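(* Let $0<\alpha\le2$, $r>2+\alpha$ and $T>0$. Assume that the (real-valued, periodic) exact solution $u$ of $$\partial_t u-\partial_{x_1}(-\Delta)^{\alpha/2}u+u\,\partial_{x_1}u=0\ \text{ on }\Omega\times(0,T],\qquad u(\cdot,0)=u_0,$$ satisfies $u\in C^1([0,T];H^r_{\mathrm{per}}(\Omega))$. For $N\ge1$ let $u_N$, with values in $\mathbb X_N$, be the semi-discrete approximation defined by $$(\partial_t u_N, v) + ((-\Delta)^{\alpha/2} u_N, \partial_{x_1} v) - \tfrac12 (u_N^2, \partial_{x_1} v) = 0 \quad \forall v\in\mathbb X_N,\qquad (u_N(0),v)=(u_0,v)\quad\forall v\in\mathbb X_N .$$ Let $K$ be a constant with $K\ge1+\tfrac12\sup_{0\le t\le T}\|\partial_{x_1}u(t)\|_{L^\infty(\Omega)}$. Then there exists a constant $C=C\left(T,\alpha,r,K,\Omega,\|u\|_{C^1([0,T];H^r_{\mathrm{per}}(\Omega))}\right)$, independent of $N$, such that $$\|u(t)-u_N(t)\|\le C N^{-r},\qquad 0\le t\le T .$$ If, in addition, $u$ and $\partial_t u$ are uniformly real-analytic in the spatial variables on $[0,T]$, then there exist positive constants $C$ and $\sigma$, independent of $N$, such that $$\|u(t)-u_N(t)\|\le C e^{-\sigma N},\qquad 0\le t\le T .$$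
   Context: $\Omega=[-\pi,\pi]^2$ with periodic boundary conditions (the two-dimensional torus), $\mathbf x=(x_1,x_2)$. All functions are real-valued. $(u,v)=\int_\Omega u\overline v\,d\mathbf x$ and $\|\cdot\|$ are the $L^2_{\mathrm{per}}(\Omega)$ inner product and norm. Fourier coefficients: $\hat f(\mathbf k)=(2\pi)^{-2}\int_\Omega f(\mathbf x)e^{-i\mathbf k\cdot\mathbf x}\,d\mathbf x$. $H^r_{\mathrm{per}}(\Omega)$ has norm $\|u\|_r^2=\sum_{\mathbf k\in\mathbb Z^2}(1+|\mathbf k|^2)^r|\hat u(\mathbf k)|^2$. $(-\Delta)^{\alpha/2}f=\sum_{\mathbf k\in\mathbb Z^2}|\mathbf k|^\alpha\hat f(\mathbf k)e^{i\mathbf k\cdot\mathbf x}$. $\mathbb X_N$ is the space of (real-valued) trigonometric polynomials in $\mathrm{span}\{e^{i\mathbf k\cdot\mathbf x}:\max\{|k_1|,|k_2|\}\le N\}$. The constant $K$ is an auxiliary parameter which enters only through the dependence of $C$. A time-dependent periodic function $f$ is uniformly real-analytic in the spatial variables on $[0,T]$ if there is $\sigma_0>0$ such that every $f(t)$, $t\in[0,T]$, extends analytically to the complex strip $\{\mathbf z\in\mathbb C^2:|\mathrm{Im}\,z_j|<\sigma_0,\ j=1,2\}$ with a bound uniform in $t$. *)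

(* Defs.v *)
From HB Require Import structures.
From mathcomp Require Import all_boot all_order all_algebra.
From mathcomp Require Import complex.
From mathcomp Require Import all_classical all_reals all_analysis.

Set Implicit Arguments.
Unset Strict Implicit.
Unset Printing Implicit Defensive.

Import Order.TTheory GRing.Theory Num.Theory.
Import numFieldNormedType.Exports.

Local Open Scope classical_set_scope.
Local Open Scope complex_scope.
Local Open Scope ring_scope.

(* Functions on the torus are 2pi-periodic functions R * R -> R; only their
   values on the fundamental cell Omega enter the integrals. *)
Section Torus.
Context {R : realType}.
Implicit Types (f g : R * R -> R) (k : int * int) (x : R * R).

Definition Omega : set (R * R) := `[- pi, pi] `*` `[- pi, pi].

Definition leb2 : {measure set (measurableTypeR R * measurableTypeR R) -> \bar R} :=
  (@lebesgue_measure R \x @lebesgue_measure R)%E.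

Definition periodic f : Prop :=
  forall x1 x2 : R, f (x1 + 2 * pi, x2) = f (x1, x2) /\
                f (x1, x2 + 2 * pi) = f (x1, x2).

(* The functions are real-valued, so the conjugate in the complex inner
   product disappears.  Both definitions return a default value when the
   integrand is not integrable: they are meant for functions satisfying
   [L2per] below. *)
Definition ip f g : R := \int[leb2]_(x in Omega) (f x * g x).
Definition L2norm f : R := Num.sqrt (ip f f).

Definition L2per f : Prop :=
  [/\ periodic f, measurable_fun setT f &
      (\int[leb2]_(x in Omega) ((f x) ^+ 2)%:E < +oo)%E].

Definition Linfnorm f : \bar R := Lnorm leb2 +oo%E (EFin \o (f \_ Omega)).

Definition cis (t : R) : R[i] := cos t +i* sin t.

Definition dotk k x : R := k.1%:~R * x.1 + k.2%:~R * x.2.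

Definition cintegral (F : R * R -> R[i]) : R[i] :=
  (\int[leb2]_(x in Omega) complex.Re (F x)) +i*
  (\int[leb2]_(x in Omega) complex.Im (F x)).

Definition fourier f k : R[i] :=
  ((2 * pi) ^- 2)%:C * cintegral (fun x => (f x)%:C * cis (- dotk k x)).

Definition modc (z : R[i]) : R := complex.Re `|z|.

Definition sqnormk k : R := k.1%:~R ^+ 2 + k.2%:~R ^+ 2.

Definition Hnorm2 (r : R) f : \bar R :=
  (\esum_(k in [set: int * int])
     ((1 + sqnormk k) `^ r * modc (fourier f k) ^+ 2)%:E)%E.

Definition Hper (r : R) f : Prop := L2per f /\ (Hnorm2 r f < +oo)%E.

Definition Hnorm (r : R) f : R := Num.sqrt (fine (Hnorm2 r f)).

Definition kbox (N : nat) : set (int * int) :=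
  [set k | `|k.1| <= N%:Z /\ `|k.2| <= N%:Z].

Definition XN (N : nat) f : Prop :=
  exists c : int * int -> R[i],
    forall x, (f x)%:C = \sum_(k \in kbox N) c k * cis (dotk k x).

(* The Fourier series is summed over the boxes [kbox n].  For real-valued f
   its box sums are real, so taking real parts loses nothing; the order of
   summation is immaterial for f in H^r with r > 1 + alpha, where the series
   converges absolutely, and for trigonometric polynomials. *)
Definition fracLap (alpha : R) f : R * R -> R := fun x =>
  limn (fun n : nat => complex.Re (\sum_(k \in kbox n)
    (Num.sqrt (sqnormk k) `^ alpha)%:C * fourier f k * cis (dotk k x))).

Definition dx1 f : R * R -> R := fun x => derive1 (fun s : R => f (s, x.2)) x.1.

Definition is_C1 (nrm : (R * R -> R) -> R) (T : R)
    (w wt : R -> R * R -> R) : Prop :=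
  forall t, 0 <= t <= T ->
    nrm (fun x => (s - t)^-1 * (w s x - w t x) - wt t x)
      @[s --> within `[0, T] t^'] --> (0 : R) /\
    nrm (fun x => wt s x - wt t x)
      @[s --> within `[0, T] (nbhs t)] --> (0 : R).

(* u is in C^1([0,T]; H^r) with time derivative ut.  For r > 1 every class in
   H^r has exactly one continuous representative; it is the one used here, so
   that u and ut can be evaluated, and u differentiated in x, pointwise. *)
Definition C1_Hper (r T : R) (u ut : R -> R * R -> R) : Prop :=
  (forall t, 0 <= t <= T ->
     [/\ Hper r (u t), continuous (u t), Hper r (ut t) & continuous (ut t)]) /\
  is_C1 (Hnorm r) T u ut.

Definition C1_norm (r T : R) (u ut : R -> R * R -> R) : R :=
  sup [set Hnorm r (u t) | t in `[0, T]] +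
  sup [set Hnorm r (ut t) | t in `[0, T]].

Definition is_solution (alpha T : R) (u0 : R * R -> R)
    (u ut : R -> R * R -> R) : Prop :=
  (forall t x, 0 < t <= T -> Omega x ->
     ut t x - dx1 (fracLap alpha (u t)) x + u t x * dx1 (u t) x = 0) /\
  (forall x, u 0 x = u0 x).

(* X_N is finite-dimensional, so the choice of the L^2 norm for time
   differentiability is immaterial. *)
Definition semidiscrete (alpha T : R) (N : nat) (u0 : R * R -> R)
    (uN : R -> R * R -> R) : Prop :=
  (forall t, 0 <= t <= T -> XN N (uN t)) /\
  (exists uNt : R -> R * R -> R,
    [/\ forall t, 0 <= t <= T -> XN N (uNt t),
        is_C1 L2norm T uN uNt &
        forall t v, 0 < t <= T -> XN N v ->
          ip (uNt t) v + ip (fracLap alpha (uN t)) (dx1 v)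
            - 2^-1 * ip (fun x => uN t x ^+ 2) (dx1 v) = 0]) /\
  (forall v, XN N v -> ip (uN 0) v = ip u0 v).

Definition strip (sigma : R) : set (R[i] * R[i]) :=
  [set z | `|complex.Im z.1| < sigma /\ `|complex.Im z.2| < sigma].

(* F is the sum of an absolutely convergent double power series on some
   polydisc around each point of D. *)
Definition analytic_on (D : set (R[i] * R[i])) (F : R[i] * R[i] -> R[i]) :
    Prop :=
  forall a, D a -> exists (c : nat -> nat -> R[i]) (rho : R), 0 < rho /\
    forall w : R[i] * R[i], modc w.1 < rho -> modc w.2 < rho ->
      (\esum_(p in [set: nat * nat])
         (modc (c p.1 p.2 * w.1 ^+ p.1 * w.2 ^+ p.2))%:E < +oo)%E /\
      modc ((\sum_(m < n) \sum_(l < n) c m l * w.1 ^+ m * w.2 ^+ l)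
            - F (a.1 + w.1, a.2 + w.2)) @[n --> \oo] --> (0 : R).

Definition unif_analytic (T : R) (w : R -> R * R -> R) : Prop :=
  exists sigma0 B : R, 0 < sigma0 /\
    forall t, 0 <= t <= T -> exists F : R[i] * R[i] -> R[i],
      [/\ analytic_on (strip sigma0) F,
          forall x, F (x.1%:C, x.2%:C) = (w t x)%:C &
          forall z, strip sigma0 z -> modc (F z) <= B].

End Torus.

(* Main.v *)
Require Import Defs.
From HB Require Import structures.
From mathcomp Require Import all_boot all_order all_algebra finmap.
From mathcomp Require Import complex.
From mathcomp Require Import all_classical all_reals all_analysis.
From mathcomp Require Import measurable_realfun.
From mathcomp Require Import ring lra zify.

(* Write P for the truncation of Fourier series to the box of size N,
   rho = u - P u and theta = P u - u_N.  A continuous function in H^r with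
   r > 2 + alpha has an absolutely convergent Fourier series, and so have its
   images under d_1, (-Delta)^(alpha/2) and d_1 (-Delta)^(alpha/2).  Testing
   with theta, the dispersive term cancels by skew-symmetry and the cubic terms
   are an exact derivative, so |theta|^2 grows at most like Gronwall's bound for
   y' <= 3 A y + A (|rho|^2 + |d_1 rho|^2).  The apparent loss of one derivative
   in d_1 rho is recovered from the equation: on the mode k it reads
   i k_1 |k|^alpha a_k = b_k + (u d_1 u)^(k), with a, b the coefficients of u and
   d_t u, and the high modes of u d_1 u are controlled by the truncation errors
   at N/2.  Hence d(N) = |d_1 u - P d_1 u|^2 satisfies
   N^(2 alpha) d(N) <= c N^(-2r) + c d(N/2), and iterating gives
   d(N) = O(N^(-2r)).

   For analytic u the coefficients decay exponentially by a discrete contour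
   shift.  Put A(y) = sum_(j < J) q^j F(x + j eta + i y) with q = e^(i kappa eta):
   on a mesh the Cauchy-Riemann equation says that
   F(z + ih) - F(z) = i (F(z + h) - F(z)) + O(h^2), so A(y + eta) is mu A(y) up to
   small errors, with |mu| >= 1 + kappa eta / 2.  As A stays bounded by J sup |F|,
   A(0) / J is exponentially small in kappa; its k-th Fourier coefficient is
   exactly a_k when k_1 = - kappa. *)

Set Implicit Arguments.
Unset Strict Implicit.
Unset Printing Implicit Defensive.

Import Order.TTheory GRing.Theory Num.Theory.
Import numFieldNormedType.Exports.

Local Open Scope classical_set_scope.
Local Open Scope complex_scope.
Local Open Scope ring_scope.

(** * Complex moduli and boxes of frequencies *)

(** Integrating u d_1 rho by parts would put the derivative on theta, which the energy does not
    control; so d_1 rho stays, and its crude bound N^(1-r) has to be improved. The iteration closes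
    for two reasons. A product of two truncations at N/2 has no mode outside the box of size N, so
    each high mode of u d_1 u carries a truncation error. And N^(2 alpha) eventually exceeds any
    fixed factor lost in passing from N/2 to N. All constants are fixed before the solution: with M
    the C^1 norm and Z a bound for the sum of (1 + |k|^2)^(1 + alpha - r), finite as r > 2 + alpha,
    the number A = Z + M^2 bounds at every time the l^1 norms of the coefficients of u and of its
    three images under d_1, (-Delta)^(alpha/2) and their product. In the contour shift the vertical
    sides are not matched by periodicity; their contribution is made negligible by taking the
    horizontal segment n times longer than the shift is high, n large. *)

Section ComplexModulus.
Context {R : realType}.
Implicit Types (z w : R[i]) (a b : R).

Lemma modcE z : modc z = Num.sqrt (complex.Re z ^+ 2 + complex.Im z ^+ 2).
Proof. by case: z. Qed.

Lemma modc_ge0 z : 0 <= modc z.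
Proof. by rewrite modcE sqrtr_ge0. Qed.

Lemma modc_sqr z : modc z ^+ 2 = complex.Re z ^+ 2 + complex.Im z ^+ 2.
Proof. by rewrite modcE sqr_sqrtr// addr_ge0 ?sqr_ge0. Qed.

Lemma normcE z : `|z| = (modc z)%:C.
Proof. by case: z. Qed.

Lemma modc0 : modc 0 = 0 :> R.
Proof. by rewrite /modc normr0. Qed.

Lemma modc1 : modc 1 = 1 :> R.
Proof. by rewrite /modc normr1. Qed.

Lemma modcN z : modc (- z) = modc z.
Proof. by rewrite /modc normrN. Qed.

Lemma modcM z w : modc (z * w) = modc z * modc w.
Proof. by rewrite /modc normrM !normcE /= mul0r subr0. Qed.

Lemma modcX z n : modc (z ^+ n) = modc z ^+ n.
Proof. by elim: n => [|n IH]; rewrite ?expr0 ?modc1// !exprS modcM IH. Qed.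

Lemma ler_modcD z w : modc (z + w) <= modc z + modc w.
Proof.
have := ler_normD z w; rewrite !normcE.
by rewrite -rmorphD/= lecR.
Qed.

Lemma ler_modcB z w : modc (z - w) <= modc z + modc w.
Proof. by rewrite -(modcN w) ler_modcD. Qed.

Lemma modc_real a : modc a%:C = `|a|.
Proof. by rewrite modcE /= expr0n addr0 sqrtr_sqr. Qed.

Lemma modc_conj z : modc (z^*)%C = modc z.
Proof. by case: z => a b; rewrite !modcE /= sqrrN. Qed.

Lemma normr_Re z : `|complex.Re z| <= modc z.
Proof.
by rewrite modcE -sqrtr_sqr ler_wsqrtr// lerDl sqr_ge0.
Qed.

Lemma normr_Im z : `|complex.Im z| <= modc z.
Proof.
by rewrite modcE -sqrtr_sqr ler_wsqrtr// lerDr sqr_ge0.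
Qed.

Lemma modc_le_ReIm z : modc z <= `|complex.Re z| + `|complex.Im z|.
Proof.
have h0 := normr_ge0 (complex.Re z); have h1 := normr_ge0 (complex.Im z).
rewrite -(@ler_pXn2r _ 2)// ?nnegrE ?modc_ge0 ?addr_ge0//.
rewrite modc_sqr -(real_normK (num_real (complex.Re z))).
by rewrite -(real_normK (num_real (complex.Im z))); nra.
Qed.

Lemma ler_modc_sum (I : Type) (s : seq I) (P : pred I) (F : I -> R[i]) :
  modc (\sum_(i <- s | P i) F i) <= \sum_(i <- s | P i) modc (F i).
Proof.
elim/big_rec2: _ => [|i x y _ h]; first by rewrite modc0.
by apply: le_trans (ler_modcD _ _) _; rewrite lerD2l.
Qed.

Lemma cReD z w : complex.Re (z + w) = complex.Re z + complex.Re w.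
Proof. by case: z; case: w. Qed.
Lemma cImD z w : complex.Im (z + w) = complex.Im z + complex.Im w.
Proof. by case: z; case: w. Qed.
Lemma cReN z : complex.Re (- z) = - complex.Re z. Proof. by case: z. Qed.
Lemma cReM z w : complex.Re (z * w) =
  complex.Re z * complex.Re w - complex.Im z * complex.Im w.
Proof. by case: z; case: w. Qed.
Lemma cImM z w : complex.Im (z * w) =
  complex.Re z * complex.Im w + complex.Im z * complex.Re w.
Proof. by case: z; case: w. Qed.

Lemma cRe_sum (I : Type) (s : seq I) (P : pred I) (F : I -> R[i]) :
  complex.Re (\sum_(i <- s | P i) F i) = \sum_(i <- s | P i) complex.Re (F i).
Proof. by elim/big_rec2: _ => // i x y _ <-; rewrite cReD. Qed.
Lemma cIm_sum (I : Type) (s : seq I) (P : pred I) (F : I -> R[i]) :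
  complex.Im (\sum_(i <- s | P i) F i) = \sum_(i <- s | P i) complex.Im (F i).
Proof. by elim/big_rec2: _ => // i x y _ <-; rewrite cImD. Qed.

Lemma complexP z w : complex.Re z = complex.Re w ->
  complex.Im z = complex.Im w -> z = w.
Proof. by case: z; case: w => ? ? ? ? /= -> ->. Qed.

Lemma mulzconj z : z * (z^*)%C = (modc z ^+ 2)%:C.
Proof.
apply: complexP; rewrite ?cReM ?cImM modc_sqr; case: z => a b /=; ring.
Qed.

Lemma cisD a b : cis (a + b) = cis a * cis b.
Proof. by apply: complexP; rewrite ?cReM ?cImM /= ?cosD// sinD addrC mulrC. Qed.

Lemma cis0 : cis 0 = 1 :> R[i].
Proof. by rewrite /cis cos0 sin0. Qed.

Lemma cis_conj a : ((cis a)^*)%C = cis (- a).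
Proof. by rewrite /cis /= cosN sinN. Qed.

Lemma modc_cis a : modc (cis a) = 1.
Proof. by rewrite modcE /= cos2Dsin2 sqrtr1. Qed.

End ComplexModulus.

Section Box.
Context {R : realType}.
Implicit Types (k l : int * int) (x : R * R).

Lemma dotkD k l x : dotk (k + l) x = dotk k x + dotk l x.
Proof. by rewrite /dotk /= !rmorphD /=; ring. Qed.

Lemma dotkN k x : dotk (- k) x = - dotk k x.
Proof. by rewrite /dotk /= !rmorphN /=; ring. Qed.

Lemma dotk0 x : dotk 0 x = 0.
Proof. by rewrite /dotk /= !mul0r addr0. Qed.

(** Explicit duplicate-free lists turn the set-indexed sums over [kbox N] into big operators over
    sequences, which can be split and reindexed. *)
Definition zseq (N : nat) : seq int := [seq i%:Z - N%:Z | i <- iota 0 N.*2.+1].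

Definition boxseq (N : nat) : seq (int * int) :=
  [seq (i, j) | i <- zseq N, j <- zseq N].

Lemma mem_zseq N (i : int) : (i \in zseq N) = (`|i| <= N%:Z).
Proof.
apply/mapP/idP => [[n]|h]; first by rewrite mem_iota => h ->; lia.
exists (absz (i + N%:Z)); last by lia.
by rewrite mem_iota; lia.
Qed.

Lemma uniq_zseq N : uniq (zseq N).
Proof. by rewrite map_inj_uniq ?iota_uniq// => a b; lia. Qed.

Lemma mem_boxseq N k : (k \in boxseq N) = (`|k.1| <= N%:Z) && (`|k.2| <= N%:Z).
Proof.
case: k => a b; rewrite -!mem_zseq /=.
apply/allpairsP/andP => [[[c d] /= [hc hd [-> ->]]]//|[ha hb]].
by exists (a, b).
Qed.

Lemma uniq_boxseq N : uniq (boxseq N).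
Proof. by apply: allpairs_uniq; rewrite ?uniq_zseq// => -[a b] [c d]. Qed.

Lemma kboxE N : kbox N = [set` boxseq N].
Proof.
apply/seteqP; split => k /=; rewrite mem_boxseq.
  by case=> -> ->.
by case/andP.
Qed.

Lemma sum_kbox (V : nmodType) N (F : int * int -> V) :
  \sum_(k \in kbox N) F k = \sum_(k <- boxseq N) F k.
Proof. by rewrite kboxE -fsbig_seq ?uniq_boxseq. Qed.

Lemma mem_boxseqN N k : (- k \in boxseq N) = (k \in boxseq N).
Proof. by rewrite !mem_boxseq /= !normrN. Qed.

Lemma boxseq_le n m k : (n <= m)%N -> k \in boxseq n -> k \in boxseq m.
Proof. by rewrite !mem_boxseq => nm /andP[h1 h2]; apply/andP; lia. Qed.

Lemma big_boxseqN (V : nmodType) N (F : int * int -> V) :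
  \sum_(k <- boxseq N) F (- k) = \sum_(k <- boxseq N) F k.
Proof.
rewrite -(big_map (fun k : int * int => - k) predT F); apply: perm_big.
apply: uniq_perm; rewrite ?uniq_boxseq// ?(map_inj_uniq (@oppr_inj _)) ?uniq_boxseq//.
move=> k; apply/mapP/idP => [[l lN ->]|kN]; first by rewrite mem_boxseqN.
by exists (- k); rewrite ?mem_boxseqN ?opprK.
Qed.

Lemma big_boxseq_split (V : nmodType) n m (F : int * int -> V) : (n <= m)%N ->
  \sum_(k <- boxseq m) F k =
  \sum_(k <- boxseq n) F k + \sum_(k <- boxseq m | k \notin boxseq n) F k.
Proof.
move=> nm; rewrite (bigID (fun k => k \in boxseq n)) /=; congr (_ + _).
rewrite -big_filter; apply: perm_big; apply: uniq_perm.
- by rewrite filter_uniq ?uniq_boxseq.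
- exact: uniq_boxseq.
move=> k; rewrite mem_filter; apply/andP/idP => [[]//|h]; split => //.
exact: boxseq_le h.
Qed.

Lemma ler_sum_boxseq n m (F : int * int -> R) : (n <= m)%N ->
  (forall k, 0 <= F k) -> \sum_(k <- boxseq n) F k <= \sum_(k <- boxseq m) F k.
Proof.
by move=> nm F0; rewrite (big_boxseq_split _ nm) lerDl sumr_ge0.
Qed.

Lemma big_boxseq_delta (V : nmodType) N k (F : int * int -> V) :
  \sum_(l <- boxseq N) (if l == k then F l else 0) =
  if k \in boxseq N then F k else 0.
Proof.
case: ifPn => kN.
  rewrite (bigD1_seq k) ?uniq_boxseq //= eqxx big1 ?addr0 // => l.
  by move/negbTE ->.
rewrite big1_seq // => l /andP[_ lN]; case: eqP => // lk.
by rewrite -lk lN in kN.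
Qed.

Lemma big_boxseq_zseq (V : nmodType) N (F : int * int -> V) :
  \sum_(k <- boxseq N) F k = \sum_(i <- zseq N) \sum_(j <- zseq N) F (i, j).
Proof. by rewrite /boxseq big_allpairs. Qed.

Lemma notin_boxseq N k : k \notin boxseq N ->
  (N%:R : R) <= Num.sqrt (sqnormk k).
Proof.
rewrite mem_boxseq negb_and -!ltNge => h.
suff: (N%:R : R) ^+ 2 <= sqnormk k.
  by move=> /ler_wsqrtr; rewrite sqrtr_sqr normr_nat.
rewrite /sqnormk -[N%:R]/((N%:Z)%:~R) !expr2 -!intrM -intrD ler_int.
by case/orP: h; nia.
Qed.

End Box.

(** * Bounded measurable functions on the torus *)

Section Integration.
Context {R : realType}.
Implicit Types (f g : R * R -> R) (k l : int * int) (x : R * R).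
Local Notation leb := (@lebesgue_measure R).
Local Notation RR := (measurableTypeR R * measurableTypeR R)%type.
Local Notation I f := (\int[leb2]_(x in Omega) f x).

(** Unlike integrability, this property is stable under products, so every integrand below is
    integrable by construction. *)
Definition bm f := @measurable_fun _ _ RR R setT f /\
  exists M : R, forall x, Omega x -> `|f x| <= M.

Lemma measurable_Omega : measurable (Omega : set RR).
Proof. by apply: measurableX; exact: measurable_itv. Qed.

Lemma leb2_Omega : leb2 (Omega : set RR) = ((2 * pi) ^+ 2 : R)%:E.
Proof.
have pi0 := @pi_gt0 R.
rewrite /leb2 /Omega /= product_measure1E; try exact: measurable_itv.
rewrite [X in (X * _)%E]lebesgue_measure_itv [X in (_ * X)%E]lebesgue_measure_itv /= !lte_fin.
have -> : - pi < pi :> R by lra.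
by rewrite -!EFinD -EFinM; congr (_%:E); ring.
Qed.

Lemma bm_integrable f : bm f -> leb2.-integrable (Omega : set RR) (EFin \o f).
Proof.
case=> mf [M hM]; apply: measurable_bounded_integrable.
- exact: measurable_Omega.
- by rewrite leb2_Omega ltry.
- exact: measurable_funTS.
- exists M; split; first exact: num_real.
  by move=> y My x /hM h; apply: le_trans h (ltW My).
Qed.

Lemma bm_cst (a : R) : bm (fun=> a).
Proof. by split; [exact: measurable_cst | exists `|a|]. Qed.

Lemma bmD f g : bm f -> bm g -> bm (fun x => f x + g x).
Proof.
case=> mf [M hM] [mg [M' hM']]; split; first exact: measurable_funD.
exists (M + M') => x xO; apply: le_trans (ler_normD _ _) _.
by rewrite lerD ?hM ?hM'.
Qed.

Lemma bmM f g : bm f -> bm g -> bm (fun x => f x * g x).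
Proof.
case=> mf [M hM] [mg [M' hM']]; split; first exact: measurable_funM.
by exists (M * M') => x xO; rewrite normrM ler_pM ?hM ?hM'.
Qed.

Lemma bmZ (a : R) f : bm f -> bm (fun x => a * f x).
Proof. by move=> h; apply: bmM => //; exact: bm_cst. Qed.

Lemma bmN f : bm f -> bm (fun x => - f x).
Proof.
by move=> /(bmZ (-1)); congr bm; apply/funext => x; rewrite mulN1r.
Qed.

Lemma bmB f g : bm f -> bm g -> bm (fun x => f x - g x).
Proof. by move=> hf /bmN; exact: bmD. Qed.

Lemma bmX f n : bm f -> bm (fun x => f x ^+ n).
Proof.
move=> hf; elim: n => [|n IH].
  by rewrite (_ : (fun _ => _) = (fun=> 1)); [exact: bm_cst|apply/funext => x; rewrite expr0].
rewrite (_ : (fun _ => _) = (fun x => f x * f x ^+ n)); first exact: bmM.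
by apply/funext => x; rewrite exprS.
Qed.

Lemma bm_norm f : bm f -> bm (fun x => `|f x|).
Proof.
case=> mf [M hM]; split; first exact: measurableT_comp.
by exists M => x xO; rewrite normr_id hM.
Qed.

Lemma ID f g : bm f -> bm g -> I (fun x => f x + g x) = I f + I g.
Proof.
by move=> /bm_integrable hf /bm_integrable hg; rewrite RintegralD//; exact: measurable_Omega.
Qed.

Lemma IB f g : bm f -> bm g -> I (fun x => f x - g x) = I f - I g.
Proof.
by move=> /bm_integrable hf /bm_integrable hg; rewrite RintegralB//; exact: measurable_Omega.
Qed.

Lemma IZ a f : bm f -> I (fun x => a * f x) = a * I f.
Proof.
by move=> /bm_integrable hf; rewrite RintegralZl//; exact: measurable_Omega.
Qed.

Lemma IN f : bm f -> I (fun x => - f x) = - I f.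
Proof.
move=> hf; rewrite -mulN1r -(IZ _ hf); congr Rintegral.
by apply/funext => x; rewrite mulN1r.
Qed.

Lemma I_cst (a : R) : I (fun=> a) = a * (2 * pi) ^+ 2.
Proof. by rewrite Rintegral_cst ?leb2_Omega//; exact: measurable_Omega. Qed.

Lemma le_I f g : bm f -> bm g -> (forall x, Omega x -> f x <= g x) -> I f <= I g.
Proof.
move=> /bm_integrable hf /bm_integrable hg; apply: (@le_Rintegral _ RR _ leb2 Omega f g) => //.
exact: measurable_Omega.
Qed.

Lemma le_norm_I f M : bm f -> (forall x, Omega x -> `|f x| <= M) ->
  `|I f| <= M * (2 * pi) ^+ 2.
Proof.
move=> hf hM; rewrite -I_cst; apply: le_trans (le_normr_Rintegral _ _) _.
- exact: measurable_Omega.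
- exact: bm_integrable.
- by apply: le_I => //; [exact: bm_norm|exact: bm_cst].
Qed.

Lemma eq_I f g : (forall x, Omega x -> f x = g x) -> I f = I g.
Proof. by move=> h; apply: eq_Rintegral => x /set_mem /h. Qed.

Lemma I_ge0 f : (forall x, Omega x -> 0 <= f x) -> 0 <= I f.
Proof. exact: (@Rintegral_ge0 _ RR _ leb2 Omega f). Qed.

Lemma bm_restrict_integrable f : bm f ->
  leb2.-integrable (setT : set RR) (EFin \o (f \_ Omega)).
Proof.
move=> /bm_integrable; rewrite -restrict_EFin => h.
by apply/integrable_restrict => //; [exact: measurable_Omega | rewrite setTI].
Qed.

Lemma mem_OmegaE (a b : R) :
  ((a, b) \in (Omega : set (R * R))) =
  (a \in `[- pi, pi]%classic) && (b \in `[- pi, pi]%classic).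
Proof.
apply/idP/andP => [/set_mem[/= ha hb]|[/set_mem ha /set_mem hb]].
  by split; apply: mem_set.
by apply: mem_set.
Qed.

Lemma I_fubini1 f : bm f ->
  (I f)%:E = (\int[leb]_(x2 in `[(- pi)%R, pi%R]) \int[leb]_(x1 in `[(- pi)%R, pi%R]) (f (x1, x2))%:E)%E.
Proof.
move=> hf; rewrite fineK; last first.
  by apply: integrable_fin_num; [exact: measurable_Omega|exact: bm_integrable].
(* The product measure lives on the whole plane, so [f] is extended by zero outside [Omega] before
   the order of integration is exchanged. *)
rewrite integral_mkcond restrict_EFin.
rewrite /leb2 -(integral21_prod_meas1 (bm_restrict_integrable hf)).
rewrite [RHS]integral_mkcond; apply: eq_integral => x2 _; rewrite /fubini_G /patch.
case: ifPn => x2O.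
  rewrite [RHS]integral_mkcond; apply: eq_integral => x1 _ /=; rewrite /patch.
  by rewrite mem_OmegaE x2O andbT; case: ifP.
apply: integral0_eq => x1 _ /=; rewrite /patch mem_OmegaE.
by rewrite (negbTE x2O) andbF.
Qed.

Lemma I_fubini2 f : bm f ->
  (I f)%:E = (\int[leb]_(x1 in `[(- pi)%R, pi%R]) \int[leb]_(x2 in `[(- pi)%R, pi%R]) (f (x1, x2))%:E)%E.
Proof.
move=> hf; rewrite fineK; last first.
  by apply: integrable_fin_num; [exact: measurable_Omega|exact: bm_integrable].
rewrite integral_mkcond restrict_EFin.
rewrite /leb2 -(integral12_prod_meas1 (bm_restrict_integrable hf)).
rewrite [RHS]integral_mkcond; apply: eq_integral => x1 _; rewrite /fubini_F /patch.
case: ifPn => x1O.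
  rewrite [RHS]integral_mkcond; apply: eq_integral => x3 _ /=; rewrite /patch.
  by rewrite mem_OmegaE x1O /=; case: ifP.
apply: integral0_eq => x3 _ /=; rewrite /patch mem_OmegaE.
by rewrite (negbTE x1O).
Qed.

Lemma integral_derive_periodic (F G : R -> R) :
  (forall s : R, is_derive s (1 : R) F (G s)) -> continuous G -> F pi = F (- pi) ->
  (\int[leb]_(s in `[(- pi)%R, pi%R]) (G s)%:E = 0)%E.
Proof.
move=> dF cG Fpi; have pi0 := @pi_gt0 R.
have cF : continuous F.
  by move=> s; apply: differentiable_continuous; apply/derivable1_diffP; case: (dF s).
rewrite (@continuous_FTC2 _ G F).
- by rewrite Fpi -EFinB subrr.
- by lra.
- exact: continuous_subspaceT.
- split.
  + by move=> s _; case: (dF s).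
  + by apply: cvg_at_right_filter; exact: cF.
  + by apply: cvg_at_left_filter; exact: cF.
- by move=> s _; rewrite derive1E; apply: derive_val.
Qed.

(** Integration by parts takes this form throughout: a periodic antiderivative in one variable is
    exhibited, and Fubini reduces the claim to the fundamental theorem of calculus. *)
Lemma I_derive1_eq0 (g g1 : R * R -> R) : bm g1 ->
  (forall x2 s : R, is_derive s (1 : R) (fun s => g (s, x2)) (g1 (s, x2))) ->
  (forall x2 : R, continuous (fun s => g1 (s, x2))) ->
  (forall x2 : R, g (pi, x2) = g (- pi, x2)) -> I g1 = 0.
Proof.
move=> hg d c p; apply: EFin_inj; rewrite I_fubini1//.
by apply: integral0_eq => x2 _; apply: (@integral_derive_periodic (fun s => g (s, x2))).
Qed.

Lemma I_derive2_eq0 (g g1 : R * R -> R) : bm g1 ->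
  (forall x1 s : R, is_derive s (1 : R) (fun s => g (x1, s)) (g1 (x1, s))) ->
  (forall x1 : R, continuous (fun s => g1 (x1, s))) ->
  (forall x1 : R, g (x1, pi) = g (x1, - pi)) -> I g1 = 0.
Proof.
move=> hg d c p; apply: EFin_inj; rewrite I_fubini2//.
by apply: integral0_eq => x2 _; apply: (@integral_derive_periodic (fun s => g (x2, s))).
Qed.

End Integration.

(** * Fourier coefficients and trigonometric polynomials *)

Section FourierBasics.
Context {R : realType}.
Implicit Types (f g : R * R -> R) (F G : R * R -> R[i]).
Implicit Types (k l : int * int) (x : R * R) (c : int * int -> R[i]).
Local Notation RR := (measurableTypeR R * measurableTypeR R)%type.
Local Notation I f := (\int[leb2]_(x in Omega) f x).
Local Notation e k := (fun x => cis (dotk k x)).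

Definition bmc F := bm (fun x => complex.Re (F x)) /\ bm (fun x => complex.Im (F x)).

Lemma bmc_cst (z : R[i]) : bmc (fun=> z).
Proof. by split; exact: bm_cst. Qed.

Lemma bmcD F G : bmc F -> bmc G -> bmc (fun x => F x + G x).
Proof.
case=> h1 h2 [h3 h4]; split.
  by under eq_fun do rewrite cReD; exact: bmD.
by under eq_fun do rewrite cImD; exact: bmD.
Qed.

Lemma bmcM F G : bmc F -> bmc G -> bmc (fun x => F x * G x).
Proof.
case=> h1 h2 [h3 h4]; split.
  by under eq_fun do rewrite cReM; apply: bmB; exact: bmM.
by under eq_fun do rewrite cImM; apply: bmD; exact: bmM.
Qed.

Lemma bmc_sum (T : Type) (s : seq T) (H : T -> R * R -> R[i]) :
  (forall i, bmc (H i)) -> bmc (fun x => \sum_(i <- s) H i x).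
Proof.
move=> h; elim: s => [|i s IH].
  by under eq_fun do rewrite big_nil; exact: bmc_cst.
by under eq_fun do rewrite big_cons; exact: bmcD.
Qed.

Lemma bmc_real f : bm f -> bmc (fun x => (f x)%:C).
Proof. by move=> h; split => //=; exact: bm_cst. Qed.

Lemma measurable_dotk k : measurable_fun setT (dotk k : RR -> R).
Proof.
apply: measurable_funD; apply: measurable_funM.
- exact: measurable_cst.
- exact: measurable_fst.
- exact: measurable_cst.
- exact: measurable_snd.
Qed.

Lemma bmc_cis k : bmc (e k).
Proof.
split; split.
- apply: measurableT_comp (measurable_dotk k).
  by apply: continuous_measurable_fun; exact: continuous_cos.
- by exists 1 => x _; exact: cos_max.
- apply: measurableT_comp (measurable_dotk k).
  by apply: continuous_measurable_fun; exact: continuous_sin.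
- by exists 1 => x _; exact: sin_max.
Qed.

Lemma cID F G : bmc F -> bmc G ->
  cintegral (fun x => F x + G x) = cintegral F + cintegral G.
Proof.
case=> h1 h2 [h3 h4]; apply: complexP; rewrite ?cReD ?cImD /=.
  by under eq_Rintegral do rewrite cReD; rewrite ID.
by under eq_Rintegral do rewrite cImD; rewrite ID.
Qed.

Lemma cIZ (z : R[i]) F : bmc F ->
  cintegral (fun x => z * F x) = z * cintegral F.
Proof.
case=> h1 h2; apply: complexP; rewrite ?cReM ?cImM /=.
  by under eq_Rintegral do rewrite cReM; rewrite IB ?IZ//; exact: bmZ.
by under eq_Rintegral do rewrite cImM; rewrite ID ?IZ//; exact: bmZ.
Qed.

Lemma cI_sum (T : Type) (s : seq T) (H : T -> R * R -> R[i]) :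
  (forall i, bmc (H i)) ->
  cintegral (fun x => \sum_(i <- s) H i x) = \sum_(i <- s) cintegral (H i).
Proof.
move=> h; elim: s => [|i s IH].
  under eq_fun do rewrite big_nil.
  by rewrite big_nil; apply: complexP; rewrite /= I_cst mul0r.
under eq_fun do rewrite big_cons.
by rewrite cID ?IH ?big_cons//; exact: bmc_sum.
Qed.

Lemma cI_real f : cintegral (fun x => (f x)%:C) = (I f)%:C.
Proof. by apply: complexP; rewrite //= I_cst mul0r. Qed.

(** The two arguments differ by [n] periods. *)
Lemma intr_mul_pi (n : int) (a : R) : sin (n%:~R * pi + a) = sin (- (n%:~R * pi) + a) :> R.
Proof.
have H (m : nat) b : sin (m%:R * pi + b) = sin (- (m%:R * pi) + b) :> R.
  rewrite -[in LHS](addrNK (m%:R * pi) b).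
  have -> : m%:R * pi + (b - m%:R * pi + m%:R * pi) = (- (m%:R * pi) + b) + (pi *+ 2) *+ m.
    by rewrite -mulr_natl -(mulr_natl pi); ring.
  by rewrite (periodicn (@sinD2pi R)).
case: n => m; first exact: H.
by rewrite NegzE rmorphN /= mulNr opprK H.
Qed.

Lemma intr_mul_pi_cos (n : int) (a : R) : cos (n%:~R * pi + a) = cos (- (n%:~R * pi) + a) :> R.
Proof.
have := intr_mul_pi n (a + pi / 2).
by rewrite !addrA !sinDpihalf.
Qed.

Lemma continuous_affine_cos (a b : R) : continuous (fun s : R => cos (a * s + b)).
Proof.
move=> s; apply: (@continuous_comp _ _ _ (fun s => a * s + b) cos).
  by apply: cvgD; [apply: cvgM; [exact: cvg_cst|exact: cvg_id]|exact: cvg_cst].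
exact: continuous_cos.
Qed.

Lemma continuous_affine_sin (a b : R) : continuous (fun s : R => sin (a * s + b)).
Proof.
move=> s; apply: (@continuous_comp _ _ _ (fun s => a * s + b) sin).
  by apply: cvgD; [apply: cvgM; [exact: cvg_cst|exact: cvg_id]|exact: cvg_cst].
exact: continuous_sin.
Qed.

Lemma is_derive_affine_cos (a b s : R) :
  is_derive s (1 : R) (fun s => cos (a * s + b)) (- a * sin (a * s + b)).
Proof.
have h : is_derive s (1 : R) (fun s => a * s + b) a.
  have := is_deriveD (is_deriveZ a (is_derive_id s (1 : R))) (is_derive_cst b s (1 : R)).
  by move=> h; apply: (is_derive_eq h); rewrite addr0 /GRing.scale /= mulr1.
have := @is_derive1_comp R cos (fun s => a * s + b) s _ _ (is_derive_cos (a * s + b)) h.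
by rewrite mulrC mulrN mulNr.
Qed.

Lemma is_derive_affine_sin (a b s : R) :
  is_derive s (1 : R) (fun s => sin (a * s + b)) (a * cos (a * s + b)).
Proof.
have h : is_derive s (1 : R) (fun s => a * s + b) a.
  have := is_deriveD (is_deriveZ a (is_derive_id s (1 : R))) (is_derive_cst b s (1 : R)).
  by move=> h; apply: (is_derive_eq h); rewrite addr0 /GRing.scale /= mulr1.
have := @is_derive1_comp R sin (fun s => a * s + b) s _ _ (is_derive_sin (a * s + b)) h.
by rewrite mulrC.
Qed.

(** Orthogonality of the characters: if [k] is not zero, the exponential has a periodic
    antiderivative in a variable whose frequency does not vanish. *)
Lemma cI_cis k : cintegral (e k) = if k == 0 then ((2 * pi) ^+ 2)%:C else 0.
Proof.
case: eqP => [->|k0].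
  under eq_fun do rewrite dotk0 cis0.
  by rewrite -[1]/((1 : R)%:C) cI_real I_cst mul1r.
have [bc bs] := bmc_cis k.
have [k1|k1] := eqVneq k.1 0; last first.
  have k1r : (k.1%:~R : R) != 0 by rewrite intr_eq0.
  apply: complexP => /=.
    apply: (@I_derive1_eq0 _ (fun x => k.1%:~R^-1 * sin (k.1%:~R * x.1 + k.2%:~R * x.2))) => //=.
    - move=> x2 s.
      have := is_deriveZ k.1%:~R^-1 (is_derive_affine_sin (k.1%:~R) (k.2%:~R * x2) s).
      by move=> h; apply: (is_derive_eq h); rewrite /GRing.scale /= mulrA mulVf ?mul1r.
    - by move=> x2; exact: (@continuous_affine_cos k.1%:~R (k.2%:~R * x2)).
    - by move=> x2; rewrite intr_mul_pi mulrN.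
  apply: (@I_derive1_eq0 _ (fun x => (- k.1%:~R^-1) * cos (k.1%:~R * x.1 + k.2%:~R * x.2))) => //=.
  - move=> x2 s.
    have := is_deriveZ (- k.1%:~R^-1) (is_derive_affine_cos (k.1%:~R) (k.2%:~R * x2) s).
    by move=> h; apply: (is_derive_eq h); rewrite /GRing.scale /= mulrA mulrNN mulVf ?mul1r.
  - by move=> x2; exact: (@continuous_affine_sin k.1%:~R (k.2%:~R * x2)).
  - by move=> x2; rewrite intr_mul_pi_cos mulrN.
have k2r : (k.2%:~R : R) != 0.
  rewrite intr_eq0; apply/eqP => k2; apply: k0.
  by case: k k1 k2 {bc bs} => a b /= -> ->.
apply: complexP => /=.
  apply: (@I_derive2_eq0 _ (fun x => k.2%:~R^-1 * sin (k.2%:~R * x.2 + k.1%:~R * x.1))) => //=.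
  - move=> x2 s; rewrite /dotk /= addrC.
    have := is_deriveZ k.2%:~R^-1 (is_derive_affine_sin (k.2%:~R) (k.1%:~R * x2) s).
    by move=> h; apply: (is_derive_eq h); rewrite /GRing.scale /= mulrA mulVf ?mul1r.
  - move=> x2; rewrite /dotk /=; under eq_fun do rewrite addrC.
    exact: continuous_affine_cos.
  - by move=> x2; rewrite intr_mul_pi mulrN.
apply: (@I_derive2_eq0 _ (fun x => (- k.2%:~R^-1) * cos (k.2%:~R * x.2 + k.1%:~R * x.1))) => //=.
- move=> x2 s; rewrite /dotk /= addrC.
  have := is_deriveZ (- k.2%:~R^-1) (is_derive_affine_cos (k.2%:~R) (k.1%:~R * x2) s).
  by move=> h; apply: (is_derive_eq h); rewrite /GRing.scale /= mulrA mulrNN mulVf ?mul1r.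
- move=> x2; rewrite /dotk /=; under eq_fun do rewrite addrC.
  exact: continuous_affine_sin.
- by move=> x2; rewrite intr_mul_pi_cos mulrN.
Qed.

(** The area of [Omega], which normalises the Fourier coefficients. *)
Definition cell : R := (2 * pi) ^+ 2.

Lemma cell_gt0 : 0 < cell.
Proof. by rewrite /cell exprn_gt0// mulr_gt0// pi_gt0. Qed.

Lemma fourierE f k :
  fourier f k = (cell^-1)%:C * cintegral (fun x => (f x)%:C * cis (dotk (- k) x)).
Proof. by rewrite /fourier; under eq_fun do rewrite -dotkN. Qed.

Lemma cI_fourier f k :
  cintegral (fun x => (f x)%:C * cis (dotk (- k) x)) = cell%:C * fourier f k.
Proof.
by rewrite fourierE mulrA -rmorphM /= divff ?mul1r// gt_eqF// cell_gt0.
Qed.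

Lemma bmc_fourier f k : bm f -> bmc (fun x => (f x)%:C * cis (dotk k x)).
Proof. by move=> h; apply: bmcM; [exact: bmc_real|exact: bmc_cis]. Qed.

Lemma fourierD f g k : bm f -> bm g ->
  fourier (fun x => f x + g x) k = fourier f k + fourier g k.
Proof.
move=> hf hg; rewrite !fourierE -mulrDr -cID; try exact: bmc_fourier.
by under [in LHS]eq_fun do rewrite rmorphD /= mulrDl.
Qed.

Lemma fourierZ (a : R) f k : bm f ->
  fourier (fun x => a * f x) k = a%:C * fourier f k.
Proof.
move=> hf; rewrite !fourierE mulrCA -[a%:C * cintegral _]cIZ; last exact: bmc_fourier.
by under [in LHS]eq_fun do rewrite rmorphM /= -mulrA.
Qed.

Lemma fourierN f k : bm f -> fourier (fun x => - f x) k = - fourier f k.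
Proof.
move=> hf; under [in LHS]eq_fun do rewrite -mulN1r.
by rewrite fourierZ// rmorphN rmorph1 mulN1r.
Qed.

Lemma fourierB f g k : bm f -> bm g ->
  fourier (fun x => f x - g x) k = fourier f k - fourier g k.
Proof. by move=> hf hg; rewrite fourierD ?fourierN//; exact: bmN. Qed.

Lemma fourier_conj f k : bm f -> fourier f (- k) = ((fourier f k)^*)%C.
Proof.
move=> hf; have [h1 h2] := bmc_fourier (- k) hf.
rewrite !fourierE opprK rmorphM; congr (_ * _); first by rewrite /= oppr0.
apply: complexP => /=.
  by apply: eq_I => x _; rewrite dotkN cosN !mul0r.
rewrite -IN//.
by apply: eq_I => x _; rewrite dotkN sinN !mul0r !addr0 mulrN opprK.
Qed.

(** The factor 2 comes from bounding real and imaginary parts separately. *)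
Lemma modc_fourier_le f k (M : R) : bm f -> (forall x, Omega x -> `|f x| <= M) ->
  modc (fourier f k) <= 2 * M.
Proof.
move=> hf hM; have [h1 h2] := bmc_fourier (- k) hf.
rewrite fourierE modcM modc_real ger0_norm ?invr_ge0 ?(ltW cell_gt0)//.
rewrite ler_pdivrMl ?cell_gt0//.
apply: le_trans (modc_le_ReIm _) _ => /=.
have H (h : R * R -> R) : bm h -> (forall x, Omega x -> `|h x| <= M) ->
  `|I h| <= M * cell by exact: le_norm_I.
have -> : cell * (2 * M) = M * cell + M * cell by ring.
apply: lerD; apply: H => // x /hM hx.
  by rewrite mul0r subr0 normrM (le_trans _ hx)// ler_piMr ?cos_max.
by rewrite mul0r addr0 normrM (le_trans _ hx)// ler_piMr ?sin_max.
Qed.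

Definition tp N c x : R[i] := \sum_(k <- boxseq N) c k * cis (dotk k x).

Lemma bmc_tp N c : bmc (tp N c).
Proof. by apply: bmc_sum => k; apply: bmcM; [exact: bmc_cst|exact: bmc_cis]. Qed.

Lemma cI_tp_cis N c k :
  cintegral (fun x => tp N c x * cis (dotk (- k) x)) =
  if k \in boxseq N then cell%:C * c k else 0.
Proof.
rewrite -(big_boxseq_delta N k (fun k => cell%:C * c k)).
under eq_fun do rewrite mulr_suml.
rewrite cI_sum; last first.
  by move=> l; apply: bmcM; [apply: bmcM; [exact: bmc_cst|]|]; exact: bmc_cis.
apply: eq_bigr => l _; under eq_fun do rewrite -mulrA -cisD -dotkD.
rewrite cIZ; last exact: bmc_cis.
by rewrite cI_cis subr_eq0; case: eqP => _; rewrite ?mulr0// mulrC.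
Qed.

Lemma fourier_tp N c f k : (forall x, Omega x -> (f x)%:C = tp N c x) ->
  fourier f k = if k \in boxseq N then c k else 0.
Proof.
move=> h; rewrite fourierE.
have -> : cintegral (fun x => (f x)%:C * cis (dotk (- k) x)) =
          cintegral (fun x => tp N c x * cis (dotk (- k) x)).
  by apply: complexP; apply: eq_I => x /h ->.
rewrite cI_tp_cis; case: ifP => _; last by rewrite mulr0.
by rewrite mulrA -rmorphM /= mulVf ?mul1r// gt_eqF// cell_gt0.
Qed.

Lemma tp_bm N c f : (forall x, (f x)%:C = tp N c x) -> bm f.
Proof.
by move=> h; have [] := bmc_tp N c; under eq_fun do rewrite -h /=.
Qed.

Lemma conj_sum_cis (s : seq (int * int)) c x :
  ((\sum_(k <- s) c k * cis (dotk k x))^*)%C =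
  \sum_(k <- s) ((c k)^*)%C * cis (dotk (- k) x).
Proof.
rewrite rmorph_sum; apply: eq_bigr => k _.
by rewrite rmorphM /= dotkN -cis_conj.
Qed.

Lemma ip_tp N c f v : bm f -> (forall x, (v x)%:C = tp N c x) ->
  (ip f v)%:C = cell%:C * \sum_(k <- boxseq N) fourier f k * ((c k)^*)%C.
Proof.
move=> hf hv; rewrite /ip -cI_real.
(* As [v] is real, its expansion may be conjugated; integrated against [f], the conjugated
   characters give the coefficients of [f] at [k] itself. *)
have vE x : (v x)%:C = \sum_(k <- boxseq N) ((c k)^*)%C * cis (dotk (- k) x).
  have -> : (v x)%:C = (((v x)%:C)^*)%C by rewrite /= oppr0.
  by rewrite hv conj_sum_cis.
under eq_fun do rewrite rmorphM /= vE mulr_sumr.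
rewrite cI_sum; last first.
  move=> k; apply: bmcM; first exact: bmc_real.
  by apply: bmcM; [exact: bmc_cst|exact: bmc_cis].
rewrite mulr_sumr; apply: eq_bigr => k _.
under eq_fun do rewrite mulrCA.
rewrite cIZ; last exact: bmc_fourier.
by rewrite cI_fourier mulrCA [X in _ * X]mulrC.
Qed.

(** With [p] the partial sum over [s], the integral of |f - p|^2 is nonnegative and equals
    [ip f f - cell * S], since both cross terms and the square of [p] integrate to [cell * S]. The
    list [s] need not be symmetric, so [p] may be complex; this covers the complement of one box in
    another. *)
Lemma bessel (s : seq (int * int)) f : uniq s -> bm f ->
  \sum_(k <- s) modc (fourier f k) ^+ 2 <= cell^-1 * ip f f.
Proof.
move=> us hf; set a := fourier f.
pose p x := \sum_(k <- s) a k * cis (dotk k x).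
pose q x := \sum_(k <- s) ((a k)^*)%C * cis (dotk (- k) x).
have pq x : q x = ((p x)^*)%C.
  by rewrite /p conj_sum_cis.
have bp : bmc p by apply: bmc_sum => k; apply: bmcM; [exact: bmc_cst|exact: bmc_cis].
have bq : bmc q by apply: bmc_sum => k; apply: bmcM; [exact: bmc_cst|exact: bmc_cis].
have bf := bmc_real hf.
set S := \sum_(k <- s) modc (a k) ^+ 2.
have fq : cintegral (fun x => (f x)%:C * q x) = (cell * S)%:C.
  under eq_fun do rewrite /q mulr_sumr.
  rewrite cI_sum; last first.
    by move=> k; apply: bmcM => //; apply: bmcM; [exact: bmc_cst|exact: bmc_cis].
  rewrite /S mulr_sumr rmorph_sum; apply: eq_bigr => k _.
  under eq_fun do rewrite mulrCA.
  rewrite cIZ ?cI_fourier; last exact: bmc_fourier.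
  rewrite -/(a k) mulrCA [_ * a k]mulrC mulzconj.
  by rewrite -rmorphM.
have pq' : cintegral (fun x => p x * q x) = (cell * S)%:C.
  under eq_fun do rewrite /q mulr_sumr.
  rewrite cI_sum; last first.
    by move=> k; apply: bmcM => //; apply: bmcM; [exact: bmc_cst|exact: bmc_cis].
  rewrite /S mulr_sumr rmorph_sum; apply: eq_big_seq => k ks.
  under eq_fun do rewrite mulrCA.
  rewrite cIZ; last by apply: bmcM => //; exact: bmc_cis.
  have -> : cintegral (fun x => p x * cis (dotk (- k) x)) = cell%:C * a k.
    under eq_fun do rewrite /p mulr_suml.
    rewrite cI_sum; last first.
      by move=> l; apply: bmcM; [apply: bmcM; [exact: bmc_cst|]|]; exact: bmc_cis.
    rewrite (bigD1_seq k)//= big1 => [|l lk]; last first.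
      under eq_fun do rewrite -mulrA -cisD -dotkD.
      by rewrite cIZ ?cI_cis ?subr_eq0 ?(negbTE lk) ?mulr0//; exact: bmc_cis.
    under eq_fun do rewrite -mulrA -cisD -dotkD.
    by rewrite cIZ ?cI_cis ?subrr ?eqxx ?addr0 1?mulrC//; exact: bmc_cis.
  by rewrite mulrCA [_ * a k]mulrC mulzconj -rmorphM.
have pf : cintegral (fun x => (f x)%:C * p x) = (cell * S)%:C.
  under eq_fun do rewrite /p mulr_sumr.
  rewrite cI_sum; last first.
    by move=> k; apply: bmcM => //; apply: bmcM; [exact: bmc_cst|exact: bmc_cis].
  rewrite /S mulr_sumr rmorph_sum; apply: eq_bigr => k _.
  under eq_fun do rewrite mulrCA.
  rewrite cIZ; last exact: bmc_fourier.
  have := cI_fourier f (- k); rewrite opprK fourier_conj// => ->.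
  by rewrite mulrCA mulzconj -rmorphM.
have key : (0 <= I (fun x => modc ((f x)%:C - p x) ^+ 2)).
  by apply: I_ge0 => x _; rewrite sqr_ge0.
have : (I (fun x => modc ((f x)%:C - p x) ^+ 2))%:C =
  (ip f f - cell * S)%:C.
  rewrite -cI_real.
  have -> : (fun x => (modc ((f x)%:C - p x) ^+ 2)%:C) =
    (fun x => (f x * f x)%:C + ((-1) * ((f x)%:C * q x) + ((-1) * ((f x)%:C * p x) + p x * q x))).
    apply/funext => x; rewrite pq; case: (p x) => y z.
    by apply: complexP; rewrite /= ?modc_sqr /=; ring.
  rewrite cID; first last.
  - apply: bmcD; first by apply: bmcM; [exact: bmc_cst|exact: bmcM].
    apply: bmcD; last exact: bmcM.
    by apply: bmcM; [exact: bmc_cst|exact: bmcM].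
  - by apply: bmc_real; exact: bmM.
  rewrite cID; first last.
  - apply: bmcD; last exact: bmcM.
    by apply: bmcM; [exact: bmc_cst|exact: bmcM].
  - by apply: bmcM; [exact: bmc_cst|exact: bmcM].
  rewrite cID; first last.
  - exact: bmcM.
  - by apply: bmcM; [exact: bmc_cst|exact: bmcM].
  rewrite !cIZ; try exact: bmcM.
  by rewrite fq pq' pf cI_real /ip rmorphB /=; ring.
case=> E; rewrite E subr_ge0 in key.
by rewrite mulrC ler_pdivlMr ?cell_gt0// mulrC.
Qed.

End FourierBasics.

(** * Uniqueness of Fourier coefficients *)

Section FourierUniqueness.
Context {R : realType}.
Implicit Types (f g : R * R -> R) (F G : R * R -> R[i]).
Implicit Types (k l : int * int) (x : R * R).
Local Notation RR := (measurableTypeR R * measurableTypeR R)%type.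
Local Notation I f := (\int[leb2]_(x in Omega) f x).

(** Frequencies may be repeated in the list, so that a sum is a concatenation and a product a list
    of pairs. *)
Definition trigpoly F := exists s : seq (R[i] * (int * int)),
  forall x, F x = \sum_(p <- s) p.1 * cis (dotk p.2 x).

Lemma trigpoly_cst (z : R[i]) : trigpoly (fun=> z).
Proof.
exists [:: (z, 0)] => x; by rewrite big_seq1 /= dotk0 cis0 mulr1.
Qed.

Lemma trigpoly_cis k : trigpoly (fun x => cis (dotk k x)).
Proof. by exists [:: (1, k)] => x; rewrite big_seq1 mul1r. Qed.

Lemma trigpolyD F G : trigpoly F -> trigpoly G -> trigpoly (fun x => F x + G x).
Proof. by move=> [s hs] [t ht]; exists (s ++ t) => x; rewrite big_cat hs ht. Qed.

Lemma trigpolyM F G : trigpoly F -> trigpoly G -> trigpoly (fun x => F x * G x).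
Proof.
move=> [s hs] [t ht].
exists [seq (p.1 * q.1, p.2 + q.2) | p <- s, q <- t] => x.
rewrite big_allpairs_dep hs ht big_distrl /=; apply: eq_bigr => p _.
rewrite big_distrr /=; apply: eq_bigr => q _.
by rewrite dotkD cisD mulrACA.
Qed.

Lemma trigpolyX F n : trigpoly F -> trigpoly (fun x => F x ^+ n).
Proof.
move=> hF; elim: n => [|n IH].
  by under eq_fun do rewrite expr0; exact: trigpoly_cst.
by under eq_fun do rewrite exprS; exact: trigpolyM.
Qed.

Lemma I_trigpoly_eq0 f g : bm g -> (forall k, fourier g k = 0) ->
  trigpoly (fun x => (f x)%:C) -> I (fun x => g x * f x) = 0.
Proof.
move=> hg g0 [s hs].
have : (I (fun x => g x * f x))%:C = 0.
  rewrite -cI_real; under eq_fun do rewrite rmorphM /= hs mulr_sumr.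
  rewrite cI_sum; last first.
    move=> p; apply: bmcM; first exact: bmc_real.
    by apply: bmcM; [exact: bmc_cst|exact: bmc_cis].
  rewrite big1 // => p _; under eq_fun do rewrite mulrCA.
  rewrite cIZ; last exact: bmc_fourier.
  by have := cI_fourier g (- p.2); rewrite opprK g0 mulr0 => ->; rewrite mulr0.
by case.
Qed.

Lemma periodic_int f (m n : int) (a b : R) : Defs.periodic f ->
  f (a + 2 * pi * m%:~R, b + 2 * pi * n%:~R) = f (a, b).
Proof.
move=> pf.
have H1 (j : nat) (c d : R) : f (c + 2 * pi * j%:R, d) = f (c, d).
  elim: j c => [|j IH] c; first by rewrite mulr0 addr0.
  rewrite -[j.+1%:R]natr1 mulrDr mulr1 addrA.
  by rewrite (pf _ _).1 IH.
have H2 (j : nat) (c d : R) : f (c, d + 2 * pi * j%:R) = f (c, d).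
  elim: j d => [|j IH] d; first by rewrite mulr0 addr0.
  rewrite -[j.+1%:R]natr1 mulrDr mulr1 addrA.
  by rewrite (pf _ _).2 IH.
have H3 (j : int) (c d : R) : f (c + 2 * pi * j%:~R, d) = f (c, d).
  case: j => j; first exact: H1.
  by rewrite NegzE rmorphN /= mulrN -(H1 j.+1 (c - _)) addrNK.
have H4 (j : int) (c d : R) : f (c, d + 2 * pi * j%:~R) = f (c, d).
  case: j => j; first exact: H2.
  by rewrite NegzE rmorphN /= mulrN -(H2 j.+1 _ (d - _)) addrNK.
by rewrite H3 H4.
Qed.

Lemma reduce_mod2pi (a : R) : exists n : int, - pi <= a + 2 * pi * n%:~R <= pi.
Proof.
have pi0 := @pi_gt0 R.
exists (- Num.floor ((a + pi) / (2 * pi))).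
have := floor_itv ((a + pi) / (2 * pi)); set m := Num.floor _.
rewrite rmorphN /= rmorphD /= => /andP[].
rewrite ler_pdivlMr ?ltr_pdivrMr ?mulr_gt0// => h1 h2.
by apply/andP; split; lra.
Qed.

Lemma eq_periodic f g : Defs.periodic f -> Defs.periodic g ->
  (forall x, Omega x -> f x = g x) -> forall x, f x = g x.
Proof.
move=> pf pg h [a b].
have [m hm] := reduce_mod2pi a; have [n hn] := reduce_mod2pi b.
by rewrite -(periodic_int m n a b pf) -(periodic_int m n a b pg) h.
Qed.

Lemma trigpoly_cos1 (a : R) : trigpoly (fun x => (cos (x.1 - a))%:C).
Proof.
have -> : (fun x : R * R => (cos (x.1 - a))%:C) =
  fun x => (2^-1)%:C * cis (- a) * cis (dotk (1, 0) x) +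
           (2^-1)%:C * cis a * cis (dotk (-1, 0) x).
  apply/funext => x; rewrite -!mulrA -!cisD /dotk /= !(mul1r, mul0r, add0r, addr0, mulN1r).
  rewrite (addrC (- a)) -(opprB x.1 a).
  by apply: complexP; rewrite /= ?cosN ?sinN; [lra|ring].
by apply: trigpolyD; apply: trigpolyM; (try exact: trigpoly_cst); exact: trigpoly_cis.
Qed.

Lemma trigpoly_cos2 (a : R) : trigpoly (fun x => (cos (x.2 - a))%:C).
Proof.
have -> : (fun x : R * R => (cos (x.2 - a))%:C) =
  fun x => (2^-1)%:C * cis (- a) * cis (dotk (0, 1) x) +
           (2^-1)%:C * cis a * cis (dotk (0, -1) x).
  apply/funext => x; rewrite -!mulrA -!cisD /dotk /= !(mul1r, mul0r, add0r, addr0, mulN1r).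
  rewrite (addrC (- a)) -(opprB x.2 a).
  by apply: complexP; rewrite /= ?cosN ?sinN; [lra|ring].
by apply: trigpolyD; apply: trigpolyM; (try exact: trigpoly_cst); exact: trigpoly_cis.
Qed.

(** On the cell |s - a| may exceed pi, but [|a| + d <= pi] keeps it below 2 pi - d; reflecting at pi
    gives a point of [d, pi], where cosine decreases. *)
Lemma cos_far (a d s : R) : 0 < d -> `|a| + d <= pi -> - pi <= s <= pi ->
  d <= `|s - a| -> cos (s - a) <= cos d.
Proof.
move=> d0 had /andP[s1 s2] hd; rewrite -(cos_norm (s - a)).
have hu : `|s - a| <= 2 * pi - d.
  rewrite ler_norml; have := ler_norm a; have := ler_norm (- a); rewrite normrN.
  by move=> h1 h2; apply/andP; split; lra.
have na := normr_ge0 a.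
have [h|h] := leP `|s - a| pi.
  have := @ltr_cos R `|s - a| d; rewrite !in_itv /= => H.
  rewrite leNgt H -?leNgt//; first by lra.
  by apply/andP; split; lra.
have -> : cos `|s - a| = cos (2 * pi - `|s - a|).
  have := cosD2pi (`|s - a| - 2 * pi); rewrite -[pi *+ 2]mulr_natl addrNK => ->.
  by rewrite -cosN opprB.
have := @ltr_cos R (2 * pi - `|s - a|) d; rewrite !in_itv /= => H.
by rewrite leNgt H -?leNgt; lra.
Qed.

Lemma cos_near (a d s : R) : 0 < d -> d <= pi ->
  `|s - a| <= d -> cos d <= cos (s - a).
Proof.
move=> d0 dpi h; rewrite -(cos_norm (s - a)).
have n0 := normr_ge0 (s - a).
have := @ltr_cos R d `|s - a|; rewrite !in_itv /= => H.
by rewrite leNgt H -?leNgt//; lra.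
Qed.

Lemma bernoulli_ler (z : R) n : 1 <= z -> 1 + n%:R * (z - 1) <= z ^+ n.
Proof.
move=> z1; elim: n => [|n IH]; first by rewrite mul0r addr0 expr0.
rewrite exprS -[n.+1%:R]natr1.
have h : 0 <= n%:R * (z - 1) ^+ 2 by rewrite mulr_ge0// sqr_ge0.
apply: le_trans (_ : z * (1 + n%:R * (z - 1)) <= _); last by rewrite ler_wpM2l//; lra.
rewrite -subr_ge0; apply: (le_trans h); rewrite le_eqVlt; apply/orP; left.
by apply/eqP; ring.
Qed.

(** By Bernoulli's inequality the powers of q1 / q0 > 1 exceed B / A. *)
Lemma geometric_dominated_false (A B q0 q1 : R) : 0 < A -> 0 < q0 -> q0 < q1 ->
  ~ (forall n, A * q1 ^+ n <= B * q0 ^+ n).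
Proof.
move=> A0 h0 h01 key; pose z := q1 / q0.
have z1 : 1 < z by rewrite ltr_pdivlMr// mul1r.
have bnd n : z ^+ n <= B / A.
  rewrite ler_pdivlMr// /z expr_div_n mulrAC ler_pdivrMr ?exprn_gt0//.
  by rewrite mulrC.
have z0 : 0 < z - 1 by rewrite subr_gt0.
have K0 : 0 <= `|B / A| / (z - 1) by rewrite divr_ge0// ltW.
have := archi_boundP K0; rewrite ltr_pdivrMr// => h.
have := bnd (Num.bound (`|B / A| / (z - 1))).
have := bernoulli_ler (Num.bound (`|B / A| / (z - 1))) (ltW z1).
have := ler_norm (B / A); clear -h; lra.
Qed.

(* The powers of [Q = (2 + cos (x1 - a1) + cos (x2 - a2)) / 4] concentrate at
   [a], whereas they are trigonometric polynomials and so orthogonal to [g]. *)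
Lemma fourier_eq0_le0 g (a : R * R) (c d : R) : bm g ->
  (forall k, fourier g k = 0) -> 0 < c -> 0 < d -> d <= 1 ->
  `|a.1| + d <= pi -> `|a.2| + d <= pi ->
  ~ (forall x, `|x.1 - a.1| <= d -> `|x.2 - a.2| <= d -> c <= g x).
Proof.
move=> hg g0 c0 d0 d1 ha1 ha2 hc.
have pi2 := @pi_ge2 R.
have [_ [M0 hM0]] := hg.
set M := `|M0| + 1; have M_gt0 : 0 < M by rewrite ltr_wpDl.
have hM x : Omega x -> `|g x| <= M.
  by move=> /hM0 h; apply: (le_trans h); rewrite (le_trans (ler_norm M0))// lerDl.
pose Q x := (2 + cos (x.1 - a.1) + cos (x.2 - a.2)) / 4.
have d20 : 0 < d / 2 by lra.
have dpi : d / 2 <= pi by lra.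
pose b := cos (d / 2).
have b0 : 0 < b by apply: cos_gt0_pihalf; lra.
have b1 : b < 1.
  have := @ltr_cos R 0 (d / 2); rewrite !in_itv /= cos0 => -> //; lra.
have cosd : cos d = 2 * b ^+ 2 - 1.
  have -> : d = (d / 2) *+ 2 by rewrite mulr2n; lra.
  by rewrite cos_mulr2n mulr2n /b; congr (_ - _); rewrite mulr2n; ring.
(* On the square of half-width d/2 both cosines are at least b, so Q >= q1. Off the square of
   half-width d one of them is at most cos d = 2 b^2 - 1, so Q <= q0. As 0 < b < 1, the two rates
   are separated. *)
pose q0 := (1 + b ^+ 2) / 2; pose q1 := (1 + b) / 2.
have q0_gt0 : 0 < q0 by rewrite /q0; nra.
have q01 : q0 < q1 by rewrite /q0 /q1; nra.
have Q0 x : 0 <= Q x.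
  rewrite /Q; have := cos_geN1 (x.1 - a.1); have := cos_geN1 (x.2 - a.2); lra.
have tQ : trigpoly (fun x => (Q x)%:C).
  have -> : (fun x => (Q x)%:C) = (fun x => (4^-1)%:C * (2%:C + (cos (x.1 - a.1))%:C + (cos (x.2 - a.2))%:C)).
    by apply/funext => x; rewrite -!rmorphD -rmorphM /= /Q mulrC.
  apply: trigpolyM; first exact: trigpoly_cst.
  apply: trigpolyD; last exact: trigpoly_cos2.
  by apply: trigpolyD; [exact: trigpoly_cst|exact: trigpoly_cos1].
have bQ : bm Q.
  case: tQ => s hs.
  have : bmc (fun x => (Q x)%:C).
    have -> : (fun x => (Q x)%:C) = (fun x => \sum_(p <- s) p.1 * cis (dotk p.2 x)) by apply/funext.
    by apply: bmc_sum => p; apply: bmcM; [exact: bmc_cst|exact: bmc_cis].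
  by case.
pose U : set RR := (`[a.1 - d / 2, a.1 + d / 2] `*` `[a.2 - d / 2, a.2 + d / 2])%classic.
have mU : measurable U by apply: measurableX; exact: measurable_itv.
have UO : U `<=` Omega.
  move=> x [/=]; rewrite !in_itv /= => /andP[h1 h2] /andP[h3 h4].
  have := ler_norm a.1; have := ler_norm (- a.1); have := ler_norm a.2; have := ler_norm (- a.2).
  rewrite !normrN; clear -h1 h2 h3 h4 ha1 ha2 d0 => *.
  by split; rewrite /= in_itv /=; apply/andP; split; lra.
have bU : bm (\1_U : R * R -> R).
  split; first exact: measurable_indic.
  exists 1 => x _; rewrite indicE; case: (_ \in _) => /=; rewrite ?normr1 ?normr0//.
have IU : I (\1_U : R * R -> R) = d ^+ 2.
  rewrite /Rintegral integral_indic//; last exact: measurable_Omega.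
  have -> : (U `&` Omega = U)%classic by apply/setIidPl.
  rewrite /U /leb2 /= product_measure1E; try exact: measurable_itv.
  rewrite [X in (X * _)%E]lebesgue_measure_itv [X in (_ * X)%E]lebesgue_measure_itv /= !lte_fin.
  have -> : a.1 - d / 2 < a.1 + d / 2 by lra.
  have -> : a.2 - d / 2 < a.2 + d / 2 by lra.
  by rewrite -!EFinD -EFinM /=; field.
have key n : c * d ^+ 2 * q1 ^+ n <= M * cell * q0 ^+ n.
  have low x : Omega x -> c * q1 ^+ n * \1_U x - M * q0 ^+ n <= g x * Q x ^+ n.
    move=> xO; have q0n : 0 <= M * q0 ^+ n by rewrite mulr_ge0 ?exprn_ge0 ?ltW.
    have Qn : 0 <= Q x ^+ n by rewrite exprn_ge0.
    rewrite indicE; have [/set_mem xU|xU] := boolP (x \in U).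
      move: xU => [/=]; rewrite !in_itv /= => /andP[h1 h2] /andP[h3 h4].
      have e1 : `|x.1 - a.1| <= d / 2 by rewrite ler_norml; apply/andP; split; lra.
      have e2 : `|x.2 - a.2| <= d / 2 by rewrite ler_norml; apply/andP; split; lra.
      have gc : c <= g x by apply: hc; lra.
      have k1 := cos_near _ _ e1; have k2 := cos_near _ _ e2.
      have : q1 <= Q x.
        have := k1 d20 dpi; have := k2 d20 dpi.
        by rewrite -/b /Q /q1; clear; lra.
      move=> hq; rewrite mulr1; apply: le_trans (_ : c * q1 ^+ n <= _); first lra.
      apply: ler_pM => //; first exact: ltW.
        by rewrite exprn_ge0// ltW// (lt_trans q0_gt0).
      by apply: lerXn2r; rewrite ?nnegrE// ltW// (lt_trans q0_gt0).
    rewrite mulr0 add0r.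
    (* Between the two squares [Q] need not be below [q0], but there [g] is still positive. *)
    have [hin|hout] := boolP ((`|x.1 - a.1| <= d) && (`|x.2 - a.2| <= d)).
      case/andP: hin => e1 e2; apply: le_trans (_ : 0 <= _); first by rewrite oppr_le0.
      by rewrite mulr_ge0// ltW// (lt_le_trans c0)// hc.
    have hq : Q x <= q0.
      have [x1 x2] := xO; rewrite /= !in_itv /= in x1 x2.
      have := cos_le1 (x.1 - a.1); have := cos_le1 (x.2 - a.2).
      rewrite negb_and -!ltNge in hout; case/orP: hout => h.
        have := cos_far d0 ha1 x1 (ltW h); rewrite cosd /Q /q0; lra.
      have := cos_far d0 ha2 x2 (ltW h); rewrite cosd /Q /q0; lra.
    have : `|g x * Q x ^+ n| <= M * q0 ^+ n.
      rewrite normrM (ger0_norm Qn); apply: ler_pM => //; first exact: hM.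
      by apply: lerXn2r; rewrite ?nnegrE// ltW.
    by rewrite ler_norml => /andP[].
  have bl : bm (fun x => c * q1 ^+ n * \1_U x - M * q0 ^+ n).
    by apply: bmB; [exact: bmZ|exact: bm_cst].
  have := le_I bl (bmM hg (bmX n bQ)) low.
  rewrite I_trigpoly_eq0//; last by under eq_fun do rewrite rmorphXn; exact: trigpolyX.
  rewrite IB//; [|exact: bmZ|exact: bm_cst].
  rewrite IZ// IU I_cst subr_le0 -/cell => h.
  by rewrite mulrAC (le_trans h)// mulrAC.
apply: (geometric_dominated_false _ q0_gt0 q01 key).
by rewrite mulr_gt0// exprn_gt0.
Qed.

Lemma fourier_eq0 g : bm g -> Defs.periodic g -> continuous g ->
  (forall k, fourier g k = 0) -> forall x, g x = 0.
Proof.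
move=> hg pg cg g0.
have W (h : R * R -> R) (p : R * R) : bm h -> continuous h -> (forall k, fourier h k = 0) ->
    Omega p -> 0 < h p -> False.
  move=> hh ch h0 [/=]; rewrite !in_itv /= => /andP[p1 p1'] /andP[p2 p2'] hp.
  have pi2 := @pi_ge2 R.
  have /cvgr_gt/(_ _ _)/= : h x @[x --> p] --> h p by exact: ch.
  move=> /(_ (h p / 2)) H; have := H ltac:(lra) => {H}.
  move=> /nbhs_ballP[e /= e0 He].
  pose t := Num.min (e / 8) 1.
  have t0 : 0 < t by rewrite /t lt_min; apply/andP; split; lra.
  have te : t <= e / 8 by rewrite /t ge_min lexx.
  have t1 : t <= 1 by rewrite /t ge_min lexx orbT.
  (* The point [p] may lie on the boundary of the cell, whereas the square has to stay inside; so
     its centre is moved towards the origin, by at most t pi / 2 < 2 t in each coordinate. *)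
  pose a := ((1 - t / 2) * p.1, (1 - t / 2) * p.2).
  have pi4 : pi < 4 :> R by have := @pihalf_lt2 R; lra.
  have n1 : `|p.1| <= pi by rewrite ler_norml p1 p1'.
  have n2 : `|p.2| <= pi by rewrite ler_norml p2 p2'.
  have tt : 0 <= 1 - t / 2 by lra.
  apply: (@fourier_eq0_le0 h a (h p / 2) (t / 2)) => //.
  - lra.
  - lra.
  - lra.
  - rewrite /= normrM (ger0_norm tt); nra.
  - rewrite /= normrM (ger0_norm tt); nra.
  move=> x; rewrite /= => hx1 hx2; apply/ltW/He; split => /=; rewrite /ball /=.
    have -> : p.1 - x.1 = - (x.1 - (1 - t / 2) * p.1) + t / 2 * p.1 by ring.
    apply: le_lt_trans (ler_normD _ _) _; rewrite normrN normrM (ger0_norm (_ : 0 <= t / 2)); last lra.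
    have := normr_ge0 p.1; nra.
  have -> : p.2 - x.2 = - (x.2 - (1 - t / 2) * p.2) + t / 2 * p.2 by ring.
  apply: le_lt_trans (ler_normD _ _) _; rewrite normrN normrM (ger0_norm (_ : 0 <= t / 2)); last lra.
  have := normr_ge0 p.2; nra.
have p0 : Defs.periodic (fun _ : R * R => 0 : R) by [].
apply: (eq_periodic pg p0) => x xO.
have [h|h|//] := ltgtP (g x) 0.
  exfalso; apply: (W (fun x => - g x) x) => //.
  - exact: bmN.
  - by move=> y; apply: cvgN; exact: cg.
  - by move=> k; rewrite fourierN// g0 oppr0.
  - by rewrite oppr_gt0.
by exfalso; apply: (W g x).
Qed.

End FourierUniqueness.

(** * Absolutely convergent Fourier series *)

Section Wiener.
Context {R : realType}.
Implicit Types (f g : R * R -> R) (F G : R * R -> R[i]) (A : R).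
Implicit Types (k l : int * int) (x : R * R) (c : int * int -> R[i]).
Local Notation RR := (measurableTypeR R * measurableTypeR R)%type.
Local Notation I f := (\int[leb2]_(x in Omega) f x).

Lemma cvgn_leP (u : R^nat) (l : R) : u @ \oo --> l <->
  forall e, 0 < e -> exists n0, forall n, (n0 <= n)%N -> `|u n - l| <= e.
Proof.
split=> [/cvgrPdist_le h e /h [n0 _ H]|h].
  by exists n0 => n nn; rewrite distrC; exact: H.
apply/cvgrPdist_le => e /h [n0 H]; exists n0 => // n nn.
by rewrite distrC; exact: H.
Qed.

(** Both [v] and [u + v] are nondecreasing and bounded, hence convergent, and [u] is their
    difference. *)
Lemma cvgn_dominated (u v : R^nat) A :
  (forall n m, (n <= m)%N -> `|u m - u n| <= v m - v n) ->
  (forall n, v n <= A) -> cvgn u.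
Proof.
move=> uv vA.
have vnd : nondecreasing_seq v.
  by move=> n m /uv h; rewrite -subr_ge0 (le_trans _ h).
have uvnd : nondecreasing_seq (u \+ v).
  move=> n m /uv; rewrite ler_norml => /andP[h _] /=; lra.
have cv : cvgn v.
  by apply: nondecreasing_is_cvgn => //; exists A => _ [n _ <-].
have cuv : cvgn (u \+ v).
  apply: nondecreasing_is_cvgn => //; exists (u 0%N - v 0%N + 2 * A) => _ [n _ <-] /=.
  have := uv 0%N n (leq0n n); have := vA n.
  rewrite ler_norml => ? /andP[_ ?]; lra.
have -> : u = (u \+ v) \- v by apply/funext => n /=; rewrite addrK.
exact: is_cvgB.
Qed.

(** The symmetry that makes all box sums real. *)
Definition herm c := forall k, c (- k) = ((c k)^*)%C.

(** The Fourier multiplier i k_1 of the derivative in x1. *)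
Definition dc c k : R[i] := (0 +i* k.1%:~R) * c k.

Lemma herm_dc c : herm c -> herm (dc c).
Proof.
move=> h k; rewrite /dc h rmorphM; congr (_ * _).
by apply: complexP; rewrite /= ?oppr0 ?rmorphN.
Qed.

Lemma modc_dc c k : modc (dc c k) = `|k.1%:~R| * modc (c k).
Proof. by rewrite modcM [X in X * _]modcE /= expr0n add0r sqrtr_sqr. Qed.

Definition rtp n c x : R := complex.Re (tp n c x).

Lemma rtpE n c x : herm c -> (rtp n c x)%:C = tp n c x.
Proof.
move=> hc; have : ((tp n c x)^*)%C = tp n c x.
  rewrite /tp conj_sum_cis -[RHS]big_boxseqN; apply: eq_bigr => k _.
  by rewrite hc.
rewrite /rtp; case: (tp n c x) => a b [E].
have -> : b = 0 by lra.
by [].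
Qed.

Lemma bm_rtp n c : bm (rtp n c).
Proof. by have [] := bmc_tp n c. Qed.

Lemma XN_rtp n c : herm c -> XN n (rtp n c).
Proof. by move=> hc; exists c => x; rewrite sum_kbox rtpE. Qed.

Lemma fourier_rtp n c k : herm c ->
  fourier (rtp n c) k = if k \in boxseq n then c k else 0.
Proof. by move=> hc; apply: fourier_tp => x _; rewrite rtpE. Qed.

Lemma rtpB n m c x : (n <= m)%N -> rtp m c x - rtp n c x =
  complex.Re (\sum_(k <- boxseq m | k \notin boxseq n) c k * cis (dotk k x)).
Proof.
move=> nm; rewrite /rtp /tp (big_boxseq_split _ nm) cReD.
by rewrite addrAC subrr add0r.
Qed.

Lemma normr_rtpB n m c x : (n <= m)%N -> `|rtp m c x - rtp n c x| <=
  \sum_(k <- boxseq m | k \notin boxseq n) modc (c k).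
Proof.
move=> nm; rewrite rtpB//; apply: le_trans (normr_Re _) _.
apply: le_trans (ler_modc_sum _ _ _) _; apply: ler_sum => k _.
by rewrite modcM modc_cis mulr1.
Qed.

Lemma normr_rtp n c x : `|rtp n c x| <= \sum_(k <- boxseq n) modc (c k).
Proof.
apply: le_trans (normr_Re _) _; apply: le_trans (ler_modc_sum _ _ _) _.
by apply: ler_sum => k _; rewrite modcM modc_cis mulr1.
Qed.

(** Membership in the Wiener algebra with norm at most [A]. The explicit [A] also bounds the box
    sums and [f] uniformly, which lets the final constants be chosen before the solution. *)
Definition wiener A c f := [/\ herm c,
  (forall n, \sum_(k <- boxseq n) modc (c k) <= A) &
  (forall x, rtp n c x @[n --> \oo] --> f x)].

Lemma wiener_exists A c : herm c ->
  (forall n, \sum_(k <- boxseq n) modc (c k) <= A) ->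
  exists f, wiener A c f.
Proof.
move=> hc hA; exists (fun x => limn (fun n => rtp n c x)); split => // x.
apply: (@cvgn_dominated _ (fun n => \sum_(k <- boxseq n) modc (c k)) A) => // n m nm.
apply: le_trans (normr_rtpB _ _ nm) _.
by rewrite (big_boxseq_split _ nm) addrAC subrr add0r.
Qed.

Lemma wiener_bound A c f x : wiener A c f -> `|f x| <= A.
Proof.
case=> hc hA hf.
have h : (fun n => `|rtp n c x|) @ \oo --> `|f x| by apply: cvg_norm; exact: hf.
apply: (cvgr_to_le h); near=> n.
exact: le_trans (normr_rtp _ _ _) (hA n).
Unshelve. all: by end_near. Qed.

Lemma wiener_tail A c f N (B : R) : wiener A c f ->
  (forall M, (N <= M)%N -> \sum_(k <- boxseq M | k \notin boxseq N) modc (c k) <= B) ->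
  forall x, `|f x - rtp N c x| <= B.
Proof.
case=> hc hA hf hB x.
have h : (fun n => `|rtp n c x - rtp N c x|) @ \oo --> `|f x - rtp N c x|.
  by apply: cvg_norm; apply: cvgB; [exact: hf|exact: cvg_cst].
apply: (cvgr_to_le h); near=> n.
have nN : (N <= n)%N by near: n; exact: nbhs_infty_ge.
exact: le_trans (normr_rtpB _ _ nN) (hB n nN).
Unshelve. all: by end_near. Qed.

Lemma sum_tail (F : int * int -> R) A (e : R) : (forall k, 0 <= F k) ->
  (forall n, \sum_(k <- boxseq n) F k <= A) -> 0 < e ->
  exists n0, forall n M, (n0 <= n)%N -> (n <= M)%N ->
    \sum_(k <- boxseq M | k \notin boxseq n) F k <= e.
Proof.
move=> F0 FA e0; set S := fun n => \sum_(k <- boxseq n) F k.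
have nd : nondecreasing_seq S by move=> n m nm; exact: ler_sum_boxseq.
have cS : cvgn S.
  by apply: nondecreasing_is_cvgn => //; exists A => _ [n _ <-]; exact: FA.
have [n0 H] := (cvgn_leP S (limn S)).1 cS e e0.
exists n0 => n M nn nM.
have -> : \sum_(k <- boxseq M | k \notin boxseq n) F k = S M - S n.
  by rewrite /S (big_boxseq_split F nM) addrAC subrr add0r.
have := nondecreasing_cvgn_le nd cS M; have := H n nn.
rewrite ler_norml => /andP[] *; lra.
Qed.

Lemma wiener_unif A c f (e : R) : wiener A c f -> 0 < e ->
  exists n0, forall n, (n0 <= n)%N -> forall x, `|f x - rtp n c x| <= e.
Proof.
move=> wf e0; have [hc hA _] := wf.
have [n0 H] := sum_tail (fun k => modc_ge0 (c k)) hA e0.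
exists n0 => n nn; apply: (wiener_tail wf) => M nM; exact: H.
Qed.

Lemma wiener_bm A c f : wiener A c f -> bm f.
Proof.
move=> wf; split.
  have [_ _ hf] := wf.
  apply: (@measurable_fun_cvg _ RR R setT (fun n => rtp n c) f) => [n|x _].
    by have [] := bm_rtp n c.
  exact: hf.
by exists A => x _; exact: wiener_bound wf.
Qed.

(** Coefficients depend continuously on the function in the uniform norm, and every large enough box
    contains [k]. *)
Lemma wiener_fourier A c f k : wiener A c f -> fourier f k = c k.
Proof.
move=> wf; have bf := wiener_bm wf; have [hc _ _] := wf.
apply/eqP; rewrite -subr_eq0; apply/eqP.
have : modc (fourier f k - c k) <= 0.
  apply/ler_addgt0Pr => e e0; rewrite add0r.
  have e2 : 0 < e / 2 by lra.
  have [n0 H] := wiener_unif wf e2.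
  pose n := maxn n0 (maxn (absz k.1) (absz k.2)).
  have kn : k \in boxseq n by rewrite mem_boxseq /n; apply/andP; lia.
  have := H n (leq_maxl _ _) => Hn.
  have := fourier_rtp n k hc; rewrite kn => <-.
  rewrite -fourierB//; last exact: bm_rtp.
  apply: le_trans (modc_fourier_le _ (bmB bf (bm_rtp n c)) (fun x _ => Hn x)) _.
  by lra.
have := modc_ge0 (fourier f k - c k) => h1 h2.
have /eqP : modc (fourier f k - c k) = 0 by apply/eqP; rewrite eq_le h1 h2.
rewrite modcE sqrtr_eq0 => h.
have a0 := sqr_ge0 (complex.Re (fourier f k - c k)).
have b0 := sqr_ge0 (complex.Im (fourier f k - c k)).
apply: complexP; rewrite /=; apply/eqP; rewrite -sqrf_eq0; apply/eqP; lra.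
Qed.

Lemma ip_rtp_tail n m c : (n <= m)%N -> herm c ->
  ip (fun x => rtp m c x - rtp n c x) (fun x => rtp m c x - rtp n c x) =
  cell * \sum_(k <- boxseq m | k \notin boxseq n) modc (c k) ^+ 2.
Proof.
move=> nm hc; pose c' k := if k \notin boxseq n then c k else 0.
have hc' : herm c'.
  by move=> k; rewrite /c' mem_boxseqN; case: ifP => _; rewrite ?hc//= oppr0.
have E x : rtp m c x - rtp n c x = rtp m c' x.
  rewrite rtpB// /rtp /tp; congr complex.Re; rewrite big_mkcond.
  by apply: eq_bigr => k _; rewrite /c'; case: ifP => _; rewrite ?mul0r.
have -> : (fun x => rtp m c x - rtp n c x) = rtp m c' by apply/funext.
have := @ip_tp _ m c' (rtp m c') (rtp m c') (bm_rtp _ _) (fun x => rtpE m x hc').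
have -> : \sum_(k <- boxseq m) fourier (rtp m c') k * ((c' k)^*)%C =
  (\sum_(k <- boxseq m | k \notin boxseq n) modc (c k) ^+ 2)%:C.
  rewrite rmorph_sum [in RHS]big_mkcond.
  apply: eq_big_seq => k km; rewrite fourier_rtp// km mulzconj /c'.
  by case: ifP => _ //; rewrite modc0 expr0n.
by rewrite -rmorphM => -[].
Qed.

(** Parseval's identity is exact for [rtp m c - rtp N c], and [f] is uniformly close to [rtp m c]
    for large [m]. *)
Lemma wiener_ip_tail A c f N (B : R) : wiener A c f ->
  (forall M, (N <= M)%N ->
     \sum_(k <- boxseq M | k \notin boxseq N) modc (c k) ^+ 2 <= B) ->
  ip (fun x => f x - rtp N c x) (fun x => f x - rtp N c x) <= cell * B.
Proof.
move=> wf hB; have bf := wiener_bm wf; have [hc hA _] := wf.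
have A0 : 0 <= A.
  by apply: le_trans (hA 0%N); apply: sumr_ge0 => k _; exact: modc_ge0.
have cell0 := @cell_gt0 R.
apply/ler_addgt0Pr => e e0.
(* If |h| <= A and |r| <= d <= 1, then (h + r)^2 <= h^2 + d (2 A + 1); [d] makes the integral of the
   excess at most [e]. *)
pose d := Num.min 1 (e / (cell * (2 * A + 1))).
have D0 : 0 < cell * (2 * A + 1) by rewrite mulr_gt0//; lra.
have d0 : 0 < d by rewrite /d lt_min ltr01 divr_gt0.
have d1 : d <= 1 by rewrite /d ge_min lexx.
have de : d * (cell * (2 * A + 1)) <= e.
  by rewrite -ler_pdivlMr// /d ge_min lexx orbT.
have [n0 H] := wiener_unif wf d0.
pose m := maxn n0 N; have Nm : (N <= m)%N by rewrite leq_maxr.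
have Hm := H m (leq_maxl _ _).
pose h x := rtp m c x - rtp N c x; pose r x := f x - rtp m c x.
have bh : bm h by apply: bmB; exact: bm_rtp.
have br : bm r by apply: bmB => //; exact: bm_rtp.
have hh x : `|h x| <= A.
  apply: le_trans (normr_rtpB _ _ Nm) _; apply: le_trans (hA m).
  rewrite (big_boxseq_split _ Nm) lerDr; apply: sumr_ge0 => k _; exact: modc_ge0.
have E x : f x - rtp N c x = h x + r x by rewrite /h /r; ring.
under eq_fun do rewrite E; rewrite /ip.
have le1 : I (fun x => (h x + r x) * (h x + r x)) <= I (fun x => h x * h x + d * (2 * A + 1)).
  apply: le_I.
  - by apply: bmM; exact: bmD.
  - by apply: bmD; [exact: bmM|exact: bm_cst].
  move=> x _; have := hh x; have := Hm x; rewrite -/(r x) => r1 h1.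
  have : h x * r x <= A * d.
    by apply: le_trans (ler_norm _) _; rewrite normrM ler_pM.
  have : r x * r x <= d * 1.
    by apply: le_trans (ler_norm _) _; rewrite normrM ler_pM// (le_trans r1).
  have -> : (h x + r x) * (h x + r x) = h x * h x + 2 * (h x * r x) + r x * r x by ring.
  have -> : d * (2 * A + 1) = 2 * (A * d) + d * 1 by ring.
  by clear; lra.
apply: (le_trans le1); rewrite ID; [|exact: bmM|exact: bm_cst].
rewrite I_cst -/cell; have := ip_rtp_tail Nm hc; rewrite /ip -/h => ->.
apply: lerD; first by rewrite ler_wpM2l ?(ltW cell0)//; exact: hB.
by rewrite -mulrA [(2 * A + 1) * _]mulrC.
Qed.

Lemma cis_add2pi (t : R) (n : int) : cis (t + 2 * pi * n%:~R) = cis t.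
Proof.
have -> : t + 2 * pi * n%:~R = n%:~R * pi + (t + n%:~R * pi) by ring.
by rewrite /cis intr_mul_pi intr_mul_pi_cos addrCA addNr addr0.
Qed.

Lemma periodic_rtp n c : Defs.periodic (rtp n c).
Proof.
move=> x1 x2; split; rewrite /rtp /tp; congr complex.Re; apply: eq_bigr => k _;
  rewrite /dotk /=; congr (_ * _).
  have -> : k.1%:~R * (x1 + 2 * pi) + k.2%:~R * x2 =
    (k.1%:~R * x1 + k.2%:~R * x2) + 2 * pi * k.1%:~R :> R by ring.
  by rewrite cis_add2pi.
have -> : k.1%:~R * x1 + k.2%:~R * (x2 + 2 * pi) =
  (k.1%:~R * x1 + k.2%:~R * x2) + 2 * pi * k.2%:~R :> R by ring.
by rewrite cis_add2pi.
Qed.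

Lemma wiener_periodic A c f : wiener A c f -> Defs.periodic f.
Proof.
case=> _ _ hf x1 x2; split.
  have := hf (x1 + 2 * pi, x2).
  have -> : (fun n => rtp n c (x1 + 2 * pi, x2)) = fun n => rtp n c (x1, x2).
    by apply/funext => n; exact: (periodic_rtp n c x1 x2).1.
  by move=> h; exact: (cvg_unique _ h (hf _)).
have := hf (x1, x2 + 2 * pi).
have -> : (fun n => rtp n c (x1, x2 + 2 * pi)) = fun n => rtp n c (x1, x2).
  by apply/funext => n; exact: (periodic_rtp n c x1 x2).2.
by move=> h; exact: (cvg_unique _ h (hf _)).
Qed.

Lemma continuous_dotk k : continuous (dotk k : R * R -> R).
Proof.
move=> x; apply: cvgD; apply: cvgM; try exact: cvg_cst.
  exact: cvg_fst.
exact: cvg_snd.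
Qed.

Lemma continuous_rtp n c : continuous (rtp n c).
Proof.
rewrite /rtp /tp; elim: (boxseq n) => [|k s IH] x.
  under eq_fun do rewrite big_nil; exact: cvg_cst.
under eq_fun do rewrite big_cons cReD cReM.
apply: cvgD; last exact: IH.
apply: cvgB; apply: cvgM; try exact: cvg_cst.
  apply: (@continuous_comp _ _ _ (dotk k) cos); first exact: continuous_dotk.
  exact: continuous_cos.
apply: (@continuous_comp _ _ _ (dotk k) sin); first exact: continuous_dotk.
exact: continuous_sin.
Qed.

Lemma wiener_continuous A c f : wiener A c f -> continuous f.
Proof.
move=> wf x; apply/cvgrPdist_le => e e0.
have e3 : 0 < e / 3 by lra.
have [n0 H] := wiener_unif wf e3.
have Hn := H n0 (leqnn n0).
have /cvgrPdist_le/(_ _ e3) : rtp n0 c y @[y --> x] --> rtp n0 c x by exact: continuous_rtp.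
apply: filterS => y hy.
have -> : f x - f y = (f x - rtp n0 c x) + (rtp n0 c x - rtp n0 c y) - (f y - rtp n0 c y) by ring.
apply: le_trans (ler_normB _ _) _.
have := ler_normD (f x - rtp n0 c x) (rtp n0 c x - rtp n0 c y).
have := Hn x; have := Hn y; lra.
Qed.

(** * Termwise differentiation of Fourier series *)

Lemma is_derive_Re_cis (z : R[i]) k (b s : R) :
  is_derive s (1 : R) (fun s : R => complex.Re (z * cis (dotk k (s, b))))
    (complex.Re ((0 +i* k.1%:~R) * z * cis (dotk k (s, b)))).
Proof.
under eq_fun do rewrite cReM /= /dotk /=.
have := is_deriveB
  (is_deriveZ (complex.Re z) (is_derive_affine_cos k.1%:~R (k.2%:~R * b) s))
  (is_deriveZ (complex.Im z) (is_derive_affine_sin k.1%:~R (k.2%:~R * b) s)).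
move=> h; apply: (is_derive_eq h); case: z {h} => a d; rewrite /GRing.scale /=; ring.
Qed.

Lemma is_derive_rtp n c (b s : R) :
  is_derive s (1 : R) (fun s : R => rtp n c (s, b)) (rtp n (dc c) (s, b)).
Proof.
rewrite /rtp /tp; elim: (boxseq n) => [|k r IH].
  under eq_fun do rewrite big_nil; rewrite big_nil; exact: is_derive_cst.
under eq_fun do rewrite big_cons cReD.
rewrite big_cons cReD; apply: is_deriveD; exact: is_derive_Re_cis.
Qed.

Lemma ler_norm_cos (a b : R) : `|cos b - cos a| <= `|b - a|.
Proof.
wlog ab : a b / a <= b.
  move=> W; have [/W//|/ltW/W h] := leP a b.
  by rewrite distrC [X in _ <= X]distrC.
have [c _ ->] := MVT_segment ab (fun (x : R) _ => is_derive_cos x)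
  (continuous_subspaceT (@continuous_cos R)).
by rewrite normrM normrN ler_piMl// sin_max.
Qed.

Lemma ler_norm_sin (a b : R) : `|sin b - sin a| <= `|b - a|.
Proof.
wlog ab : a b / a <= b.
  move=> W; have [/W//|/ltW/W h] := leP a b.
  by rewrite distrC [X in _ <= X]distrC.
have [c _ ->] := MVT_segment ab (fun (x : R) _ => is_derive_sin x)
  (continuous_subspaceT (@continuous_sin R)).
by rewrite normrM ler_piMl// cos_max.
Qed.

Lemma modc_cisB (a b : R) : modc (cis b - cis a) <= 2 * `|b - a|.
Proof.
apply: le_trans (modc_le_ReIm _) _ => /=.
have := ler_norm_cos a b; have := ler_norm_sin a b; lra.
Qed.

(** Since |e^(i k_1 h) - 1| <= 2 |k_1 h|, each mode is Lipschitz in x1 with twice the modulus of its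
    coefficient in [dc c]. The difference quotients of the tail are thus small uniformly in [h]. *)
Lemma wiener_tail_lip A A' c f f1 N (B : R) :
  wiener A c f -> wiener A' (dc c) f1 ->
  (forall M, (N <= M)%N ->
     \sum_(k <- boxseq M | k \notin boxseq N) modc (dc c k) <= B) ->
  forall s h b : R,
  `|(f (s + h, b) - rtp N c (s + h, b)) - (f (s, b) - rtp N c (s, b))| <= 2 * B * `|h|.
Proof.
move=> [_ _ hf] _ hB s h b.
have lim : (fun n => `|(rtp n c (s + h, b) - rtp N c (s + h, b)) -
    (rtp n c (s, b) - rtp N c (s, b))|) @ \oo -->
  `|(f (s + h, b) - rtp N c (s + h, b)) - (f (s, b) - rtp N c (s, b))|.
  by apply: cvg_norm; apply: cvgB; apply: cvgB; (try exact: hf); exact: cvg_cst.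
apply: (cvgr_to_le lim); near=> n.
have nN : (N <= n)%N by near: n; exact: nbhs_infty_ge.
rewrite !rtpB// -cReN -cReD -sumrN -big_split /=.
apply: le_trans (normr_Re _) _; apply: le_trans (ler_modc_sum _ _ _) _.
apply: le_trans (_ : \sum_(k <- boxseq n | k \notin boxseq N) (2 * `|h|) * modc (dc c k) <= _).
  apply: ler_sum => k _; rewrite -mulrBr modcM modc_dc.
  have -> : 2 * `|h| * (`|k.1%:~R| * modc (c k)) = modc (c k) * (2 * `|k.1%:~R * h|).
    by rewrite normrM; ring.
  rewrite ler_wpM2l ?modc_ge0//; apply: le_trans (modc_cisB _ _) _.
  rewrite ler_wpM2l// le_eqVlt; apply/orP; left; apply/eqP; congr `|_|.
  by rewrite /dotk /=; ring.
rewrite -mulr_sumr (mulrAC 2 B) ler_wpM2l ?mulr_ge0//; exact: hB.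
Unshelve. all: by end_near. Qed.

Lemma wiener_is_derive A A' c f f1 (b s : R) :
  wiener A c f -> wiener A' (dc c) f1 ->
  is_derive s (1 : R) (fun s : R => f (s, b)) (f1 (s, b)).
Proof.
move=> wf wf1.
suff H : (fun h : R => h^-1 *: (((fun s => f (s, b)) \o shift s) (h *: 1) - f (s, b)))
    @ 0^' --> f1 (s, b).
  split; first by apply/cvg_ex; exists (f1 (s, b)).
  exact: cvg_lim H.
apply/cvgrPdist_le => e e0.
have e4 : 0 < e / 4 by lra.
have [_ hA' _] := wf1.
have [N HN] := sum_tail (fun k => modc_ge0 (dc c k)) hA' e4.
have t1 := wiener_tail_lip wf wf1 (fun M => HN N M (leqnn N)).
have t2 := wiener_tail wf1 (fun M => HN N M (leqnn N)).
have d := is_derive_rtp N c b s.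
have : (fun h : R => h^-1 *: (((fun s => rtp N c (s, b)) \o shift s) (h *: 1) - rtp N c (s, b)))
    @ 0^' --> rtp N (dc c) (s, b).
  by case: d => /cvg_ex[l hl] <-; rewrite /derive (cvg_lim _ hl).
move=> /cvgrPdist_le/(_ _ e4) hd.
near=> h; have h0 : h != 0 by near: h; exact: nbhs_dnbhs_neq.
have : `|rtp N (dc c) (s, b) - h^-1 *: (((fun s => rtp N c (s, b)) \o shift s) (h *: 1) - rtp N c (s, b))| <= e / 4.
  by near: h.
have := t1 s h b; have := t2 (s, b).
rewrite /= /GRing.scale /= mulr1 (addrC h s).
set p := rtp N c (s + h, b); set p0 := rtp N c (s, b); set p1 := rtp N (dc c) (s, b).
set q := f (s + h, b); set q0 := f (s, b); set q1 := f1 (s, b).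
move=> h2 h1 h3.
(* Three errors: the tail of the derivative (e/4), the difference quotient of the trigonometric
   polynomial (e/4) and the difference quotient of the tail (e/2). *)
have -> : q1 - h^-1 * (q - q0) = (q1 - p1) + (p1 - h^-1 * (p - p0)) - h^-1 * ((q - p) - (q0 - p0)) by ring.
apply: le_trans (ler_normB _ _) _.
have := ler_normD (q1 - p1) (p1 - h^-1 * (p - p0)).
have : `|h^-1 * (q - p - (q0 - p0))| <= e / 2.
  rewrite normrM normfV ler_pdivrMl ?normr_gt0//; apply: (le_trans h1); lra.
lra.
Unshelve. all: by end_near. Qed.

Lemma wiener_dx1 A A' c f f1 x :
  wiener A c f -> wiener A' (dc c) f1 -> dx1 f x = f1 x.
Proof.
case: x => s b wf wf1; rewrite /dx1 derive1E /=.
by have := wiener_is_derive b s wf wf1 => h; rewrite derive_val.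
Qed.

End Wiener.

(** * Regularity of functions in Sobolev spaces *)

Section Sobolev.
Context {R : realType}.
Implicit Types (f g : R * R -> R) (A p r : R).
Implicit Types (k l : int * int) (x : R * R) (c : int * int -> R[i]).

(* Grouping the terms of indices 2m and 2m+1 gives S_(2n+1) <= 1 + 2^(1-p) S_n
   for the partial sums S_n, whence S_n <= 1 / (1 - 2^(1-p)). *)
Lemma riemann_sum_bounded p : 1 < p -> exists Z : R,
  forall n, \sum_(m < n) (m.+1%:R `^ p)^-1 <= Z.
Proof.
move=> p1; have p0 : 0 <= p by lra.
set F := fun m : nat => (m.+1%:R `^ p : R)^-1.
have F0 m : 0 <= F m by rewrite invr_ge0 powR_ge0.
pose q : R := 2 * (2 `^ p)^-1.
have q1 : q < 1.
  rewrite /q ltr_pdivrMr ?powR_gt0// mul1r.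
  rewrite -{1}[2]powRr1// /powR pnatr_eq0/= ltr_expR ltr_pM2r//.
  by rewrite ln_gt0// ltr1n.
have pair m : F m.*2.+1 + F m.*2.+2 <= q * F m.
  have h1 : F m.*2.+1 = (2 `^ p)^-1 * F m.
    rewrite /F -invfM -powRM//; congr (_ `^ _)^-1.
    by rewrite -natrM; congr _%:R; lia.
  have h2 : F m.*2.+2 <= F m.*2.+1.
    rewrite /F lef_pV2 ?posrE ?powR_gt0//.
    by apply: ge0_ler_powR; rewrite ?nnegrE// ler_nat.
  have -> : q * F m = (2 `^ p)^-1 * F m + (2 `^ p)^-1 * F m by rewrite /q; ring.
  lra.
have dbl n : \sum_(m < n.*2.+1) F m <= 1 + q * \sum_(m < n) F m.
  elim: n => [|n IH].
    by rewrite big_ord1 big_ord0 mulr0 addr0 /F powR1 invr1.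
  rewrite doubleS big_ord_recr big_ord_recr [X in _ <= 1 + q * X]big_ord_recr /=.
  have := pair n; rewrite mulrDr; lra.
exists (1 - q)^-1 => n.
have le : \sum_(m < n) F m <= \sum_(m < n.*2.+1) F m.
  rewrite -!(big_mkord xpredT F) (@big_cat_nat _ _ _ n 0 n.*2.+1)//=; last by lia.
  by rewrite lerDl sumr_ge0.
have := dbl n; rewrite -[_^-1]mul1r ler_pdivlMr; last by lra.
move=> h; have := le_trans le h; lra.
Qed.

Lemma big_zseq_even (F : int -> R) n : (forall i, F (- i) = F i) ->
  \sum_(i <- zseq n) F i = F 0 + 2 * \sum_(m < n) F m.+1%:Z.
Proof.
move=> ev; elim: n => [|n IH].
  by rewrite big_ord0 mulr0 addr0 /zseq /= big_seq1 subr0.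
rewrite big_ord_recr /=.
have E (i : int) : (i \in zseq n.+1) = (i \in [:: Posz n.+1, Negz n & zseq n]).
  by rewrite mem_zseq in_cons in_cons mem_zseq; lia.
have -> : \sum_(i <- zseq n.+1) F i =
    \sum_(i <- [:: Posz n.+1, Negz n & zseq n]) F i.
  apply: perm_big; apply: uniq_perm; first exact: uniq_zseq.
    rewrite /=; apply/and3P; split; last exact: uniq_zseq.
      by rewrite in_cons mem_zseq; lia.
    by rewrite mem_zseq; lia.
  exact: E.
by rewrite big_cons big_cons NegzE ev IH; ring.
Qed.

Lemma powRD_gt0 (y a b : R) : 0 < y -> y `^ (a + b) = y `^ a * y `^ b.
Proof. by move=> y0; rewrite powRD// (gt_eqF y0) implybT. Qed.

Definition bracket k : R := 1 + sqnormk k.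

Lemma bracket_ge1 k : 1 <= bracket k.
Proof. by rewrite /bracket /sqnormk lerDl addr_ge0 ?sqr_ge0. Qed.

Lemma bracket_gt0 k : 0 < bracket k.
Proof. exact: lt_le_trans (bracket_ge1 k). Qed.

(** As (1 + i^2) (1 + j^2) <= (1 + i^2 + j^2)^2, the double sum is dominated by the square of the
    sum of (1 + i^2)^(-p/2), which is comparable with a Riemann sum of exponent p. *)
Lemma sum_bracket_bounded p : 1 < p -> exists Z : R,
  forall n, \sum_(k <- boxseq n) (bracket k `^ p)^-1 <= Z.
Proof.
move=> p1; have [Z0 hZ0] := riemann_sum_bounded p1.
have p0 : 0 <= p by lra.
pose G (i : int) : R := ((1 + i%:~R ^+ 2) `^ (p / 2))^-1.
have G0 i : 0 <= G i by rewrite invr_ge0 powR_ge0.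
have one_ge (i : int) : 1 <= 1 + i%:~R ^+ 2 :> R by rewrite lerDl sqr_ge0.
have g0 (i : int) : 0 < 1 + i%:~R ^+ 2 :> R by exact: lt_le_trans ltr01 (one_ge i).
have Gev i : G (- i) = G i by rewrite /G rmorphN sqrrN.
have GF (m : nat) : G m.+1%:Z <= (m.+1%:R `^ p)^-1.
  rewrite /G lef_pV2 ?posrE ?powR_gt0 ?(g0 m.+1%:Z)//.
  have -> : m.+1%:R `^ p = (m.+1%:R ^+ 2) `^ (p / 2) :> R.
    rewrite -powR_mulrn// -powRrM; congr (_ `^ _); lra.
  apply: ge0_ler_powR; rewrite ?nnegrE ?sqr_ge0 ?divr_ge0 ?(ltW (g0 m.+1%:Z))//.
  by rewrite lerDr.
have Gsum n : \sum_(i <- zseq n) G i <= 1 + 2 * Z0.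
  rewrite big_zseq_even// {1}/G expr0n addr0 powR1 invr1 lerD2l ler_wpM2l//.
  by apply: le_trans (hZ0 n); apply: ler_sum => m _; exact: GF.
have Z00 : 0 <= Z0 by apply: le_trans (hZ0 0%N); rewrite big_ord0.
exists ((1 + 2 * Z0) * (1 + 2 * Z0)) => n.
rewrite big_boxseq_zseq.
apply: le_trans (_ : \sum_(i <- zseq n) G i * \sum_(j <- zseq n) G j <= _); last first.
  rewrite -mulr_suml ler_pM//; rewrite sumr_ge0//.
apply: ler_sum => i _; rewrite mulr_sumr; apply: ler_sum => j _.
rewrite /G -invfM lef_pV2 ?posrE ?mulr_gt0 ?powR_gt0 ?bracket_gt0//;
  try by exact: lt_le_trans ltr01 (one_ge _).
rewrite -powRM; try by exact: le_trans ler01 (one_ge _).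
have -> : bracket (i, j) `^ p = (bracket (i, j) ^+ 2) `^ (p / 2).
  rewrite -powR_mulrn ?(ltW (bracket_gt0 _))// -powRrM; congr (_ `^ _); lra.
have ab : 0 <= (1 + i%:~R ^+ 2) * (1 + j%:~R ^+ 2) :> R.
  by rewrite mulr_ge0//; exact: le_trans ler01 (one_ge _).
apply: ge0_ler_powR; rewrite ?nnegrE ?sqr_ge0 ?divr_ge0//.
rewrite /bracket /sqnormk /=.
have := sqr_ge0 (i%:~R : R); have := sqr_ge0 (j%:~R : R).
set a := _ ^+ 2; set b := _ ^+ 2; clear => *; nra.
Qed.

Lemma Hper_sum r f (s : seq (int * int)) : (Hnorm2 r f < +oo)%E -> uniq s ->
  \sum_(k <- s) bracket k `^ r * modc (fourier f k) ^+ 2 <= Hnorm r f ^+ 2.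
Proof.
move=> hfin us.
have h0 : (0 <= Hnorm2 r f)%E.
  by apply: esum_ge0 => k _; rewrite lee_fin mulr_ge0 ?powR_ge0 ?sqr_ge0.
rewrite /Hnorm sqr_sqrtr ?fine_ge0// -lee_fin fineK ?ge0_fin_numE//.
apply: esum_ge; exists [set` s]; first by split => //; exact: finite_seq.
by rewrite -fsbig_seq// -sumEFin.
Qed.

Lemma Hnorm_le r f (B : R) : 0 <= B ->
  (forall s, uniq s -> \sum_(k <- s) bracket k `^ r * modc (fourier f k) ^+ 2 <= B) ->
  (Hnorm2 r f <= B%:E)%E /\ Hnorm r f ^+ 2 <= B.
Proof.
move=> B0 hB; have h : (Hnorm2 r f <= B%:E)%E.
  apply: ge_ereal_sup => _ [X [finX _] <-].
  rewrite fsbig_finite//= sumEFin lee_fin; apply: hB; exact: fset_uniq.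
split => //.
have h0 : (0 <= Hnorm2 r f)%E.
  by apply: esum_ge0 => k _; rewrite lee_fin mulr_ge0 ?powR_ge0 ?sqr_ge0.
rewrite /Hnorm sqr_sqrtr ?fine_ge0// -lee_fin fineK// ge0_fin_numE//.
exact: le_lt_trans h (ltry B).
Qed.

Lemma modc_sqrD (z w : R[i]) : modc (z + w) ^+ 2 <= 2 * modc z ^+ 2 + 2 * modc w ^+ 2.
Proof.
have h : modc (z + w) ^+ 2 <= (modc z + modc w) ^+ 2.
  by rewrite lerXn2r ?nnegrE ?addr_ge0 ?modc_ge0// ler_modcD.
apply: (le_trans h); have := sqr_ge0 (modc z - modc w).
rewrite sqrrB sqrrD; set a := modc z; set b := modc w; clear; lra.
Qed.

(** Working mode by mode with squares, the elementary inequality [modc_sqrD] takes the place of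
    Minkowski's; the factors 2 do no harm, as only finiteness and crude bounds are drawn from it. *)
Lemma Hper_lin r f g (a b : R) : (Hnorm2 r f < +oo)%E -> (Hnorm2 r g < +oo)%E -> bm f -> bm g ->
  (Hnorm2 r (fun x => (a * f x + b * g x)%R) < +oo)%E /\
  Hnorm r (fun x => a * f x + b * g x) ^+ 2 <=
    2 * a ^+ 2 * Hnorm r f ^+ 2 + 2 * b ^+ 2 * Hnorm r g ^+ 2.
Proof.
move=> Hf Hg bf bg.
set B := 2 * a ^+ 2 * Hnorm r f ^+ 2 + 2 * b ^+ 2 * Hnorm r g ^+ 2.
have B0 : 0 <= B by rewrite addr_ge0// mulr_ge0 ?sqr_ge0// mulr_ge0 ?sqr_ge0.
have H : forall s, uniq s ->
  \sum_(k <- s) bracket k `^ r * modc (fourier (fun x => a * f x + b * g x) k) ^+ 2 <= B.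
  move=> s us.
  apply: le_trans (_ : 2 * a ^+ 2 * \sum_(k <- s) bracket k `^ r * modc (fourier f k) ^+ 2 +
    2 * b ^+ 2 * \sum_(k <- s) bracket k `^ r * modc (fourier g k) ^+ 2 <= _); last first.
    have := Hper_sum Hf us; have := Hper_sum Hg us.
    have a2 : 0 <= 2 * a ^+ 2 by rewrite mulr_ge0 ?sqr_ge0.
    have b2 : 0 <= 2 * b ^+ 2 by rewrite mulr_ge0 ?sqr_ge0.
    by move=> hg hf; rewrite /B; exact: (lerD (ler_wpM2l a2 hf) (ler_wpM2l b2 hg)).
  rewrite !mulr_sumr -big_split /=; apply: ler_sum => k _.
  rewrite fourierD ?fourierZ//; try exact: bmZ.
  have := modc_sqrD (a%:C * fourier f k) (b%:C * fourier g k).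
  rewrite !modcM !modc_real !exprMn !real_normK ?num_real// => h.
  have w0 := powR_ge0 (bracket k) r.
  apply: le_trans (ler_wpM2l w0 h) _.
  by rewrite le_eqVlt; apply/orP; left; apply/eqP; ring.
have [h1 h2] := Hnorm_le B0 H.
by split; [apply: (le_lt_trans h1); rewrite ltry|exact: h2].
Qed.

Lemma continuous_bm f : L2per f -> continuous f -> bm f.
Proof.
move=> [_ mf _] cf; split; first exact: mf.
have cO : compact (Omega : set (R * R)) by apply: compact_setX; exact: segment_compact.
have cn : {within (Omega : set (R * R)), continuous (fun x => `|f x|)}.
  by apply: continuous_subspaceT => x; apply: cvg_norm; exact: cf.
have O0 : (Omega : set (R * R)) !=set0.
  have pi0 := @pi_ge0 R.
  by exists (0, 0); split; rewrite /= in_itv /= oppr_le0 pi0.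
have [y _ hy] := compact_EVT_max O0 cO cn.
by exists `|f y| => x xO; apply: hy; apply: mem_set.
Qed.

Definition fracc (alpha : R) c k : R[i] :=
  (Num.sqrt (sqnormk k) `^ alpha)%:C * c k.

Lemma sqnormkN k : sqnormk (- k) = sqnormk k :> R.
Proof. by rewrite /sqnormk /= !rmorphN !sqrrN. Qed.

Lemma herm_fracc alpha c : herm c -> herm (fracc alpha c).
Proof.
move=> h k; rewrite /fracc h sqnormkN rmorphM; congr (_ * _).
by rewrite /= oppr0.
Qed.

Lemma modc_fracc alpha c k :
  modc (fracc alpha c k) = Num.sqrt (sqnormk k) `^ alpha * modc (c k).
Proof. by rewrite modcM modc_real ger0_norm// powR_ge0. Qed.

Lemma fracLapE alpha f A g : wiener A (fracc alpha (fourier f)) g ->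
  fracLap alpha f = g.
Proof.
case=> _ _ h; apply/funext => x; rewrite -(cvg_lim _ (h x))//.
by rewrite /fracLap; congr (limn _); apply/funext => n; rewrite sum_kbox.
Qed.

Lemma sqrt_sqnormk_le k : Num.sqrt (sqnormk k) <= bracket k `^ (2^-1).
Proof.
rewrite powR12_sqrt ?(ltW (bracket_gt0 _))// ler_sqrt ?(ltW (bracket_gt0 _))//.
by rewrite /bracket lerDr.
Qed.

Lemma k1_le_sqrt k : `|k.1%:~R| <= Num.sqrt (sqnormk k) :> R.
Proof. by rewrite -sqrtr_sqr ler_sqrt /sqnormk ?lerDl ?addr_ge0 ?sqr_ge0. Qed.

Lemma sqnormk_ge0 k : 0 <= sqnormk k :> R.
Proof. by rewrite /sqnormk addr_ge0 ?sqr_ge0. Qed.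

Lemma powR_sqrt_le k alpha : 0 <= alpha ->
  Num.sqrt (sqnormk k) `^ alpha <= bracket k `^ (alpha / 2).
Proof.
move=> a0; rewrite mulrC powRrM; apply: ge0_ler_powR => //.
- by rewrite nnegrE sqrtr_ge0.
- by rewrite nnegrE powR_ge0.
- exact: sqrt_sqnormk_le.
Qed.

(* [Z] is the sum of [(1 + |k|^2)^(1 + alpha - r)]. *)
Lemma weighted_fourier_sum alpha r f (w : int * int -> R) (Z M : R) n : (Hnorm2 r f < +oo)%E ->
  (forall n, \sum_(k <- boxseq n) (bracket k `^ (r - 1 - alpha))^-1 <= Z) ->
  Hnorm r f <= M -> 0 <= M ->
  (forall k, 0 <= w k <= bracket k `^ ((1 + alpha) / 2)) ->
  \sum_(k <- boxseq n) w k * modc (fourier f k) <= Z + M ^+ 2.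
Proof.
move=> Hf hZ hM M0 hw.
have HM : Hnorm r f ^+ 2 <= M ^+ 2 by rewrite lerXn2r ?nnegrE// sqrtr_ge0.
apply: le_trans (lerD (hZ n) (le_trans (Hper_sum Hf (uniq_boxseq n)) HM)).
rewrite -big_split; apply: ler_sum => k _ /=.
have b0 := bracket_gt0 k.
have /andP[w0 w1] := hw k.
set a := modc (fourier f k); have a0 : 0 <= a by exact: modc_ge0.
apply: le_trans (ler_wpM2r a0 w1) _.
(* The weight factors as s t, where s^2 is the weight of H^r and t^2 the summable weight; then s t a
   <= (s a)^2 + t^2, which yields [M ^+ 2] and [Z] respectively. *)
set s := bracket k `^ (r / 2).
set t := (bracket k `^ ((r - 1 - alpha) / 2))^-1.
have E1 : bracket k `^ ((1 + alpha) / 2) = s * t.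
  rewrite /s /t -powRN -powRD_gt0//; congr (_ `^ _); lra.
have E2 : bracket k `^ r = s ^+ 2.
  rewrite -powR_mulrn ?powR_ge0// -powRrM; congr (_ `^ _); lra.
have E3 : (bracket k `^ (r - 1 - alpha))^-1 = t ^+ 2.
  rewrite /t exprVn; congr (_^-1).
  rewrite -powR_mulrn ?powR_ge0// -powRrM; congr (_ `^ _); lra.
rewrite E1 E2 E3.
have s0 : 0 <= s by exact: powR_ge0.
have t0 : 0 <= t by rewrite invr_ge0 powR_ge0.
have := sqr_ge0 (s * a - t); have := sqr_ge0 (s * a); have := sqr_ge0 t.
have -> : s ^+ 2 * a ^+ 2 = (s * a) ^+ 2 by rewrite exprMn.
have -> : s * t * a = (s * a) * t by ring.
set y := s * a; clear => *; nra.
Qed.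

(** The series sums to a continuous periodic [g] with the coefficients of [f]; uniqueness forces
    [g = f]. *)
Lemma fourier_wiener A f : bm f -> Defs.periodic f -> continuous f ->
  (forall n, \sum_(k <- boxseq n) modc (fourier f k) <= A) ->
  wiener A (fourier f) f.
Proof.
move=> bf pf cf hA.
have hc : herm (fourier f) by move=> k; exact: fourier_conj.
have [g wg] := wiener_exists hc hA.
suff gf : g = f by rewrite gf in wg.
have bg := wiener_bm wg.
apply/funext => x; apply/eqP; rewrite -subr_eq0; apply/eqP.
apply: (@fourier_eq0 _ (fun x => g x - f x)).
- exact: bmB.
- have pg := wiener_periodic wg.
  by move=> x1 x2; rewrite (pg x1 x2).1 (pg x1 x2).2 (pf x1 x2).1 (pf x1 x2).2.
- by move=> y; apply: cvgB; [exact: (wiener_continuous wg)|exact: cf].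
- by move=> k; rewrite fourierB// (wiener_fourier k wg) subrr.
Qed.

(** Here [f1], [g] and [g1] are d_1 f, (-Delta)^(alpha/2) f and d_1 (-Delta)^(alpha/2) f, given as
    sums of their series with one common bound; [regularE] identifies them with the pointwise
    operators. *)
Record regular (A alpha : R) f f1 g g1 : Prop := Regular {
  reg_bm : bm f;
  reg_u : wiener A (fourier f) f;
  reg_u1 : wiener A (dc (fourier f)) f1;
  reg_lap : wiener A (fracc alpha (fourier f)) g;
  reg_lap1 : wiener A (dc (fracc alpha (fourier f))) g1 }.

(** The multipliers 1, |k_1|, |k|^alpha and |k_1| |k|^alpha are all at most (1 + |k|^2)^((1 +
    alpha)/2), so one weighted sum controls the four series. *)
Lemma Hper_regular alpha r f (Z M : R) : 0 < alpha -> Hper r f -> continuous f ->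
  (forall n, \sum_(k <- boxseq n) (bracket k `^ (r - 1 - alpha))^-1 <= Z) ->
  Hnorm r f <= M -> 0 <= M ->
  exists f1 g g1, regular (Z + M ^+ 2) alpha f f1 g g1.
Proof.
move=> a0 Hf cf hZ hM M0.
have bf := continuous_bm Hf.1 cf; have [[pf _ _] _] := Hf.
have hc : herm (fourier f) by move=> k; exact: fourier_conj.
have W w n := @weighted_fourier_sum alpha r f w Z M n Hf.2 hZ hM M0.
have b1 k := bracket_ge1 k.
have w0 : wiener (Z + M ^+ 2) (fourier f) f.
  apply: fourier_wiener => // n.
  rewrite (eq_bigr (fun k => 1 * modc (fourier f k))); last by move=> k _; rewrite mul1r.
  apply: W => k; rewrite ler01 /= -[X in X <= _](powRr0 (bracket k)); apply: ler_powR => //.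
  by rewrite divr_ge0// addr_ge0// ltW.
have [f1 w1] : exists f1, wiener (Z + M ^+ 2) (dc (fourier f)) f1.
  apply: wiener_exists; first exact: herm_dc.
  move=> n; rewrite (eq_bigr (fun k => `|k.1%:~R| * modc (fourier f k))); last first.
    by move=> k _; rewrite modc_dc.
  apply: W => k; rewrite normr_ge0 /=; apply: le_trans (k1_le_sqrt k) _.
  apply: le_trans (sqrt_sqnormk_le k) _; apply: ler_powR => //.
  by rewrite -[X in X <= _]mul1r ler_pM2r ?invr_gt0// lerDl ltW.
have [g w2] : exists g, wiener (Z + M ^+ 2) (fracc alpha (fourier f)) g.
  apply: wiener_exists; first exact: herm_fracc.
  move=> n; rewrite (eq_bigr (fun k => Num.sqrt (sqnormk k) `^ alpha * modc (fourier f k))); last first.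
    by move=> k _; rewrite modc_fracc.
  apply: W => k; rewrite powR_ge0 /=.
  apply: le_trans (powR_sqrt_le k (ltW a0)) _; apply: ler_powR => //.
  by rewrite ler_pM2r ?invr_gt0// lerDr.
have [g1 w3] : exists g1, wiener (Z + M ^+ 2) (dc (fracc alpha (fourier f))) g1.
  apply: wiener_exists; first by apply: herm_dc; exact: herm_fracc.
  move=> n; rewrite (eq_bigr (fun k => (`|k.1%:~R| * Num.sqrt (sqnormk k) `^ alpha) * modc (fourier f k))); last first.
    by move=> k _; rewrite modc_dc modc_fracc mulrA.
  apply: W => k; rewrite mulr_ge0 ?powR_ge0//=.
  rewrite mulrDl mul1r powRD_gt0 ?bracket_gt0//.
  apply: ler_pM; rewrite ?powR_ge0//.
    exact: le_trans (k1_le_sqrt k) (sqrt_sqnormk_le k).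
  exact: powR_sqrt_le (ltW a0).
by exists f1, g, g1; split.
Qed.

End Sobolev.

(** * Inner products and differentiation in time *)

Section InnerProduct.
Context {R : realType}.
Implicit Types (f g h : R * R -> R).

Lemma ip_ge0 f : 0 <= ip f f.
Proof. by apply: I_ge0 => x _; rewrite -expr2 sqr_ge0. Qed.

Lemma L2norm_sqr f : L2norm f ^+ 2 = ip f f.
Proof. by rewrite /L2norm sqr_sqrtr// ip_ge0. Qed.

Lemma ipC f g : ip f g = ip g f.
Proof. by apply: eq_I => x _; rewrite mulrC. Qed.

Lemma ipDl f g h : bm f -> bm g -> bm h ->
  ip (fun x => f x + g x) h = ip f h + ip g h.
Proof.
move=> bf bg bh; rewrite /ip -ID; [|exact: bmM|exact: bmM].
by apply: eq_I => x _; rewrite mulrDl.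
Qed.

Lemma ipBl f g h : bm f -> bm g -> bm h ->
  ip (fun x => f x - g x) h = ip f h - ip g h.
Proof.
move=> bf bg bh; rewrite /ip -IB; [|exact: bmM|exact: bmM].
by apply: eq_I => x _; rewrite mulrBl.
Qed.

Lemma ipZl (a : R) f h : bm f -> bm h -> ip (fun x => a * f x) h = a * ip f h.
Proof.
move=> bf bh; rewrite /ip -IZ; [|exact: bmM].
by apply: eq_I => x _; rewrite mulrA.
Qed.

Lemma ip_young f g (a : R) : bm f -> bm g -> 0 < a ->
  2 * `|ip f g| <= a * ip f f + a^-1 * ip g g.
Proof.
move=> bf bg a0.
have H h : bm h -> (2 * ip f h <= a * ip f f + a^-1 * ip h h).
  move=> bh; rewrite /ip -!IZ -?ID; try exact: bmM; last 2 first.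
  - by apply: bmZ; exact: bmM.
  - by apply: bmZ; exact: bmM.
  apply: le_I; first by apply: bmZ; exact: bmM.
    by apply: bmD; apply: bmZ; exact: bmM.
  move=> x _; rewrite -subr_ge0.
  have -> : a * (f x * f x) + a^-1 * (h x * h x) - 2 * (f x * h x) =
     a^-1 * (a * f x - h x) ^+ 2 by field; rewrite gt_eqF.
  by rewrite mulr_ge0 ?invr_ge0 ?sqr_ge0// ltW.
have [h|h] := ler0P (ip f g); last exact: H.
have := H (fun x => - g x) (bmN bg).
have -> : ip f (fun x => - g x) = - ip f g.
  by rewrite /ip -IN; [|exact: bmM]; apply: eq_I => x _; rewrite mulrN.
have -> // : ip (fun x => - g x) (fun x => - g x) = ip g g.
by apply: eq_I => x _; rewrite mulrNN.
Qed.

Lemma ip_sqrD f g : bm f -> bm g ->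
  ip (fun x => f x + g x) (fun x => f x + g x) <= 2 * ip f f + 2 * ip g g.
Proof.
move=> bf bg; rewrite /ip -!IZ -?ID; try exact: bmM; last 2 first.
- by apply: bmZ; exact: bmM.
- by apply: bmZ; exact: bmM.
apply: le_I; first by apply: bmM; exact: bmD.
  by apply: bmD; apply: bmZ; exact: bmM.
move=> x _; have := sqr_ge0 (f x - g x).
by rewrite expr2 => h; clear -h; lra.
Qed.

Lemma ip_sqrB f g : bm f -> bm g ->
  ip (fun x => f x - g x) (fun x => f x - g x) <= 2 * ip f f + 2 * ip g g.
Proof.
move=> bf bg; have := ip_sqrD bf (bmN bg).
have -> // : ip (fun x => - g x) (fun x => - g x) = ip g g.
by apply: eq_I => x _; rewrite mulrNN.
Qed.

Lemma ip_mul_le f g (A : R) : bm f -> bm g -> (forall x, Omega x -> `|f x| <= A) ->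
  ip (fun x => f x * g x) (fun x => f x * g x) <= A ^+ 2 * ip g g.
Proof.
move=> bf bg fA; rewrite /ip -IZ; last exact: bmM.
apply: le_I; first by apply: bmM; exact: bmM.
  by apply: bmZ; exact: bmM.
move=> x /fA h; have -> : f x * g x * (f x * g x) = f x ^+ 2 * (g x * g x) by ring.
rewrite ler_wpM2r -?expr2 ?sqr_ge0//.
rewrite -real_normK ?num_real// lerXn2r ?nnegrE//.
exact: le_trans (normr_ge0 _) h.
Qed.

Lemma ip_rtp N c : herm c ->
  ip (rtp N c) (rtp N c) = cell * \sum_(k <- boxseq N) modc (c k) ^+ 2 :> R.
Proof.
move=> hc.
have := @ip_tp _ N c (rtp N c) (rtp N c) (bm_rtp _ _) (fun x => rtpE N x hc).
have -> : \sum_(k <- boxseq N) fourier (rtp N c) k * ((c k)^*)%C =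
  (\sum_(k <- boxseq N) modc (c k) ^+ 2)%:C.
  rewrite rmorph_sum.
  by apply: eq_big_seq => k km; rewrite fourier_rtp// km mulzconj.
by rewrite -rmorphM => -[].
Qed.

End InnerProduct.

Section TimeCalculus.
Context {R : realType}.
Implicit Types (T : R) (y dy : R -> R) (w wt : R -> R * R -> R).

(** Differentiability relative to [0,T], one-sided at the end points, as a first-order expansion in
    which s = t is harmless. *)
Definition diff_on T y dy := forall t : R, 0 <= t <= T -> forall e : R, 0 < e ->
  exists2 d : R, 0 < d & forall s : R, 0 <= s <= T -> `|s - t| < d ->
    `|y s - y t - (s - t) * dy t| <= e * `|s - t|.

Lemma diff_on_is_derive T y dy t : diff_on T y dy -> 0 < t < T ->
  is_derive t (1 : R) y (dy t).
Proof.
move=> h /andP[t0 tT]; have tb : 0 <= t <= T by rewrite !ltW.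
suff H : (fun s : R => s^-1 *: ((y \o shift t) (s *: 1) - y t)) @ 0^' --> dy t.
  split; first by apply/cvg_ex; exists (dy t).
  exact: cvg_lim H.
apply/cvgrPdist_le => e e0; have [d d0 H] := h t tb e e0.
pose m := Num.min d (Num.min t (T - t)).
have m0 : 0 < m by rewrite !lt_min d0 t0 subr_gt0.
have ms : m <= d /\ m <= t /\ m <= T - t.
  by rewrite /m; split; [|split]; rewrite !ge_min lexx ?orbT.
near=> s.
have s0 : s != 0 by near: s; exact: nbhs_dnbhs_neq.
have sm : `|s| < m.
  near: s; apply: dnbhs0_lt => //.
have := H (s + t); rewrite addrK /= /GRing.scale /= mulr1.
move=> /(_ _ _)/wrap[].
- by have [_ [m1 m2]] := ms; move: sm; rewrite ltr_norml => /andP[*]; apply/andP; split; lra.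
- by have [m1 _] := ms; lra.
move=> hs; have -> : dy t - s^-1 * (y (s + t) - y t) =
   - (s^-1 * (y (s + t) - y t - s * dy t)) by field.
by rewrite normrN normrM normfV ler_pdivrMl ?normr_gt0// [X in _ <= X]mulrC.
Unshelve. all: by end_near. Qed.

Lemma diff_on_continuous T y dy : diff_on T y dy -> {within `[0, T], continuous y}.
Proof.
move=> h; apply/subspace_continuousP => t /=; rewrite in_itv /= => tb.
apply/cvgrPdist_le => e e0; have [d d0 H] := h t tb 1 ltr01.
pose B := 1 + `|dy t|; have B0 : 0 < B by rewrite ltr_wpDr.
have de : 0 < Num.min d (e / B) by rewrite lt_min d0 divr_gt0.
rewrite near_withinE; near=> s; rewrite /= in_itv /= => sb.
have : `|t - s| < Num.min d (e / B).
  by near: s; apply: cvgr_dist_lt => //; exact: cvg_id.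
rewrite lt_min distrC => /andP[s1 s2]; have := H s sb s1; rewrite mul1r => hs.
have -> : y t - y s = - ((y s - y t - (s - t) * dy t) + (s - t) * dy t) by ring.
rewrite normrN; apply: le_trans (ler_normD _ _) _; rewrite normrM.
rewrite ltr_pdivlMr// in s2; apply: le_trans (ltW s2).
by rewrite /B mulrDr mulr1 lerD2r.
Unshelve. all: by end_near. Qed.

Lemma gronwall_bound T y dy (a b : R) : diff_on T y dy -> 0 <= a -> 0 <= b ->
  (forall t, 0 < t < T -> dy t <= a * y t + b) -> y 0 = 0 ->
  forall t, 0 <= t <= T -> y t <= b * T * expR (a * T).
Proof.
move=> hd a0 b0 hy y0 t /andP[t0 tT].
(* Its derivative e^(-a s) (y' - a y) - b is nonpositive, because y' - a y <= b and e^(-a s) <= 1;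
   so z(t) <= z(0) = 0 by the mean value theorem. *)
pose z s := expR (- a * s) * y s - b * s.
have dexp (s : R) : is_derive s (1 : R) (fun s => expR (- a * s)) (- a * expR (- a * s)).
  have h : is_derive s (1 : R) (fun s => - a * s) (- a).
    have := is_deriveZ (- a) (is_derive_id s (1 : R)).
    by move=> h; apply: (is_derive_eq h); rewrite /GRing.scale /= mulr1.
  have := @is_derive1_comp R expR (fun s => - a * s) s _ _ (is_derive_expR (- a * s)) h.
  by rewrite mulrC.
have dz s : s \in `]0, t[ -> is_derive s (1 : R) z
    (expR (- a * s) * (dy s - a * y s) - b).
  rewrite in_itv /= => /andP[s0 st].
  have dys : is_derive s (1 : R) y (dy s).
    by apply: diff_on_is_derive hd _; rewrite s0 (lt_le_trans st).
  have := is_deriveB (is_deriveM (dexp s) dys) (is_deriveZ b (is_derive_id s (1 : R))).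
  by move=> h; apply: (is_derive_eq h); rewrite /GRing.scale /=; ring.
have cy : {within `[0, t], continuous y}.
  apply: continuous_subspaceW (diff_on_continuous hd).
  by move=> s /=; rewrite !in_itv /= => /andP[-> h]; exact: le_trans h tT.
have cexp : {within `[0, t], continuous (fun s => expR (- a * s))}.
  apply: continuous_subspaceT => s.
  by apply: differentiable_continuous; apply/derivable1_diffP; case: (dexp s).
have cz : {within `[0, t], continuous z}.
  move=> s; apply: cvgB; first by apply: cvgM; [exact: cexp|exact: cy].
  have : {within `[0, t], continuous (fun s => b * s)}.
    by apply: continuous_subspaceT => q; apply: cvgM; [exact: cvg_cst|exact: cvg_id].
  exact.
have z0 : z 0 = 0 by rewrite /z y0 !mulr0 subr0.
have zt : z t <= 0.
  have [->|tn0] := eqVneq t 0; first by rewrite z0.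
  have tpos : 0 < t by rewrite lt_def tn0.
  have [c' cI' E'] := MVT tpos dz cz.
  rewrite z0 subr0 in E'; rewrite E' subr0.
  move: cI'; rewrite in_itv /= => /andP[c0 ct].
  have h1 : dy c' - a * y c' <= b.
    by have := hy c'; rewrite c0 (lt_le_trans ct tT) => /(_ isT); lra.
  have e1 : expR (- a * c') <= 1.
    by rewrite -expR0 ler_expR mulNr oppr_le0 mulr_ge0// ltW.
  have e0 := expR_gt0 (- a * c').
  rewrite mulr_le0_ge0// subr_le0.
  apply: le_trans (_ : expR (- a * c') * b <= _); first by rewrite ler_pM2l.
  by rewrite ler_piMl.
have : expR (- a * t) * y t <= b * t by move: zt; rewrite /z subr_le0.
rewrite mulNr expRN mulrC ler_pdivrMr ?expR_gt0// => h; apply: (le_trans h).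
apply: ler_pM => //.
- by rewrite mulr_ge0.
- by rewrite ler_wpM2l.
- by rewrite ler_expR ler_wpM2l.
Qed.

Lemma is_C1_eps (nrm : (R * R -> R) -> R) T w wt t (e : R) :
  is_C1 nrm T w wt -> 0 <= t <= T -> 0 < e ->
  exists2 d : R, 0 < d & forall s : R, 0 <= s <= T -> s != t -> `|s - t| < d ->
    nrm (fun x => (s - t)^-1 * (w s x - w t x) - wt t x) <= e.
Proof.
move=> h tb e0; have [+ _] := h t tb.
move=> /cvgrPdist_le/(_ e e0).
rewrite !near_withinE => /nbhs_ballP[d /= d0 H].
exists d => // s sb st sd.
have := H s; rewrite /ball /= distrC => /(_ sd st).
rewrite in_itv /= sb => /(_ isT).
by rewrite sub0r normrN => hh; apply: le_trans (ler_norm _) hh.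
Qed.

(** L2 convergence of difference quotients, in squared form: enough to differentiate the squared
    norm of [w]. *)
Definition diff_q T w wt := forall t : R, 0 <= t <= T -> forall e : R, 0 < e ->
  exists2 d : R, 0 < d & forall s : R, 0 <= s <= T -> s != t -> `|s - t| < d ->
    ip (fun x => (s - t)^-1 * (w s x - w t x) - wt t x)
       (fun x => (s - t)^-1 * (w s x - w t x) - wt t x) <= e.

Lemma diff_q_diff_on T w wt :
  (forall t, 0 <= t <= T -> bm (w t) /\ bm (wt t)) -> diff_q T w wt ->
  diff_on T (fun t => ip (w t) (w t)) (fun t => 2 * ip (wt t) (w t)).
Proof.
move=> hb hd t tb e e0; have [bw bwt] := hb t tb.
have q0 := ip_ge0 (w t); have qt0 := ip_ge0 (wt t).
(* With w(s) = w(t) + (s - t) (wt + D), the remainder divided by s - t is 2 (w, D) + (s - t) |wt +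
   D|^2. The Young weight [a] and the bound [m] on |D|^2 give e/4 + e/4 for the first term, and |s -
   t| < r gives e/2 for the second. *)
pose a := e / (4 * (ip (w t) (w t) + 1)).
have D0 : 0 < 4 * (ip (w t) (w t) + 1) by rewrite mulr_gt0//; clear -q0; lra.
have a0 : 0 < a by rewrite divr_gt0.
have aq : a * ip (w t) (w t) <= e / 4.
  have : a * (4 * (ip (w t) (w t) + 1)) = e by rewrite /a divfK// gt_eqF.
  move: (ip (w t) (w t)) q0 a a0 => v v0 a a0; clear -v0 a0; lra.
pose m := Num.min 1 (a * (e / 4)).
have m0 : 0 < m by rewrite lt_min ltr01 mulr_gt0// divr_gt0.
have [d d0 H] := hd t tb m m0.
pose r := e / (4 * (ip (wt t) (wt t) + 1)).
have E0 : 0 < 4 * (ip (wt t) (wt t) + 1) by rewrite mulr_gt0//; clear -qt0; lra.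
have r0 : 0 < r by rewrite divr_gt0.
have rq : r * (2 * ip (wt t) (wt t) + 2) <= e / 2.
  have : r * (4 * (ip (wt t) (wt t) + 1)) = e by rewrite /r divfK// gt_eqF.
  move: (ip (wt t) (wt t)) => v; clear; lra.
exists (Num.min d r); first by rewrite lt_min d0 r0.
move=> s sb; rewrite lt_min => /andP[sd sr]; have [bws _] := hb s sb.
have [->|st] := eqVneq s t; first by rewrite !subrr mul0r subrr !normr0 mulr0.
set D := fun x => (s - t)^-1 * (w s x - w t x) - wt t x.
have bD : bm D by apply: bmB => //; apply: bmZ; exact: bmB.
have st0 : s - t != 0 by rewrite subr_eq0.
have qD := H s sb st sd; rewrite -/D in qD.
have qD1 : ip D D <= 1 by apply: (le_trans qD); rewrite /m ge_min lexx.
have qD2 : ip D D <= a * (e / 4) by apply: (le_trans qD); rewrite /m ge_min lexx orbT.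
have ws : w s = fun x => w t x + (s - t) * (wt t x + D x).
  by apply/funext => x; rewrite /D; field.
have -> : ip (w s) (w s) - ip (w t) (w t) - (s - t) * (2 * ip (wt t) (w t)) =
  (s - t) * (2 * ip (w t) D + (s - t) * ip (fun x => wt t x + D x) (fun x => wt t x + D x)).
  have bwD : bm (fun x => wt t x + D x) by exact: bmD.
  have b3 : bm (fun x => (s - t) * (wt t x + D x)) by exact: bmZ.
  rewrite {1 2}ws ipDl// ?(ipC _ (fun x => w t x + (s - t) * (wt t x + D x))); last exact: bmD.
  rewrite [ip (fun x => w t x + (s - t) * (wt t x + D x)) (w t)]ipDl//.
  rewrite [ip (fun x => w t x + (s - t) * (wt t x + D x)) _]ipDl//.
  rewrite [ip (w t) (fun x => (s - t) * _)]ipC !ipZl//.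
  rewrite [ip (fun x => wt t x + D x) (w t)]ipDl// (ipC D).
  rewrite [ip (fun x => wt t x + D x) (fun x => (s - t) * _)]ipC ipZl//.
  ring.
rewrite normrM mulrC ler_wpM2r//.
apply: le_trans (ler_normD _ _) _; rewrite normrM (@normr_nat R 2).
have y1 := ip_young bw bD a0.
have : a^-1 * ip D D <= e / 4 by rewrite ler_pdivrMl.
have : `|(s - t) * ip (fun x => wt t x + D x) (fun x => wt t x + D x)| <= e / 2.
  rewrite normrM (ger0_norm (ip_ge0 _)); apply: le_trans rq.
  apply: ler_pM => //; first exact: ip_ge0; first exact: ltW.
  apply: le_trans (ip_sqrD bwt bD) _; rewrite lerD2l; clear -qD1; lra.
clear -aq y1; lra.
Qed.

End TimeCalculus.

(** * The energy inequality for the Galerkin error *)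

Section Galerkin.
Context {R : realType}.
Implicit Types (f g v : R * R -> R) (A alpha : R).
Implicit Types (k : int * int) (x : R * R) (c : int * int -> R[i]).
Local Notation I f := (\int[leb2]_(x in Omega) f x).

Lemma realcD (a b : R) : (a + b)%:C = a%:C + b%:C.
Proof. by apply: complexP; rewrite //= addr0. Qed.

Lemma wiener_rtp N c : herm c -> (forall k, k \notin boxseq N -> c k = 0) ->
  wiener (\sum_(k <- boxseq N) modc (c k)) c (rtp N c : R * R -> R).
Proof.
move=> hc h0; split => // [n|x].
  have [nN|Nn] := leqP n N; first by apply: ler_sum_boxseq => // k; exact: modc_ge0.
  rewrite (big_boxseq_split _ (ltnW Nn)) [X in _ + X]big1 ?addr0// => k /h0 ->.
  exact: modc0.
apply/cvgn_leP => e e0; exists N => n Nn.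
rewrite rtpB// big1 /= ?normr0 ?ltW// => k /h0 ->; by rewrite mul0r.
Qed.

Lemma XN_bm N v : XN N v -> bm v.
Proof.
by case=> c hc; apply: (@tp_bm _ N c) => x; rewrite hc sum_kbox.
Qed.

Lemma XN_fourier0 N v k : XN N v -> k \notin boxseq N -> fourier v k = 0.
Proof.
case=> c hc kN; rewrite (@fourier_tp _ N c v); first by rewrite (negbTE kN).
by move=> x _; rewrite hc sum_kbox.
Qed.

Lemma herm_fourier f : bm f -> herm (fourier f).
Proof. by move=> bf k; exact: fourier_conj. Qed.

(** By orthogonality the coefficients in [XN] agree on the box with the Fourier coefficients, which
    are hermitian because [v] is real. *)
Lemma XN_rtpE N v : XN N v -> v = rtp N (fourier v).
Proof.
move=> hv; have bv := XN_bm hv; have [c hc] := hv.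
apply/funext => x; apply: (@complexI R); rewrite rtpE; last exact: herm_fourier.
rewrite hc sum_kbox; apply: eq_big_seq => k kN; congr (_ * _).
by rewrite (@fourier_tp _ N c v) ?kN// => y _; rewrite hc sum_kbox.
Qed.

Lemma dx1_rtp N c x : dx1 (rtp N c) x = rtp N (dc c) x :> R.
Proof.
by case: x => s b; rewrite /dx1 derive1E /=; have h := is_derive_rtp N c b s; rewrite derive_val.
Qed.

Lemma fracLap_XN alpha N v : XN N v -> fracLap alpha v = rtp N (fracc alpha (fourier v)).
Proof.
move=> hv; apply: fracLapE; apply: wiener_rtp.
  by apply: herm_fracc; apply: herm_fourier; exact: XN_bm hv.
by move=> k /(XN_fourier0 hv); rewrite /fracc => ->; rewrite mulr0.
Qed.

Lemma ip_rtpr N c f : bm f -> herm c ->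
  (ip f (rtp N c))%:C = cell%:C * \sum_(k <- boxseq N) fourier f k * ((c k)^*)%C.
Proof. by move=> bf hc; apply: ip_tp => // x; rewrite rtpE. Qed.

Lemma ip_proj N c f : bm f -> herm c ->
  ip (rtp N (fourier f)) (rtp N c) = ip f (rtp N c).
Proof.
move=> bf hc; apply: (@complexI R); rewrite !ip_rtpr//; last exact: bm_rtp.
congr (_ * _); apply: eq_big_seq => k kN.
by rewrite fourier_rtp ?kN//; exact: herm_fourier.
Qed.

(* The skew-symmetry of [dx1 (-Delta)^(alpha/2)]. *)
Lemma dispersion_cancel alpha N g (a b : int * int -> R[i]) : bm g -> herm a -> herm b ->
  (forall k, fourier g k = dc (fracc alpha a) k) ->
  ip g (rtp N (fun k => a k - b k)) +
  ip (rtp N (fracc alpha b)) (rtp N (dc (fun k => a k - b k))) = 0.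
Proof.
move=> bg ha hb hg; set c := fun k => a k - b k.
have hc : herm c by move=> k; rewrite /c ha hb rmorphB.
have hdc : herm (dc c) by exact: herm_dc.
have hfb : herm (fracc alpha b) by exact: herm_fracc.
(* The mode k contributes i k_1 |k|^alpha |c_k|^2, which is purely imaginary, whereas the sum of the
   two inner products is real. *)
have : (ip g (rtp N c) + ip (rtp N (fracc alpha b)) (rtp N (dc c)))%:C =
  cell%:C * \sum_(k <- boxseq N)
    (0 +i* (k.1%:~R * (Num.sqrt (sqnormk k) `^ alpha) * modc (c k) ^+ 2)).
  rewrite realcD ip_rtpr// ip_rtpr//; last exact: bm_rtp.
  rewrite -mulrDr -big_split; congr (_ * _); apply: eq_big_seq => k kN.
  rewrite fourier_rtp// kN hg /dc /fracc -/(c k).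
  rewrite modc_sqr /c; case: (a k) => a1 a2; case: (b k) => b1 b2.
  by apply: complexP => /=; ring.
move/(congr1 (@complex.Re R)); rewrite /= => ->.
have -> : \sum_(k <- boxseq N) (0 +i* (k.1%:~R * (Num.sqrt (sqnormk k) `^ alpha) * modc (c k) ^+ 2)) =
  0 +i* \sum_(k <- boxseq N) (k.1%:~R * (Num.sqrt (sqnormk k) `^ alpha) * modc (c k) ^+ 2).
  by apply: complexP; rewrite ?cRe_sum ?cIm_sum //= big1.
by rewrite /=; ring.
Qed.

(* The integrand of the difference is the [x1]-derivative of
   w^2 th / 2 - w th^2 / 2 + th^3 / 6. *)
Lemma transport_cancel N (a b : int * int -> R[i]) :
  let w := rtp N a in let th := rtp N b in
  let w1 := rtp N (dc a) in let th1 := rtp N (dc b) in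
  2^-1 * ip (fun x => (w x - th x) ^+ 2) th1 =
  - ip (fun x => w x * w1 x) th + 2^-1 * ip w1 (fun x => th x * th x).
Proof.
move=> w th w1 th1.
have bw : bm w by exact: bm_rtp.
have bt : bm th by exact: bm_rtp.
have bw1 : bm w1 by exact: bm_rtp.
have bt1 : bm th1 by exact: bm_rtp.
pose G x := w x * w1 x * th x + 2^-1 * (w x * w x * th1 x) - 2^-1 * (w1 x * (th x * th x))
   - w x * (th x * th1 x) + 2^-1 * (th x * th x * th1 x).
have bG : bm G.
  apply: bmD; last by apply: bmZ; do ?apply: bmM.
  apply: bmB; last by do ?apply: bmM.
  apply: bmB; last by apply: bmZ; do ?apply: bmM.
  apply: bmD; last by apply: bmZ; do ?apply: bmM.
  by do ?apply: bmM.
have G0 : I G = 0.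
  apply: (@I_derive1_eq0 _ (fun x => 2^-1 * (w x * w x * th x) - 2^-1 * (w x * (th x * th x))
      + 6^-1 * (th x * (th x * th x)))) => //.
  - move=> b0 s; have dw := is_derive_rtp N a b0 s; have dt := is_derive_rtp N b b0 s.
    have h := is_deriveD (is_deriveB (is_deriveZ 2^-1 (is_deriveM (is_deriveM dw dw) dt))
      (is_deriveZ 2^-1 (is_deriveM dw (is_deriveM dt dt))))
      (is_deriveZ 6^-1 (is_deriveM dt (is_deriveM dt dt))).
    apply: (is_derive_eq h); rewrite !mulrfctE /GRing.scale /= /G /w /w1 /th /th1; by field.
  - move=> b0.
    have cc c : continuous (fun s : R => rtp N c (s, b0)).
      move=> s; have := is_derive_rtp N c b0 s => h.
      by apply: differentiable_continuous; apply/derivable1_diffP; case: h.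
    have cM (f g : R -> R) : continuous f -> continuous g -> continuous (fun s => f s * g s).
      by move=> hf hg s; apply: cvgM; [exact: hf|exact: hg].
    have cD (f g : R -> R) : continuous f -> continuous g -> continuous (fun s => f s + g s).
      by move=> hf hg s; apply: cvgD; [exact: hf|exact: hg].
    have cB (f g : R -> R) : continuous f -> continuous g -> continuous (fun s => f s - g s).
      by move=> hf hg s; apply: cvgB; [exact: hf|exact: hg].
    have cZ (f : R -> R) : continuous f -> continuous (fun s => 2^-1 * f s).
      by move=> hf; apply: cM => // s; exact: cvg_cst.
    have c1 := cc a; have c2 := cc b; have c3 := cc (dc a); have c4 := cc (dc b).
    exact: (cD _ _ (cB _ _ (cB _ _ (cD _ _ (cM _ _ (cM _ _ c1 c3) c2)
      (cZ _ (cM _ _ (cM _ _ c1 c1) c4))) (cZ _ (cM _ _ c3 (cM _ _ c2 c2))))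
      (cM _ _ c1 (cM _ _ c2 c4))) (cZ _ (cM _ _ (cM _ _ c2 c2) c4))).
  - move=> b0.
    have pp c : rtp N c (pi, b0) = rtp N c (- pi, b0).
      by rewrite -(periodic_rtp N c (- pi) b0).1; congr (rtp N c (_, _)); ring.
    by rewrite /w /th !pp.
apply/eqP; rewrite -subr_eq0; apply/eqP; rewrite -[RHS]G0.
have b1 : bm (fun x => (w x - th x) ^+ 2 * th1 x).
  by apply: bmM => //; apply: bmX; exact: bmB.
have b2 : bm (fun x => w x * w1 x * th x) by do 2 apply: bmM => //.
have b3 : bm (fun x => w1 x * (th x * th x)) by do 2 apply: bmM => //.
rewrite /ip -(IZ _ b1) -(IN b2) -(IZ _ b3) -ID -?IB.
- by apply: eq_I => x _; rewrite /G; field.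
- exact: bmZ.
- by apply: bmD; [exact: bmN|exact: bmZ].
- exact: bmN.
- exact: bmZ.
Qed.

Lemma galerkin_energy alpha A (delta : R) N (u ut f1 g g1 v vt : R * R -> R) :
  regular A alpha u f1 g g1 -> bm ut -> 0 <= A ->
  (forall x, Omega x -> ut x - g1 x + u x * f1 x = 0) ->
  XN N v -> XN N vt ->
  (forall z, XN N z -> ip vt z + ip (fracLap alpha v) (dx1 z)
     - 2^-1 * ip (fun x => v x ^+ 2) (dx1 z) = 0) ->
  let th x := rtp N (fourier u) x - v x in
  let tht x := rtp N (fourier ut) x - vt x in
  ip (fun x => u x - rtp N (fourier u) x) (fun x => u x - rtp N (fourier u) x) +
  ip (fun x => f1 x - rtp N (dc (fourier u)) x) (fun x => f1 x - rtp N (dc (fourier u)) x) <= delta ->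
  2 * ip tht th <= 3 * A * ip th th + A * delta.
Proof.
move=> [bu wu wu1 wl wl1] but A0 pde hv hvt gal th tht hdelta.
have bv := XN_bm hv; have bvt := XN_bm hvt.
have hu := herm_fourier bu; have hfv := herm_fourier bv.
pose c k := fourier u k - fourier v k.
have hc : herm c by move=> k; rewrite /c hu hfv rmorphB.
have thE : th = rtp N c.
  apply/funext => x; rewrite /th {1}(XN_rtpE hv) /rtp -cReN -cReD; congr complex.Re.
  rewrite /tp -sumrB; apply: eq_bigr => k _; by rewrite mulrBl.
set w := rtp N (fourier u); set w1 := rtp N (dc (fourier u)).
have bw : bm w by exact: bm_rtp.
have bw1 : bm w1 by exact: bm_rtp.
have bth : bm th by rewrite thE; exact: bm_rtp.
have bf1 := wiener_bm wu1; have bg1 := wiener_bm wl1.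
have Xth : XN N th by rewrite thE; exact: XN_rtp.
have dth : dx1 th = rtp N (dc c) by apply/funext => x; rewrite thE dx1_rtp.
(* As [th] lies in X_N, the truncation of [ut] may be replaced by [ut] under the inner product. *)
have e1 : ip tht th = ip ut th - ip vt th.
  rewrite /tht ipBl//; last exact: bm_rtp.
  by rewrite {1}thE ip_proj// -thE.
have e2 : ip ut th = ip g1 th - ip (fun x => u x * f1 x) th.
  rewrite -ipBl//; last exact: bmM.
  by apply: eq_I => x /pde h; congr (_ * _); move: h; clear; lra.
have e3 := gal th Xth.
have e4 : ip g1 th + ip (fracLap alpha v) (dx1 th) = 0.
  rewrite dth (fracLap_XN _ hv) thE; apply: dispersion_cancel => //.
  by move=> k; exact: wiener_fourier wl1.
have e5 : 2^-1 * ip (fun x => v x ^+ 2) (dx1 th) =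
    - ip (fun x => w x * w1 x) th + 2^-1 * ip w1 (fun x => th x * th x).
  have := transport_cancel N (fourier u) c; rewrite -dth -thE -/w -/w1 /= => <-.
  by congr (_ * ip _ _); apply/funext => x; rewrite /th; congr (_ ^+ 2); ring.
have e6 : ip tht th = - (ip (fun x => u x * f1 x) th - ip (fun x => w x * w1 x) th)
    - 2^-1 * ip w1 (fun x => th x * th x).
  move: e3; rewrite e1 e2 e5; move: e4; clear; lra.
rewrite -ipBl// in e6; [|exact: bmM|exact: bmM].
set rho := fun x => u x - w x in hdelta; set rho1 := fun x => f1 x - w1 x in hdelta.
have brho : bm rho by exact: bmB.
have brho1 : bm rho1 by exact: bmB.
have uA x : `|u x| <= A by exact: wiener_bound wu.
have w1A x : `|w1 x| <= A.
  by apply: le_trans (normr_rtp _ _ _) _; case: wu1 => _ h _; exact: h.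
have key : 2 * ip tht th <= I (fun x => A * (3 * (th x * th x)) + A * (rho x * rho x + rho1 x * rho1 x)).
  rewrite e6 /ip -!IN -?IZ -?ID -?IB -?IZ; try by do ?[apply: bmB|apply: bmD|apply: bmN|apply: bmX|apply: bmZ|apply: bmM].
  apply: le_I; try by do ?[apply: bmB|apply: bmD|apply: bmN|apply: bmX|apply: bmZ|apply: bmM].
  move=> x _.
  (* The split leaves [u] and [w1], both bounded by [A], in front of the truncation errors. Together
     with w1 th^2 there are three products for the Young inequality [P], each contributing A th^2:
     hence the coefficient 3 A. *)
  have -> : u x * f1 x - w x * w1 x = u x * rho1 x + w1 x * rho x by rewrite /rho /rho1; ring.
  have hu1 := uA x; have hw := w1A x.
  have P (p q z : R) : `|p| <= A -> - (2 * (p * q * z)) <= A * (q * q + z * z).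
    move=> hp; apply: le_trans (ler_norm _) _.
    rewrite normrN !normrM (@normr_nat R 2).
    have -> : q * q + z * z = `|q| * `|q| + `|z| * `|z| by rewrite -!normrM !ger0_norm -?expr2 ?sqr_ge0.
    have nn := mulr_ge0 (normr_ge0 q) (normr_ge0 z).
    apply: le_trans (_ : A * (2 * (`|q| * `|z|)) <= _).
      have -> : 2 * (`|p| * `|q| * `|z|) = `|p| * (2 * (`|q| * `|z|)) by ring.
      by rewrite ler_wpM2r// mulr_ge0.
    rewrite ler_wpM2l//; have := sqr_ge0 (`|q| - `|z|); rewrite sqrrB !expr2.
    by move: (`|q|) (`|z|); clear => y1 y2; lra.
  have p1 := P (u x) (rho1 x) (th x) hu1.
  have p2 := P (w1 x) (rho x) (th x) hw.
  have p3 := P (w1 x) (th x) (th x) hw.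
  move: p1 p2 p3; set A1 := A * _; set A2 := A * _; set A3 := A * _.
  have -> : A * (3 * (th x * th x)) + A * (rho x * rho x + rho1 x * rho1 x) = A1 + A2 + 2^-1 * A3.
    by rewrite /A1 /A2 /A3; field.
  clear; lra.
apply: (le_trans key).
rewrite ID; last 2 first.
- by apply: bmZ; apply: bmZ; exact: bmM.
- by apply: bmZ; apply: bmD; exact: bmM.
rewrite !IZ ?ID//; try exact: bmM; last 2 first.
- by apply: bmD; exact: bmM.
- by apply: bmZ; exact: bmM.
rewrite mulrA (mulrC A 3); apply: lerD; first by [].
by apply: ler_wpM2l.
Qed.

End Galerkin.

(** * Optimal truncation rate of the exact solution *)

Section Bootstrap.
Context {R : realType}.
Implicit Types (f g u ut : R * R -> R) (A alpha r M : R).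
Implicit Types (k : int * int) (x : R * R) (a b : int * int -> R[i]).

(** For n >= 2 one has n <= 3 floor(n/2), with equality at n = 3. *)
Lemma powR_half_le (q : R) n : 0 <= q -> (2 <= n)%N ->
  n%:R `^ q <= 3 `^ q * (n./2)%:R `^ q.
Proof.
move=> q0 n2; rewrite -powRM//; apply: ge0_ler_powR; rewrite ?nnegrE//.
by rewrite -natrM ler_nat; lia.
Qed.

Lemma powR_nat_ge (q X : R) : 0 < q -> exists2 n0 : nat, (2 <= n0)%N &
  forall n : nat, (n0 <= n)%N -> X <= n%:R `^ q.
Proof.
move=> q0; pose Y := (`|X| + 1) `^ q^-1.
have Y0 : 0 <= Y by exact: powR_ge0.
exists (maxn 2 (Num.bound Y)); first by rewrite leq_maxl.
move=> n; rewrite geq_max => /andP[_ hn].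
have hY : Y <= n%:R.
  apply: ltW; apply: lt_le_trans (archi_boundP Y0) _; by rewrite ler_nat.
apply: le_trans (_ : Y `^ q <= _); last by apply: ge0_ler_powR; rewrite ?nnegrE// ltW.
rewrite /Y -powRrM mulVf ?gt_eqF// powRr1 ?addr_ge0//.
by apply: le_trans (ler_norm X) _; rewrite lerDl.
Qed.

(** From [n0] on, n^p is at least 1 and at least 2 c2 3^q, so the right-hand side is at most C/2 +
    n^p C/2 <= n^p C and the bound [C] passes from n/2 to n. Below [n0] the trivial bound [D] is
    used. *)
Lemma bootstrap_seq (p q D c1 c2 : R) : 0 < p -> 0 <= q -> 0 <= D -> 0 <= c1 -> 0 <= c2 ->
  exists2 C, 0 <= C & forall d : nat -> R, (forall n, 0 <= d n <= D) ->
    (forall n, (2 <= n)%N -> n%:R `^ p * (n%:R `^ q * d n) <= c1 + c2 * (n%:R `^ q * d n./2)) ->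
    forall n, (1 <= n)%N -> n%:R `^ q * d n <= C.
Proof.
move=> p0 q0 D0 c10 c20.
have [n0 n02 hn0] := powR_nat_ge (Num.max 1 (2 * c2 * 3 `^ q)) p0.
pose C := n0%:R `^ q * D + 2 * c1.
have n0q : 0 <= n0%:R `^ q * D by rewrite mulr_ge0 ?powR_ge0.
exists C; first by rewrite addr_ge0// mulr_ge0.
move=> d hd hrec; elim/ltn_ind => n IH n1.
have /andP[dn0 dnD] := hd n.
have [nn0|n0n] := ltnP n n0.
  apply: le_trans (_ : n0%:R `^ q * D <= _); last by rewrite lerDl mulr_ge0.
  apply: ler_pM => //.
  by apply: ge0_ler_powR; rewrite ?nnegrE// ler_nat ltnW.
have n2 : (2 <= n)%N by exact: leq_trans n02 n0n.
have := hn0 n n0n; rewrite ge_max => /andP[h1 h2].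
set e := n%:R `^ q * d n; have e0 : 0 <= e by rewrite mulr_ge0 ?powR_ge0.
set y := n%:R `^ p in h1 h2.
have hC : (n./2)%:R `^ q * d n./2 <= C by apply: IH; clear -n2; lia.
have /andP[dh0 _] := hd n./2.
have hh : n%:R `^ q * d n./2 <= 3 `^ q * C.
  apply: le_trans (_ : (3 `^ q * (n./2)%:R `^ q) * d n./2 <= _).
    by rewrite ler_wpM2r// powR_half_le.
  by rewrite -mulrA ler_wpM2l// powR_ge0.
have rec : y * e <= c1 + c2 * (3 `^ q * C).
  by apply: (le_trans (hrec n n2)); rewrite lerD2l ler_wpM2l.
have C0 : 0 <= C by rewrite addr_ge0// mulr_ge0.
have C1 : 2 * c1 <= C by rewrite /C lerDr.
rewrite leNgt; apply/negP => eC.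
have : y * C < y * e by rewrite ltr_pM2l//; lra.
have : 2 * c2 * 3 `^ q * C <= y * C by rewrite ler_wpM2r.
have : 1 * C <= y * C by rewrite ler_wpM2r.
have -> : 2 * c2 * 3 `^ q * C = 2 * (c2 * 3 `^ q * C) by ring.
rewrite mulrA in rec; move: rec C1.
move: (y * C) (y * e) (c2 * 3 `^ q * C); clear => v1 v2 v3; lra.
Qed.

(** Frequencies of a product add, so two factors with modes in the box of size n have a product with
    modes in the box of size 2n. *)
Lemma fourier_rtpM_eq0 n N a b k : herm a -> herm b -> (n.*2 <= N)%N ->
  k \notin boxseq N ->
  fourier (fun x => rtp n a x * rtp n b x) k = 0 :> R[i].
Proof.
move=> ha hb nN kN; rewrite fourierE.
have -> : cintegral (fun x : R * R => (rtp n a x * rtp n b x)%:C * cis (dotk (- k) x)) =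
  cintegral (fun x => \sum_(l <- boxseq n) a l * (tp n b x * cis (dotk (- (k - l)) x))).
  congr cintegral; apply/funext => x; rewrite rmorphM /= !rtpE// /tp mulr_suml mulr_suml.
  apply: eq_bigr => l _; rewrite opprB dotkD cisD dotkN.
  by rewrite -!mulrA; congr (_ * _); rewrite mulrCA.
rewrite cI_sum; last first.
  move=> l; apply: bmcM; first exact: bmc_cst.
  by apply: bmcM; [exact: bmc_tp|exact: bmc_cis].
rewrite big1_seq ?mulr0// => l /andP[_ ln].
rewrite cIZ; last by apply: bmcM; [exact: bmc_tp|exact: bmc_cis].
rewrite cI_tp_cis; case: ifPn; rewrite ?mulr0// => kl; exfalso.
move: kN ln kl; rewrite !mem_boxseq /= => /negP h /andP[l1 l2] /andP[k1 k2].
apply: h; apply/andP; split.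
  have := ler_normD (k.1 - l.1) l.1; rewrite addrNK; lia.
have := ler_normD (k.2 - l.2) l.2; rewrite addrNK; lia.
Qed.

Lemma bracket_tail r n k : 0 <= r -> k \notin boxseq n ->
  n%:R `^ (2 * r) <= bracket k `^ r :> R.
Proof.
move=> r0 kn; rewrite powRrM powR_mulrn//; apply: ge0_ler_powR => //.
- by rewrite nnegrE sqr_ge0.
- by rewrite nnegrE ltW// bracket_gt0.
have := @notin_boxseq R n k kn => h.
apply: le_trans (_ : sqnormk k <= _); last by rewrite /bracket lerDr.
rewrite -(sqr_sqrtr (sqnormk_ge0 k)) lerXn2r ?nnegrE// sqrtr_ge0//.
Qed.

Lemma Hper_tail r f M n (s : seq (int * int)) : 0 <= r -> (Hnorm2 r f < +oo)%E ->
  Hnorm r f <= M -> uniq s -> (1 <= n)%N ->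
  n%:R `^ (2 * r) * \sum_(k <- s | k \notin boxseq n) modc (fourier f k) ^+ 2 <= M ^+ 2.
Proof.
move=> r0 Hf hM us n1.
have M0 : 0 <= Hnorm r f by exact: sqrtr_ge0.
have HM : Hnorm r f ^+ 2 <= M ^+ 2 by rewrite lerXn2r ?nnegrE// (le_trans M0).
apply: le_trans (le_trans (Hper_sum Hf us) HM).
rewrite mulr_sumr big_mkcond; apply: ler_sum => k _; case: ifPn => kn.
  by rewrite ler_wpM2r ?sqr_ge0// bracket_tail.
by rewrite mulr_ge0 ?powR_ge0 ?sqr_ge0.
Qed.

Lemma wiener_ip_tailM A c f n (X B : R) : wiener A c f -> 0 < X ->
  (forall N, (n <= N)%N ->
     X * \sum_(k <- boxseq N | k \notin boxseq n) modc (c k) ^+ 2 <= B) ->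
  X * ip (fun x => f x - rtp n c x) (fun x => f x - rtp n c x) <= cell * B.
Proof.
move=> wf X0 h; rewrite mulrC -ler_pdivlMr// -mulrA.
apply: (wiener_ip_tail wf) => N nN.
by rewrite ler_pdivlMr// mulrC h.
Qed.

Lemma regular_step A alpha r M u ut f1 g g1 : 0 < alpha -> 0 <= r -> 0 <= A ->
  regular A alpha u f1 g g1 -> bm ut ->
  (Hnorm2 r u < +oo)%E -> (Hnorm2 r ut < +oo)%E -> Hnorm r u <= M -> Hnorm r ut <= M ->
  (forall x, Omega x -> ut x - g1 x + u x * f1 x = 0) ->
  let d n := ip (fun x => f1 x - rtp n (dc (fourier u)) x)
                (fun x => f1 x - rtp n (dc (fourier u)) x) in
  forall n, (2 <= n)%N -> n%:R `^ (2 * alpha) * (n%:R `^ (2 * r) * d n) <=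
    cell * (2 * M ^+ 2 + 4 * A ^+ 2 * M ^+ 2 * 3 `^ (2 * r)) +
    4 * A ^+ 2 * (n%:R `^ (2 * r) * d n./2).
Proof.
move=> a0 r0 A0 [bu wu wu1 wl wl1] but Hu Hut Mu Mut pde d n n2.
have bf1 := wiener_bm wu1; have bg1 := wiener_bm wl1.
have hu := herm_fourier bu; have hdu := herm_dc hu.
have n0 : 0 < n%:R :> R by rewrite ltr0n; clear -n2; lia.
pose m := n./2; have m1 : (1 <= m)%N by rewrite /m; clear -n2; lia.
pose w := rtp m (fourier u); pose w1 := rtp m (dc (fourier u)).
have bw : bm w by exact: bm_rtp.
have bw1 : bm w1 by exact: bm_rtp.
pose rho x := u x - w x; pose rho1 x := f1 x - w1 x.
have brho : bm rho by exact: bmB.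
have brho1 : bm rho1 by exact: bmB.
(* The nonlinearity is u f1 = w w1 + G, with truncations at n/2; since w w1 has no mode outside the
   box of size n, the high modes see only [G]. *)
pose G x := u x * rho1 x + w1 x * rho x.
have bG : bm G by apply: bmD; exact: bmM.
have bww : bm (fun x => w x * w1 x) by exact: bmM.
have uA x : `|u x| <= A by exact: wiener_bound wu.
have w1A x : `|w1 x| <= A.
  by apply: le_trans (normr_rtp _ _ _) _; case: wu1 => _ h _; exact: h.
have qrho : m%:R `^ (2 * r) * ip rho rho <= cell * M ^+ 2.
  apply: (wiener_ip_tailM wu); first by rewrite powR_gt0// ltr0n.
  by move=> N mN; apply: Hper_tail => //; exact: uniq_boxseq.
have qG : ip G G <= 2 * A ^+ 2 * d m + 2 * A ^+ 2 * ip rho rho.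
  apply: le_trans (ip_sqrD (bmM bu brho1) (bmM bw1 brho)) _.
  have i1 := ip_mul_le bu brho1 (fun x _ => uA x).
  have i2 := ip_mul_le bw1 brho (fun x _ => w1A x).
  have -> : 2 * A ^+ 2 * d m = 2 * (A ^+ 2 * ip rho1 rho1) by rewrite mulrA.
  have -> : 2 * A ^+ 2 * ip rho rho = 2 * (A ^+ 2 * ip rho rho) by rewrite mulrA.
  by apply: lerD; apply: ler_wpM2l.
have coef k : k \notin boxseq n -> fourier g1 k = fourier ut k + fourier G k.
  move=> kn; have -> : fourier g1 k = fourier (fun x => ut x + (w x * w1 x + G x)) k.
    rewrite !fourierE; congr (_ * _).
    have E x : Omega x -> g1 x = ut x + (w x * w1 x + G x).
      have -> : ut x + (w x * w1 x + G x) = ut x + u x * f1 x by rewrite /G /rho /rho1; ring.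
      by move=> /pde; clear; lra.
    by apply: complexP; apply: eq_I => x /E ->.
  rewrite fourierD//; last exact: bmD.
  rewrite fourierD// (@fourier_rtpM_eq0 m n)// ?add0r//.
  by rewrite /m; clear; lia.
set NA := n%:R `^ (2 * alpha); set NR := n%:R `^ (2 * r).
have NA0 : 0 < NA by rewrite powR_gt0.
have NR0 : 0 < NR by rewrite powR_gt0.
rewrite mulrA; have -> : cell * (2 * M ^+ 2 + 4 * A ^+ 2 * M ^+ 2 * 3 `^ (2 * r)) +
    4 * A ^+ 2 * (NR * d m) =
    cell * (2 * M ^+ 2 + cell^-1 * (4 * A ^+ 2 * (3 `^ (2 * r) * (cell * M ^+ 2) + NR * d m))).
  by field; rewrite gt_eqF// cell_gt0.
apply: (wiener_ip_tailM wu1); first by rewrite mulr_gt0.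
move=> N nN.
set SS := \sum_(k <- boxseq N | k \notin boxseq n) modc (dc (fourier u) k) ^+ 2.
(* Outside the box |k|^alpha >= n^alpha: the dispersive multiplier supplies the gain. *)
have s1 : NA * SS <= \sum_(k <- boxseq N | k \notin boxseq n) modc (fourier g1 k) ^+ 2.
  rewrite /SS mulr_sumr; apply: ler_sum => k kn.
  rewrite (wiener_fourier k wl1) !modc_dc modc_fracc.
  set z := Num.sqrt (sqnormk k) `^ alpha.
  have -> : (`|k.1%:~R| * (z * modc (fourier u k))) ^+ 2 =
    z ^+ 2 * (`|k.1%:~R| * modc (fourier u k)) ^+ 2 by ring.
  rewrite ler_wpM2r ?sqr_ge0// /NA mulrC powRrM powR_mulrn ?powR_ge0//.
  rewrite lerXn2r ?nnegrE ?powR_ge0//; apply: ge0_ler_powR; rewrite ?nnegrE ?sqrtr_ge0//.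
    exact: ltW.
  exact: notin_boxseq.
have s2 : \sum_(k <- boxseq N | k \notin boxseq n) modc (fourier g1 k) ^+ 2 <=
   2 * \sum_(k <- boxseq N | k \notin boxseq n) modc (fourier ut k) ^+ 2 +
   2 * \sum_(k <- boxseq N | k \notin boxseq n) modc (fourier G k) ^+ 2.
  rewrite !mulr_sumr -big_split; apply: ler_sum => k kn /=.
  by rewrite coef//; exact: modc_sqrD.
have s3 : NR * \sum_(k <- boxseq N | k \notin boxseq n) modc (fourier ut k) ^+ 2 <= M ^+ 2.
  by apply: Hper_tail => //; [exact: uniq_boxseq|exact: ltnW].
have s4 : \sum_(k <- boxseq N | k \notin boxseq n) modc (fourier G k) ^+ 2 <= cell^-1 * ip G G.
  by rewrite -big_filter; apply: bessel => //; rewrite filter_uniq// uniq_boxseq.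
have s5 : NR * ip rho rho <= 3 `^ (2 * r) * (cell * M ^+ 2).
  apply: le_trans (_ : (3 `^ (2 * r) * m%:R `^ (2 * r)) * ip rho rho <= _).
    by rewrite ler_wpM2r ?ip_ge0// powR_half_le// mulr_ge0.
  by rewrite -mulrA ler_wpM2l// powR_ge0.
have -> : NA * NR * SS = NR * (NA * SS) by ring.
apply: le_trans (ler_wpM2l (ltW NR0) (le_trans s1 s2)) _.
(* The factor 4 A^2 is 2 from separating [ut] and [G], times 2 A^2 from separating the two terms of
   [G]. *)
rewrite mulrDr mulrCA; apply: lerD; first by rewrite ler_wpM2l.
have A20 : 0 <= A ^+ 2 by rewrite sqr_ge0.
have c0 : 0 < (cell : R)^-1 by rewrite invr_gt0 cell_gt0.
rewrite mulrCA; apply: le_trans (_ : 2 * (NR * (cell^-1 * ip G G)) <= _).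
  by rewrite ler_wpM2l// ler_wpM2l// ltW.
have -> : 2 * (NR * (cell^-1 * ip G G)) = cell^-1 * (2 * (NR * ip G G)) by ring.
rewrite ler_wpM2l ?(ltW c0)//.
have := ler_wpM2l (ltW NR0) qG => h.
apply: le_trans (_ : 2 * (NR * (2 * A ^+ 2 * d m + 2 * A ^+ 2 * ip rho rho)) <= _).
  by rewrite ler_wpM2l.
have -> : 2 * (NR * (2 * A ^+ 2 * d m + 2 * A ^+ 2 * ip rho rho)) =
  4 * A ^+ 2 * (NR * ip rho rho + NR * d m) by ring.
by rewrite ler_wpM2l ?mulr_ge0// lerD2r.
Qed.

Lemma regular_rate A alpha r M : 0 < alpha -> 0 <= r -> 0 <= A -> 0 <= M ->
  exists2 C, 0 <= C & forall u ut f1 g g1, regular A alpha u f1 g g1 -> bm ut ->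
  (Hnorm2 r u < +oo)%E -> (Hnorm2 r ut < +oo)%E -> Hnorm r u <= M -> Hnorm r ut <= M ->
  (forall x, Omega x -> ut x - g1 x + u x * f1 x = 0) ->
  forall n, (1 <= n)%N -> n%:R `^ (2 * r) *
    (ip (fun x => u x - rtp n (fourier u) x) (fun x => u x - rtp n (fourier u) x) +
     ip (fun x => f1 x - rtp n (dc (fourier u)) x)
                (fun x => f1 x - rtp n (dc (fourier u)) x)) <= C.
Proof.
move=> a0 r0 A0 M0.
have c0 := @cell_gt0 R.
(* The trivial bound for the bootstrap: [f1] and its truncations are each at most [A] in modulus. *)
have D0 : 0 <= (2 * A) ^+ 2 * (cell : R) by rewrite mulr_ge0 ?sqr_ge0 ?ltW.
have c10 : 0 <= (cell : R) * (2 * M ^+ 2 + 4 * A ^+ 2 * M ^+ 2 * 3 `^ (2 * r)).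
  rewrite mulr_ge0 ?(ltW c0)//; apply: addr_ge0; first by rewrite mulr_ge0 ?sqr_ge0.
  by rewrite !mulr_ge0 ?sqr_ge0 ?powR_ge0.
have c20 : 0 <= 4 * A ^+ 2 by rewrite mulr_ge0 ?sqr_ge0.
have p0 : 0 < 2 * alpha by rewrite mulr_gt0.
have q0 : 0 <= 2 * r by rewrite mulr_ge0.
have [C C0 HC] := bootstrap_seq p0 q0 D0 c10 c20.
exists (cell * M ^+ 2 + C).
  by rewrite addr_ge0// mulr_ge0 ?sqr_ge0// ltW.
move=> u ut f1 g g1 reg but Hu Hut Mu Mut pde n n1.
rewrite mulrDr; apply: lerD.
  have [_ wu _ _ _] := reg.
  apply: (wiener_ip_tailM wu); first by rewrite powR_gt0// ltr0n.
  by move=> N nN; apply: Hper_tail => //; exact: uniq_boxseq.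
apply: (HC (fun n => ip (fun x => f1 x - rtp n (dc (fourier u)) x)
                (fun x => f1 x - rtp n (dc (fourier u)) x))) => //.
  move=> m; rewrite ip_ge0 /=; have [_ _ wu1 _ _] := reg.
  have bf1 := wiener_bm wu1.
  have bb : bm (fun x => f1 x - rtp m (dc (fourier u)) x) by apply: bmB => //; exact: bm_rtp.
  rewrite /ip -I_cst; apply: le_I; first exact: bmM; first exact: bm_cst.
  move=> x _; rewrite -expr2 -real_normK ?num_real// lerXn2r ?nnegrE ?mulr_ge0//.
  apply: le_trans (ler_normB _ _) _; rewrite mulrDl mul1r; apply: lerD.
    exact: wiener_bound wu1.
  by apply: le_trans (normr_rtp _ _ _) _; case: wu1 => _ h _; exact: h.
exact: (regular_step a0 r0 A0 reg but Hu Hut Mu Mut pde).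
Qed.

End Bootstrap.

(** * Gronwall estimate in time *)

Section TimeEstimates.
Context {R : realType}.
Implicit Types (f g : R * R -> R) (A alpha r T : R) (u ut uN : R -> R * R -> R).
Implicit Types (k : int * int) (x : R * R).

(** Compactness is applied with the natural numbers as candidate bounds: near each point all large
    ones work, hence one works everywhere. *)
Lemma locally_bounded_segment T (F : R -> R) :
  (forall t, 0 <= t <= T -> exists d B : R, 0 < d /\
     forall s, 0 <= s <= T -> `|s - t| < d -> F s <= B) ->
  exists B : R, forall s, 0 <= s <= T -> F s <= B.
Proof.
move=> h.
have /compact_near_coveringP cov := @segment_compact R 0 T.
have H : forall t, `[0, T]%classic t ->
    \forall s \near t & n \near \oo, 0 <= s <= T -> F s <= n%:R.
  move=> t; rewrite /= in_itv /= => /h [d [B [d0 HB]]].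
  exists (ball t d, [set n : nat | (Num.bound `|B| <= n)%N]).
    split => /=; first exact: nbhsx_ballx.
    by exists (Num.bound `|B|).
  move=> [s n] [/= hs hn] sT; rewrite /ball /= distrC in hs.
  apply: le_trans (HB s sT hs) _; apply: le_trans (ler_norm B) _.
  apply: ltW; apply: lt_le_trans (archi_boundP (normr_ge0 B)) _.
  by rewrite ler_nat.
have [n _ Hn] := cov nat \oo (fun n s => 0 <= s <= T -> F s <= n%:R) _ H.
exists n%:R => s sT.
by apply: (Hn n (leqnn n) s) => //=; rewrite in_itv.
Qed.

Lemma Hnorm_ge0 r f : 0 <= Hnorm r f.
Proof. exact: sqrtr_ge0. Qed.

Lemma bm_C1 r T u ut t : C1_Hper r T u ut -> 0 <= t <= T -> bm (u t) /\ bm (ut t).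
Proof.
by move=> [h _] /h [[l1 _] c1 [l2 _] c2]; split; apply: continuous_bm.
Qed.

Lemma quotient_lin (a : R) f g (h : R * R -> R) :
  (fun x => a * (f x - g x) - h x) =
  (fun x => a * f x + 1 * (- a * g x + (- 1) * h x)).
Proof. by apply/funext => x; ring. Qed.

Lemma Hnorm2_quotient r (a : R) f g (h : R * R -> R) : bm f -> bm g -> bm h ->
  (Hnorm2 r f < +oo)%E -> (Hnorm2 r g < +oo)%E -> (Hnorm2 r h < +oo)%E ->
  (Hnorm2 r (fun x => (a * (f x - g x) - h x)%R) < +oo)%E.
Proof.
move=> bf bg bh hf hg hh; rewrite quotient_lin.
apply: (proj1 (Hper_lin _ _ hf _ bf _)).
  exact: (proj1 (Hper_lin _ _ hg hh bg bh)).
by apply: bmD; exact: bmZ.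
Qed.

(** The [sup] of an unbounded set is a default value, so [C1_norm] dominates the norms only once
    boundedness is known. Near t, write u(s) = u(t) + (s - t) (ut(t) + D) with D of norm at most
    1. *)
Lemma C1_Hper_bounded r T u ut : C1_Hper r T u ut ->
  exists B : R, forall s, 0 <= s <= T -> Hnorm r (u s) <= B /\ Hnorm r (ut s) <= B.
Proof.
move=> hC; have [hH hd] := hC.
have sq_le (y B : R) : 0 <= y -> y ^+ 2 <= B -> y <= 1 + B.
  by move=> y0 yB; have := sqr_ge0 (y - 2^-1); rewrite sqrrB => h; clear -yB h y0; nra.
have [B1 H1] : exists B : R, forall s, 0 <= s <= T -> Hnorm r (u s) <= B.
  apply: locally_bounded_segment => t tT.
  have [d d0 H] := is_C1_eps hd tT ltr01.
  have [bu but] := bm_C1 hC tT.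
  have [[_ hu] _ [_ hut] _] := hH t tT.
  pose B := 2 * Hnorm r (u t) ^+ 2 + 2 * d ^+ 2 * (2 * Hnorm r (ut t) ^+ 2 + 2).
  have Bge : 0 <= 2 * d ^+ 2 * (2 * Hnorm r (ut t) ^+ 2 + 2).
    apply: mulr_ge0; first by rewrite mulr_ge0 ?sqr_ge0.
    by rewrite addr_ge0// mulr_ge0 ?sqr_ge0.
  exists d, (1 + B); split => // s sT sd.
  have [bus _] := bm_C1 hC sT.
  have [[_ hus] _ _ _] := hH s sT.
  apply: sq_le; first exact: Hnorm_ge0.
  have [->|st] := eqVneq s t.
    have := sqr_ge0 (Hnorm r (u t)) => h; apply: le_trans (_ : 2 * Hnorm r (u t) ^+ 2 <= _).
      by clear -h; lra.
    by rewrite /B lerDl.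
  have st0 : s - t != 0 by rewrite subr_eq0.
  set D := fun x => (s - t)^-1 * (u s x - u t x) - ut t x.
  have bD : bm D by apply: bmB => //; apply: bmZ; exact: bmB.
  have HD := H s sT st sd; rewrite -/D in HD.
  have hD : (Hnorm2 r D < +oo)%E by exact: Hnorm2_quotient.
  have -> : u s = fun x => 1 * u t x + (s - t) * (1 * ut t x + 1 * D x).
    by apply/funext => x; rewrite /D; field.
  have [l1 l2] := Hper_lin 1 1 hut hD but bD.
  have bl : bm (fun x => 1 * ut t x + 1 * D x) by apply: bmD; exact: bmZ.
  have [_ l3] := Hper_lin 1 (s - t) hu l1 bu bl.
  apply: (le_trans l3); rewrite expr1n mulr1 /B lerD2l.
  apply: ler_pM.
  - by apply: mulr_ge0 => //; exact: sqr_ge0.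
  - exact: sqr_ge0.
  - rewrite ler_wpM2l// -real_normK ?num_real// lerXn2r ?nnegrE ?(ltW d0)//.
    exact: ltW.
  apply: (le_trans l2); rewrite expr1n mulr1 lerD2l -[X in _ <= X]mulr1 ler_wpM2l//.
  by rewrite expr_le1// Hnorm_ge0.
have [B2 H2] : exists B : R, forall s, 0 <= s <= T -> Hnorm r (ut s) <= B.
  apply: locally_bounded_segment => t tT.
  have [_] := hd t tT => /cvgrPdist_le/(_ 1 ltr01).
  rewrite near_withinE => /nbhs_ballP[d /= d0 H].
  have [bu but] := bm_C1 hC tT.
  have [_ _ [_ hut] _] := hH t tT.
  pose B := 2 * Hnorm r (ut t) ^+ 2 + 2.
  exists d, (1 + B); split => // s sT sd.
  have [_ bus] := bm_C1 hC sT.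
  have [_ _ [_ hus] _] := hH s sT.
  apply: sq_le; first exact: Hnorm_ge0.
  have := H s; rewrite /ball /= distrC => /(_ sd).
  rewrite in_itv /= sT => /(_ isT).
  rewrite sub0r normrN ger0_norm ?Hnorm_ge0//.
  set D := fun x => ut s x - ut t x => HD.
  have bD : bm D by exact: bmB.
  have hD : (Hnorm2 r D < +oo)%E.
    have -> : D = fun x => 1 * ut s x + (- 1) * ut t x by apply/funext => x; rewrite /D; ring.
    exact: (proj1 (Hper_lin _ _ hus hut bus but)).
  have -> : ut s = fun x => 1 * ut t x + 1 * D x by apply/funext => x; rewrite /D; ring.
  have [_ l2] := Hper_lin 1 1 hut hD but bD.
  apply: (le_trans l2); rewrite expr1n !mulr1 lerD2l -[X in _ <= X]mulr1 ler_wpM2l//.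
  by rewrite expr_le1// Hnorm_ge0.
exists (Num.max B1 B2) => s sT; split; rewrite le_max.
  by rewrite (H1 s sT).
by rewrite (H2 s sT) orbT.
Qed.

Lemma C1_norm_ge r T u ut s : C1_Hper r T u ut -> 0 <= s <= T ->
  Hnorm r (u s) <= C1_norm r T u ut /\ Hnorm r (ut s) <= C1_norm r T u ut.
Proof.
move=> hC sT; have [B HB] := C1_Hper_bounded hC.
have h1 : Hnorm r (u s) <= sup [set Hnorm r (u t) | t in `[0, T]].
  apply: ub_le_sup; last by exists s; rewrite //= in_itv.
  exists B => _ [t tT <-]; move: tT; rewrite /= in_itv /= => tT.
  exact: (proj1 (HB t tT)).
have h2 : Hnorm r (ut s) <= sup [set Hnorm r (ut t) | t in `[0, T]].
  apply: ub_le_sup; last by exists s; rewrite //= in_itv.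
  exists B => _ [t tT <-]; move: tT; rewrite /= in_itv /= => tT.
  exact: (proj2 (HB t tT)).
have n1 := Hnorm_ge0 r (u s); have n2 := Hnorm_ge0 r (ut s).
rewrite /C1_norm; split; [apply: (le_trans h1)|apply: (le_trans h2)].
  by rewrite lerDl (le_trans n2 h2).
by rewrite lerDr (le_trans n1 h1).
Qed.

Lemma rtp_fourier_lin N (a b : R) f g x : bm f -> bm g ->
  rtp N (fourier (fun x => a * f x + b * g x)) x =
  a * rtp N (fourier f) x + b * rtp N (fourier g) x.
Proof.
move=> bf bg; rewrite /rtp /tp !cRe_sum !mulr_sumr.
transitivity (\sum_(k <- boxseq N) (a * complex.Re (fourier f k * cis (dotk k x)) +
   b * complex.Re (fourier g k * cis (dotk k x)))); last by rewrite big_split.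
apply: eq_bigr => k _; rewrite fourierD ?fourierZ//; try exact: bmZ.
move: (fourier f k) (fourier g k) (cis _) => p q c.
rewrite mulrDl cReD -!mulrA !(cReM _%:C).
have r1 (d : R) : complex.Re d%:C = d by [].
have r2 (d : R) : complex.Im d%:C = 0 by [].
by rewrite !r1 !r2 !mul0r !subr0.
Qed.

Lemma ip_proj_Hnorm N r f : 0 <= r -> bm f -> (Hnorm2 r f < +oo)%E ->
  ip (rtp N (fourier f)) (rtp N (fourier f)) <= cell * Hnorm r f ^+ 2.
Proof.
move=> r0 bf hf; rewrite ip_rtp; last exact: herm_fourier.
rewrite ler_pM2l ?cell_gt0//; apply: le_trans (Hper_sum hf (uniq_boxseq N)).
apply: ler_sum => k _; rewrite -[X in X <= _]mul1r ler_wpM2r ?sqr_ge0//.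
by rewrite -(powRr0 (bracket k)) ler_powR// bracket_ge1.
Qed.

Lemma projB N f (v : R * R -> R) : bm f -> XN N v ->
  (fun x => rtp N (fourier f) x - v x) = rtp N (fun k => fourier f k - fourier v k).
Proof.
move=> bf hv; apply/funext => x; rewrite {1}(XN_rtpE hv) /rtp -cReN -cReD.
congr complex.Re; rewrite /tp -sumrB; apply: eq_bigr => k _; by rewrite mulrBl.
Qed.

Lemma XN_projB N f (v : R * R -> R) : bm f -> XN N v ->
  XN N (fun x => rtp N (fourier f) x - v x).
Proof.
move=> bf hv; rewrite projB//; apply: XN_rtp => k.
by rewrite (herm_fourier bf) (herm_fourier (XN_bm hv)) rmorphB.
Qed.

(** Truncation is linear and, for r >= 0, bounded from H^r to L2; the quotient error is therefore
    the truncation of that of [u] minus that of [uN]. *)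
Lemma projection_diff_q r T N u ut uN uNt : 0 <= r -> C1_Hper r T u ut ->
  (forall t, 0 <= t <= T -> XN N (uN t)) -> (forall t, 0 <= t <= T -> XN N (uNt t)) ->
  is_C1 L2norm T uN uNt ->
  diff_q T (fun t x => rtp N (fourier (u t)) x - uN t x)
           (fun t x => rtp N (fourier (ut t)) x - uNt t x).
Proof.
move=> r0 hC hX hXt hd t tT e e0; have [hH hdH] := hC.
have c0 := @cell_gt0 R.
(* The squared quotient errors are at most e', as e' <= 1; together they cost 2 cell e' + 2 e' <=
   e. *)
pose e' := Num.min 1 (e / (2 * cell + 2)).
have D0 : 0 < 2 * cell + 2 :> R by rewrite addr_gt0// mulr_gt0.
have e'0 : 0 < e' by rewrite lt_min ltr01 divr_gt0.
have e'1 : e' <= 1 by rewrite ge_min lexx.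
have e'2 : e' * (2 * cell + 2) <= e by rewrite -ler_pdivlMr// ge_min lexx orbT.
have [d1 d10 H1] := is_C1_eps hdH tT e'0.
have [d2 d20 H2] := is_C1_eps hd tT e'0.
exists (Num.min d1 d2); first by rewrite lt_min d10 d20.
move=> s sT st; rewrite lt_min => /andP[s1 s2].
have [bu but] := bm_C1 hC tT; have [bus _] := bm_C1 hC sT.
have [[_ hu] _ [_ hut] _] := hH t tT; have [[_ hus] _ _ _] := hH s sT.
have bv := XN_bm (hX t tT); have bvt := XN_bm (hXt t tT); have bvs := XN_bm (hX s sT).
set a := (s - t)^-1.
set D := fun x => a * (u s x - u t x) - ut t x.
set E := fun x => a * (uN s x - uN t x) - uNt t x.
have bD : bm D by apply: bmB => //; apply: bmZ; exact: bmB.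
have bE : bm E by apply: bmB => //; apply: bmZ; exact: bmB.
have hD : (Hnorm2 r D < +oo)%E by exact: Hnorm2_quotient.
have sq_le (y : R) : 0 <= y -> y <= e' -> y ^+ 2 <= e'.
  by move=> y0 ye; rewrite expr2 -[X in _ <= X]mulr1 ler_pM// (le_trans ye).
have qD : Hnorm r D ^+ 2 <= e' by apply: sq_le; [exact: Hnorm_ge0|exact: H1].
have qE : ip E E <= e'.
  by rewrite -L2norm_sqr; apply: sq_le; [exact: sqrtr_ge0|exact: H2].
have -> : (fun x => a * (rtp N (fourier (u s)) x - uN s x - (rtp N (fourier (u t)) x - uN t x)) -
    (rtp N (fourier (ut t)) x - uNt t x)) = (fun x => rtp N (fourier D) x - E x).
  apply/funext => x.
  have bl : bm (fun x => - a * u t x + (- 1) * ut t x) by apply: bmD; exact: bmZ.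
  rewrite /D quotient_lin (rtp_fourier_lin N a 1 x bus bl).
  rewrite (rtp_fourier_lin N (- a) (- 1) x bu but) /E.
  move: (rtp _ _ _) (rtp _ _ _) (rtp _ _ _) (uN s x) (uN t x) (uNt t x) => X1 X2 X3 X4 X5 X6.
  by clear; ring.
apply: le_trans (ip_sqrB (bm_rtp _ _) bE) _; apply: le_trans e'2.
have := ip_proj_Hnorm N r0 bD hD => h.
have h2 : cell * Hnorm r D ^+ 2 <= cell * e' by rewrite ler_pM2l.
rewrite mulrDr (mulrC e') -mulrA; clear -h h2 qE; lra.
Qed.

Lemma regularE A alpha f f1 g g1 : regular A alpha f f1 g g1 ->
  [/\ f1 = dx1 f, g = fracLap alpha f & g1 = dx1 (fracLap alpha f)].
Proof.
move=> [_ w0 w1 w2 w3]; have e2 := fracLapE w2.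
split => //; first by apply/funext => x; rewrite (wiener_dx1 x w0 w1).
by apply/funext => x; rewrite e2 (wiener_dx1 x w2 w3).
Qed.

(** A sum of squared norms: the quantity bounded by [delta] in [galerkin_energy]. *)
Definition tail_norm N f : R :=
  ip (fun x => f x - rtp N (fourier f) x) (fun x => f x - rtp N (fourier f) x) +
  ip (fun x => dx1 f x - rtp N (dc (fourier f)) x)
     (fun x => dx1 f x - rtp N (dc (fourier f)) x).

Lemma energy_estimate alpha r T A delta N (u0 : R * R -> R) u ut uN :
  0 <= r -> 0 <= A -> 0 <= delta -> 0 <= T ->
  C1_Hper r T u ut -> is_solution alpha T u0 u ut ->
  (forall t, 0 <= t <= T -> exists f1 g g1, regular A alpha (u t) f1 g g1) ->
  (forall t, 0 < t <= T -> tail_norm N (u t) <= delta) ->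
  semidiscrete alpha T N u0 uN ->
  forall t, 0 <= t <= T ->
    ip (fun x => rtp N (fourier (u t)) x - uN t x)
       (fun x => rtp N (fourier (u t)) x - uN t x) <= A * delta * T * expR (3 * A * T).
Proof.
move=> r0 A0 delta0 T0 hC [pde u00] hreg htail [hX [[uNt [hXt hd gal]] hini]].
pose th t x := rtp N (fourier (u t)) x - uN t x.
pose tht t x := rtp N (fourier (ut t)) x - uNt t x.
have bth t : 0 <= t <= T -> bm (th t) /\ bm (tht t).
  by move=> tT; split; apply: bmB; (try exact: bm_rtp); apply: XN_bm; [exact: hX|exact: hXt].
have dq := projection_diff_q r0 hC hX hXt hd.
have don := diff_q_diff_on bth dq.
apply: (gronwall_bound don).
- by rewrite mulr_ge0.
- by rewrite mulr_ge0.
- move=> t /andP[t0 tT].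
  have tb : 0 <= t <= T by rewrite (ltW t0) ltW.
  have tb' : 0 < t <= T by rewrite t0 ltW.
  have [bu but] := bm_C1 hC tb.
  have [f1 [g [g1 reg]]] := hreg t tb.
  have [E1 E2 E3] := regularE reg.
  apply: (galerkin_energy reg but A0).
  + by move=> x xO; rewrite E3 E1; exact: pde.
  + exact: hX.
  + exact: hXt.
  + by move=> z hz; exact: gal.
  + by rewrite E1; exact: htail.
(* Initially theta vanishes in norm: it lies in X_N, and [uN 0] and the truncation of [u0] have the
   same inner products with X_N. *)
- have tb : 0 <= (0 : R) <= T by rewrite lexx.
  have [bu _] := bm_C1 hC tb.
  have X0 := XN_projB bu (hX 0 tb).
  have bN := XN_bm (hX 0 tb).
  rewrite /= ipBl//; [|exact: bm_rtp|exact: XN_bm X0].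
  rewrite (hini _ X0) /th (projB bu (hX 0 tb)) ip_proj//; last first.
    by move=> k; rewrite (herm_fourier bu) (herm_fourier bN) rmorphB.
  have -> : u 0 = u0 by apply/funext.
  exact: subrr.
Qed.

End TimeEstimates.

(** * Exponential decay of Fourier coefficients of analytic functions *)

Section ContourShift.
Context {R : realType}.
Implicit Types (f g : R * R -> R) (w z : R[i]) (h tau : R).

Lemma modc_i : modc ('i : R[i]) = 1.
Proof. by rewrite modcE /= expr0n expr1n add0r sqrtr1. Qed.

(** A Cauchy estimate for monomials on a disc of radius tau. No factor [m] appears, so the bound can
    be summed against the coefficients of a power series; [ler_power_defect] is its second-order
    analogue. *)
Lemma ler_power_diff w (d : R[i]) h tau m : modc d <= h -> 0 <= h <= tau -> 0 < tau ->
  modc ((w + d) ^+ m - w ^+ m) <= h / tau * (modc w + tau) ^+ m.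
Proof.
move=> dh /andP[h0 ht] t0; elim: m => [|m IH].
  by rewrite !expr0 subrr modc0 mulr1 divr_ge0// ltW.
have -> : (w + d) ^+ m.+1 - w ^+ m.+1 =
  w * ((w + d) ^+ m - w ^+ m) + d * (w + d) ^+ m by rewrite !exprS; ring.
apply: le_trans (ler_modcD _ _) _; rewrite !modcM modcX exprS.
have W0 := modc_ge0 w.
have wd : modc (w + d) <= modc w + tau.
  by apply: le_trans (ler_modcD _ _) _; rewrite lerD2l (le_trans dh).
have h1 : modc w * modc ((w + d) ^+ m - w ^+ m) <= modc w * (h / tau * (modc w + tau) ^+ m).
  by rewrite ler_wpM2l.
have h2 : modc d * modc (w + d) ^+ m <= h * (modc w + tau) ^+ m.
  by rewrite ler_pM// ?modc_ge0 ?exprn_ge0 ?modc_ge0// lerXn2r ?nnegrE ?modc_ge0// addr_ge0// ltW.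
apply: le_trans (lerD h1 h2) _.
move: ((modc w + tau) ^+ m) => X; move: (modc w) => W.
suff -> : h / tau * ((W + tau) * X) = W * (h / tau * X) + h * X by [].
by field; rewrite gt_eqF.
Qed.

Lemma ler_power_defect w h tau m : 0 <= h <= tau -> 0 < tau ->
  modc ((w + 'i * h%:C) ^+ m - w ^+ m - 'i * ((w + h%:C) ^+ m - w ^+ m)) <=
  2 * (h / tau) ^+ 2 * (modc w + tau) ^+ m.
Proof.
move=> hht t0; have /andP[h0 ht] := hht; have W0 := modc_ge0 w.
have mh : modc h%:C = h by rewrite modc_real ger0_norm.
have mih : modc ('i * h%:C) = h by rewrite modcM modc_i mul1r.
elim: m => [|m IH].
  rewrite !expr0 !subrr mulr0 subrr modc0 mulr1.
  by rewrite mulr_ge0// sqr_ge0.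
set P := (w + 'i * h%:C) ^+ m - w ^+ m in IH *.
set Q := (w + h%:C) ^+ m - w ^+ m in IH *.
have -> : (w + 'i * h%:C) ^+ m.+1 - w ^+ m.+1 - 'i * ((w + h%:C) ^+ m.+1 - w ^+ m.+1) =
  w * (P - 'i * Q) + 'i * h%:C * (P - Q) by rewrite /P /Q !exprS; ring.
have hP : modc P <= h / tau * (modc w + tau) ^+ m by apply: ler_power_diff; rewrite ?mih.
have hQ : modc Q <= h / tau * (modc w + tau) ^+ m by apply: ler_power_diff; rewrite ?mh.
apply: le_trans (ler_modcD _ _) _; rewrite (modcM w) (modcM ('i * _)) mih [(_ + tau) ^+ m.+1]exprS.
have h1 := ler_wpM2l W0 IH.
have h2 : h * modc (P - Q) <= h * (2 * (h / tau * (modc w + tau) ^+ m)).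
  by rewrite ler_wpM2l// mulrDl mul1r; apply: le_trans (ler_modcB _ _) _; exact: lerD.
apply: le_trans (lerD h1 h2) _.
move: ((modc w + tau) ^+ m) => X; move: (modc w) => W.
suff -> : 2 * (h / tau) ^+ 2 * ((W + tau) * X) =
  W * (2 * (h / tau) ^+ 2 * X) + h * (2 * (h / tau * X)) by [].
by field; rewrite gt_eqF.
Qed.

Lemma expR_le_1D2x (y : R) : 0 <= y <= 2^-1 -> expR y <= 1 + 2 * y.
Proof.
move=> /andP[y0 y1].
have h := expR_ge1Dx (- y); have hp := expR_gt0 y.
have e1 : expR y * expR (- y) = 1 by rewrite -expRD subrr expR0.
have h2 : expR y * (1 + - y) <= 1 by rewrite -[X in _ <= X]e1; apply: ler_wpM2l => //; exact: ltW.
clear -h2 hp y0 y1; nra.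
Qed.

Lemma sin_ge_half (y : R) : 0 <= y <= 2^-1 -> y / 2 <= sin y.
Proof.
move=> /andP[y0 y1].
have [] := @MVT_segment R sin cos 0 y y0.
  by apply: continuous_subspaceT => t; exact: continuous_sin.
move=> t; rewrite in_itv /= => /andP[t0 ty]; rewrite sin0 !subr0 => ->.
have := ler_norm_cos 0 t; rewrite cos0 subr0 (ger0_norm t0) distrC => hc.
have hc' := ler_norm (1 - cos t).
have hh : 2^-1 <= cos t by clear -hc hc' ty y1; lra.
by rewrite [leLHS]mulrC ler_wpM2r.
Qed.

(** Read downwards: a sequence that nearly grows by the factor [mu] at each step and is bounded at
    the top must be small at the bottom. *)
Lemma backward_recursion_bound (v : nat -> R[i]) (mu : R[i]) (nu E : R) s :
  1 <= nu -> nu <= modc mu -> 0 <= E ->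
  (forall l, (l < s)%N -> modc (v l.+1 - mu * v l) <= E) ->
  nu ^+ s * modc (v 0%N) <= modc (v s) + s%:R * nu ^+ s * E.
Proof.
move=> nu1 numu E0; elim: s => [|s IH] hv.
  by rewrite expr0 !mul1r mul0r mul0r addr0.
have nu0 : 0 <= nu by rewrite (le_trans ler01).
have := ler_wpM2l nu0 (IH (fun l ls => hv l (ltnW ls))).
move=> h; rewrite exprS -mulrA; apply: (le_trans h); rewrite mulrDr.
have hs : nu * modc (v s) <= modc (v s.+1) + E.
  apply: le_trans (_ : modc (mu * v s) <= _).
    by rewrite modcM ler_wpM2r// modc_ge0.
  have -> : mu * v s = v s.+1 - (v s.+1 - mu * v s) by rewrite opprB addrC subrK.
  by apply: le_trans (ler_modcB _ _) _; rewrite lerD2l hv.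
have hE : E <= nu * nu ^+ s * E.
  by rewrite -exprS -[X in X <= _]mul1r ler_wpM2r// exprn_ege1.
rewrite -[s.+1%:R]natr1; apply: le_trans (lerD hs (lexx _)) _.
move: (nu ^+ s) hE => X hE.
have -> : (s%:R + 1) * (nu * X) * E = nu * (s%:R * X * E) + nu * X * E by ring.
by clear -hE; lra.
Qed.

(* Discrete contour shift: the defect hypothesis is a Cauchy-Riemann equation for
   G(t + iy) on a mesh, and multiplies the weighted sums by mu at each step up. *)
Lemma shifted_sum_bound (G : R -> R -> R[i]) (B E kappa eta : R) (J s : nat) :
  0 <= kappa -> 0 <= eta -> kappa * eta <= 2^-1 -> 0 <= B -> 0 <= E ->
  (forall t (l : nat), (l <= s)%N -> modc (G t (l%:R * eta)) <= B) ->
  (forall j l : nat, (j < J)%N -> (l < s)%N ->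
     modc (G (j%:R * eta) (l.+1%:R * eta) - G (j%:R * eta) (l%:R * eta) -
           'i * (G (j.+1%:R * eta) (l%:R * eta) - G (j%:R * eta) (l%:R * eta))) <= E) ->
  modc (\sum_(j < J) cis (kappa * eta) ^+ j * G (j%:R * eta) 0) <=
  J%:R * B * expR (- (kappa * (s%:R * eta) / 4)) + s%:R * (2 * B + J%:R * E).
Proof.
move=> k0 e0 ke B0 E0 hB hE.
set q := cis (kappa * eta); set p := cis (- (kappa * eta)).
have qp : q * p = 1 by rewrite -cisD subrr cis0.
have modq j : modc (q ^+ j) = 1 by rewrite modcX modc_cis expr1n.
pose v l := \sum_(j < J) q ^+ j * G (j%:R * eta) (l%:R * eta).
(* Replacing the upward difference by i times the horizontal one, and the index shift by
   multiplication with [p], gives 1 + i (p - 1). Its real part is 1 + sin(kappa eta) >= 1 + kappa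
   eta / 2. *)
pose mu := 1 - 'i + 'i * p.
pose nu := 1 + kappa * eta / 2.
have ke0 : 0 <= kappa * eta by rewrite mulr_ge0.
have nu1 : 1 <= nu by rewrite /nu lerDl divr_ge0.
have numu : nu <= modc mu.
  apply: le_trans (normr_Re mu); apply: le_trans (ler_norm _).
  rewrite /mu /nu cReD cReD cReN cReM /= sinN cosN.
  have := @sin_ge_half (kappa * eta); rewrite ke0 ke => /(_ isT) hs.
  by clear -hs; lra.
have hJE (a : nat -> R[i]) (C : R) :
    (forall j, (j < J)%N -> modc (a j) <= C) -> modc (\sum_(j < J) q ^+ j * a j) <= J%:R * C.
  move=> ha; apply: le_trans (ler_modc_sum _ _ _) _.
  rewrite mulr_natl -[X in _ *+ X]card_ord -sumr_const; apply: ler_sum => j _.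
  by rewrite modcM modq mul1r ha.
have step l : (l < s)%N -> modc (v l.+1 - mu * v l) <= 2 * B + J%:R * E.
  move=> ls.
  pose g j := G (j%:R * eta) (l%:R * eta).
  pose err j := G (j%:R * eta) (l.+1%:R * eta) - g j - 'i * (g j.+1 - g j).
  (* Shifting the index leaves two end terms, each at most [B] in modulus: the source of 2 B in the
     error per step. *)
  have tele : \sum_(j < J) q ^+ j * g j.+1 = p * (v l + q ^+ J * g J - g 0%N).
    have -> : v l + q ^+ J * g J - g 0%N = \sum_(j < J) q ^+ j.+1 * g j.+1.
      have -> : v l + q ^+ J * g J = \sum_(j < J.+1) q ^+ j * g j by rewrite big_ord_recr.
      by rewrite big_ord_recl expr0 mul1r addrC addrA addNr add0r.
    rewrite mulr_sumr; apply: eq_bigr => j _.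
    by rewrite exprS mulrA mulrA [p * q]mulrC qp mul1r.
  have -> : v l.+1 - mu * v l =
     'i * p * (q ^+ J * g J - g 0%N) + \sum_(j < J) q ^+ j * err j.
    have -> : \sum_(j < J) q ^+ j * err j =
       v l.+1 - v l - 'i * (\sum_(j < J) q ^+ j * g j.+1 - v l).
      rewrite /v -!sumrB mulr_sumr -sumrB; apply: eq_bigr => j _.
      by rewrite /err /g; ring.
    by rewrite tele /mu; ring.
  apply: le_trans (ler_modcD _ _) _; apply: lerD.
    rewrite modcM modcM modc_i modc_cis !mul1r mulrDl mul1r.
    apply: le_trans (ler_modcB _ _) _; rewrite modcM modq mul1r.
    by apply: lerD; apply: hB; exact: ltnW.
  by apply: hJE => j jJ; exact: hE.
have D0 : 0 <= 2 * B + J%:R * E by rewrite addr_ge0// mulr_ge0.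
have := backward_recursion_bound nu1 numu D0 step.
have -> : v 0%N = \sum_(j < J) q ^+ j * G (j%:R * eta) 0.
  by rewrite /v; apply: eq_bigr => j _; rewrite mul0r.
have hvs : modc (v s) <= J%:R * B by apply: (hJE (fun j => G (j%:R * eta) (s%:R * eta))) => j _; exact: hB.
set V := modc _; move: (2 * B + J%:R * E) D0 => D D0 h.
(* From e^y <= 1 + 2 y at y = kappa eta / 4; half of the rate kappa / 2 is given away here. *)
have nus : expR (kappa * (s%:R * eta) / 4) <= nu ^+ s.
  have -> : kappa * (s%:R * eta) / 4 = s%:R * (kappa * eta / 4) by ring.
  rewrite expRM_natl lerXn2r ?nnegrE ?expR_ge0 ?(le_trans ler01 nu1)//.
  have -> : nu = 1 + 2 * (kappa * eta / 4) by rewrite /nu; field.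
  by apply: expR_le_1D2x; clear -ke ke0; lra.
have nus0 : 0 < nu ^+ s by rewrite exprn_gt0// (lt_le_trans ltr01).
have h3 : V <= (nu ^+ s)^-1 * (J%:R * B) + s%:R * D.
  rewrite -(ler_pM2l nus0); apply: (le_trans h); rewrite mulrDr mulrA divff ?gt_eqF// mul1r.
  by apply: lerD => //; rewrite mulrCA mulrA.
apply: (le_trans h3); rewrite lerD2r mulrC ler_wpM2l ?mulr_ge0//.
by rewrite expRN lef_pV2// posrE// expR_gt0.
Qed.


(** * The discrete Cauchy-Riemann equation for analytic functions *)

Implicit Types (b : bool) (x : R * R).

(** The Boolean selects the coordinate in which the contour is shifted. *)
Definition cdir b z : R[i] * R[i] := if b then (z, 0) else (0, z).
Definition rdir b (t : R) : R * R := if b then (t, 0) else (0, t).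
Definition kdir b (k : int * int) : int := if b then k.1 else k.2.

Definition defect (F : R[i] * R[i] -> R[i]) b (z : R[i] * R[i]) h : R[i] :=
  F (z + cdir b ('i * h%:C)) - F z - 'i * (F (z + cdir b h%:C) - F z).

Lemma esum_psum (a : nat -> nat -> R) : (forall m l, 0 <= a m l) ->
  (\esum_(p in [set: nat * nat]) (a p.1 p.2)%:E < +oo)%E ->
  exists2 S : R, 0 <= S & forall n, \sum_(m < n) \sum_(l < n) a m l <= S.
Proof.
move=> a0 hfin.
have h0 : (0 <= \esum_(p in [set: nat * nat]) (a p.1 p.2)%:E)%E.
  by apply: esum_ge0 => p _; rewrite lee_fin.
exists (fine (\esum_(p in [set: nat * nat]) (a p.1 p.2)%:E)); first exact: fine_ge0.
move=> n; rewrite -lee_fin fineK ?ge0_fin_numE//.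
apply: esum_ge; exists [set` [seq (m, l) | m <- index_iota 0 n, l <- index_iota 0 n]].
  by split => //; exact: finite_seq.
rewrite -fsbig_seq//; last first.
  by apply: allpairs_uniq; rewrite ?iota_uniq// => -[? ?] [? ?].
rewrite sumEFin big_allpairs lee_fin /= big_mkord.
by apply: ler_sum => m _; rewrite big_mkord.
Qed.

(** The factor 4 counts the values of the function in the defect, with F z occurring twice. *)
Lemma modc_defect_le (F P : R[i] * R[i] -> R[i]) b (z : R[i] * R[i]) h (e : R) :
  modc (P (z + cdir b ('i * h%:C)) - F (z + cdir b ('i * h%:C))) <= e ->
  modc (P (z + cdir b h%:C) - F (z + cdir b h%:C)) <= e ->
  modc (P z - F z) <= e ->
  modc (defect F b z h) <= modc (defect P b z h) + 4 * e.
Proof.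
rewrite /defect.
move: (F (z + cdir b ('i * _))) (P (z + cdir b ('i * _))) => F1 P1.
move: (F (z + cdir b _)) (P (z + cdir b _)) (F z) (P z) => F2 P2 F0 P0 h1 h2 h0.
have -> : F1 - F0 - 'i * (F2 - F0) = (P1 - P0 - 'i * (P2 - P0)) -
  ((P1 - F1) - (P0 - F0) - 'i * ((P2 - F2) - (P0 - F0))) by ring.
apply: le_trans (ler_modcB _ _) _; rewrite lerD2l.
apply: le_trans (ler_modcB _ _) _; rewrite modcM modc_i mul1r.
have g1 := ler_modcB (P1 - F1) (P0 - F0); have g2 := ler_modcB (P2 - F2) (P0 - F0).
by clear -g1 g2 h0 h1 h2; lra.
Qed.

Lemma analytic_defect D (F : R[i] * R[i] -> R[i]) a b : analytic_on D F -> D a ->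
  exists rho M : R, 0 < rho /\ forall z : R[i] * R[i], modc (z.1 - a.1) < rho -> modc (z.2 - a.2) < rho ->
    forall h, 0 <= h <= rho -> modc (defect F b z h) <= M * h ^+ 2.
Proof.
move=> hF Da; have [c [rho [rho0 hw]]] := hF a Da.
(* A point within [tau] of the centre, enlarged by a further [tau] in the power estimates, stays
   within rho/2 = |r|; the absolute convergence at (r, r) then sums the defects of all monomials. *)
pose tau := rho / 4; have tau0 : 0 < tau by rewrite divr_gt0.
pose r := (rho / 2)%:C; have modr : modc r = rho / 2.
  by rewrite modc_real ger0_norm// divr_ge0// ltW.
have rho2 : rho / 2 < rho by rewrite ltr_pdivrMr// mulr_natr mulr2n ltrDl.
have [hsum _] : _ /\ _ := hw (r, r) ltac:(by rewrite modr) ltac:(by rewrite modr).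
have [|S S0 hS] := @esum_psum (fun m l => modc (c m l * r ^+ m * r ^+ l)) _ hsum.
  by move=> m l; exact: modc_ge0.
exists tau, (2 * (tau ^+ 2)^-1 * S); split => // z z1 z2 h hh.
have /andP[h0 ht] := hh.
pose P n (w : R[i] * R[i]) :=
  \sum_(m < n) \sum_(l < n) c m l * (w.1 - a.1) ^+ m * (w.2 - a.2) ^+ l.
have hP (w : R[i] * R[i]) : modc (w.1 - a.1) < rho -> modc (w.2 - a.2) < rho ->
    modc (P n w - F w) @[n --> \oo] --> (0 : R).
  move=> w1 w2; have [_] := hw (w.1 - a.1, w.2 - a.2) w1 w2.
  by rewrite /= !subrKC -surjective_pairing.
have mh : modc h%:C = h by rewrite modc_real ger0_norm.
have mih : modc ('i * h%:C) = h by rewrite modcM modc_i mul1r.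
have near w : modc w = h -> modc ((z + cdir b w).1 - a.1) < rho /\
    modc ((z + cdir b w).2 - a.2) < rho.
  move=> mw.
  have H (y v : R[i]) : modc y < tau -> modc v <= h -> modc (y + v) < rho.
    move=> hy hv; apply: le_lt_trans (ler_modcD _ _) _.
    by move: hy hv ht tau0; rewrite /tau; clear; lra.
  have A1 (v : R[i]) : modc v <= h -> modc (z.1 + v - a.1) < rho.
    by move=> hv; rewrite addrAC; exact: H.
  have A2 (v : R[i]) : modc v <= h -> modc (z.2 + v - a.2) < rho.
    by move=> hv; rewrite addrAC; exact: H.
  by rewrite /cdir; case: (b); split; (apply: A1 || apply: A2); rewrite ?mw ?modc0.
have defP n : modc (defect (P n) b z h) <= 2 * (tau ^+ 2)^-1 * S * h ^+ 2.
  pose T m l := modc (c m l * r ^+ m * r ^+ l).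
  have -> : 2 * (tau ^+ 2)^-1 * S * h ^+ 2 = 2 * (h / tau) ^+ 2 * S.
    by field; rewrite gt_eqF.
  apply: le_trans (_ : 2 * (h / tau) ^+ 2 * (\sum_(m < n) \sum_(l < n) T m l) <= _); last first.
    by rewrite ler_wpM2l// mulr_ge0// sqr_ge0.
  have -> : defect (P n) b z h = \sum_(m < n) \sum_(l < n)
      defect (fun w : R[i] * R[i] => c m l * (w.1 - a.1) ^+ m * (w.2 - a.2) ^+ l) b z h.
    rewrite /defect /P -!sumrB mulr_sumr -sumrB; apply: eq_bigr => m _.
    by rewrite -!sumrB mulr_sumr -sumrB.
  rewrite mulr_sumr; apply: le_trans (ler_modc_sum _ _ _) _; apply: ler_sum => m _.
  rewrite mulr_sumr; apply: le_trans (ler_modc_sum _ _ _) _; apply: ler_sum => l _.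
  have hr (y : R[i]) j : modc y < tau -> modc y ^+ j <= modc r ^+ j.
    move=> hy; rewrite lerXn2r ?nnegrE ?modc_ge0// modr.
    by move: hy tau0; rewrite /tau; clear; lra.
  have hd (y : R[i]) j : modc y < tau ->
      modc ((y + 'i * h%:C) ^+ j - y ^+ j - 'i * ((y + h%:C) ^+ j - y ^+ j)) <=
      2 * (h / tau) ^+ 2 * modc r ^+ j.
    move=> hy; apply: le_trans (ler_power_defect y j hh tau0) _.
    apply: ler_wpM2l; first by apply: mulr_ge0 => //; exact: sqr_ge0.
    rewrite lerXn2r ?nnegrE ?modc_ge0//.
      by rewrite addr_ge0 ?modc_ge0// ltW.
    by rewrite modr; move: hy tau0; rewrite /tau; clear; lra.
  rewrite /T !modcM !modcX /defect /cdir; case: (b) => /=.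
    rewrite !addr0 (addrAC z.1 ('i * _)) (addrAC z.1 h%:C).
    have -> : forall X Y Z y : R[i], c m l * X * y - c m l * Y * y -
       'i * (c m l * Z * y - c m l * Y * y) = c m l * (X - Y - 'i * (Z - Y)) * y.
      by move=> *; ring.
    rewrite !modcM modcX; apply: le_trans (_ : modc (c m l) *
       (2 * (h / tau) ^+ 2 * modc r ^+ m) * modc r ^+ l <= _); last first.
      by rewrite le_eqVlt; apply/orP; left; apply/eqP; ring.
    apply: ler_pM; rewrite ?mulr_ge0 ?modc_ge0 ?exprn_ge0 ?modc_ge0//.
      by rewrite ler_wpM2l ?modc_ge0// hd.
    exact: hr.
  rewrite !addr0 (addrAC z.2 ('i * _)) (addrAC z.2 h%:C).
  have -> : forall X Y Z y : R[i], c m l * y * X - c m l * y * Y -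
     'i * (c m l * y * Z - c m l * y * Y) = c m l * y * (X - Y - 'i * (Z - Y)).
    by move=> *; ring.
  rewrite !modcM modcX; apply: le_trans (_ : modc (c m l) * modc r ^+ m *
     (2 * (h / tau) ^+ 2 * modc r ^+ l) <= _); last first.
    by rewrite le_eqVlt; apply/orP; left; apply/eqP; ring.
  apply: ler_pM; rewrite ?mulr_ge0 ?modc_ge0 ?exprn_ge0 ?modc_ge0//.
    by rewrite ler_wpM2l ?modc_ge0// hr.
  exact: hd.
(* The bound on polynomial defects does not depend on [n], so convergence at the three points
   involved carries it over to [F]. *)
apply/ler_addgt0Pr => e e0.
have e4 : 0 < e / 4 by rewrite divr_gt0.
have [n1a n1b] := near _ mih; have [n2a n2b] := near _ mh.
have n0a : modc (z.1 - a.1) < rho by apply: lt_trans z1 _; rewrite /tau; clear -rho0; lra.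
have n0b : modc (z.2 - a.2) < rho by apply: lt_trans z2 _; rewrite /tau; clear -rho0; lra.
have small (w : R[i] * R[i]) : modc (w.1 - a.1) < rho -> modc (w.2 - a.2) < rho ->
    \forall n \near \oo, modc (P n w - F w) <= e / 4.
  move=> w1 w2; have /cvgrPdist_le/(_ _ e4) := hP w w1 w2.
  apply: filterS => n; rewrite sub0r normrN ger0_norm ?modc_ge0//.
have [n [[q1 q2] q0]] : exists n, (modc (P n (z + cdir b ('i * h%:C)) -
     F (z + cdir b ('i * h%:C))) <= e / 4 /\
     modc (P n (z + cdir b h%:C) - F (z + cdir b h%:C)) <= e / 4) /\
     modc (P n z - F z) <= e / 4.
  have [n _ Hn] := filterI (filterI (small _ n1a n1b) (small _ n2a n2b)) (small _ n0a n0b).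
  by exists n; apply: Hn => /=.
apply: le_trans (modc_defect_le q1 q2 q0) _.
have -> : 4 * (e / 4) = e by field.
by rewrite lerD2r.
Qed.


Definition zpt b x (t y : R) : R[i] * R[i] :=
  (x.1%:C, x.2%:C) + cdir b (t%:C + 'i * y%:C).

Lemma zpt_shift b x t y h : zpt b x (t + h) y = zpt b x t y + cdir b h%:C.
Proof.
rewrite /zpt -addrA; congr (_ + _); rewrite /cdir; case: b.
  by rewrite realcD -[RHS]/(_, _) /= addr0 addrAC.
by rewrite realcD -[RHS]/(_, _) /= addr0 addrAC.
Qed.

Lemma zpt_lift b x t y h : zpt b x t (y + h) = zpt b x t y + cdir b ('i * h%:C).
Proof.
rewrite /zpt -addrA; congr (_ + _); rewrite /cdir; case: b.
  by rewrite realcD mulrDr -[RHS]/(_, _) /= addr0 addrA.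
by rewrite realcD mulrDr -[RHS]/(_, _) /= addr0 addrA.
Qed.

Lemma zpt_strip b x t y sigma : `|y| < sigma -> strip sigma (zpt b x t y).
Proof.
move=> ys; have s0 : 0 < sigma by apply: le_lt_trans ys.
rewrite /strip /zpt /cdir; case: b => /=; split;
by rewrite ?mul0r ?mul1r ?addr0 ?add0r ?normr0 ?mulr0 ?addr0 ?add0r ?normr0.
Qed.

(** Compactness of the parameter set, contained in the open strip because sigma < sigma0. A single
    integer bounds both the constant and the inverse of the admissible step, so that the property
    holds for all large integers near each point. *)
Lemma analytic_defect_unif sigma0 F b (L1 L sigma : R) :
  analytic_on (strip sigma0) F -> sigma < sigma0 ->
  exists n : nat, forall x t y, `|x.1| <= L1 -> `|x.2| <= L1 -> 0 <= t <= L ->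
    0 <= y <= sigma -> forall h, 0 <= h <= n.+1%:R^-1 ->
    modc (defect F b (zpt b x t y) h) <= n%:R * h ^+ 2.
Proof.
move=> hF ss0.
pose K : set (R * R * (R * R)) :=
  (`[- L1, L1] `*` `[- L1, L1]) `*` (`[0, L] `*` `[0, sigma]).
have cK : compact K by do !apply: compact_setX; exact: segment_compact.
pose Q (p : R * R * (R * R)) (n : nat) := forall h, 0 <= h <= n.+1%:R^-1 ->
   modc (defect F b (zpt b p.1 p.2.1 p.2.2) h) <= n%:R * h ^+ 2.
have H : forall p, K p -> \forall p' \near p & n \near \oo, Q p' n.
  move=> p [_ [_]]; rewrite /= in_itv /= => /andP[y0 ys].
  have := @zpt_strip b p.1 p.2.1 p.2.2 sigma0; rewrite ger0_norm// => /(_ (le_lt_trans ys ss0)).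
  move=> /(analytic_defect b hF)[rho [M [rho0 HM]]].
  have r4 : 0 < rho / 4 by rewrite divr_gt0.
  pose n0 := Num.bound (`|M| + rho^-1).
  have hn0 : `|M| + rho^-1 < n0%:R by apply: archi_boundP; rewrite addr_ge0// invr_ge0 ltW.
  exists (ball p (rho / 4), [set n : nat | (n0 <= n)%N]).
    by split => /=; [exact: nbhsx_ballx|exists n0].
  move=> [p' n] [/= [[b1 b2] [b3 b4]] hn] h /andP[h0 hh].
  have hn' : n0%:R <= n%:R :> R by rewrite ler_nat.
  move: b1 b2 b3 b4; rewrite /ball /= => b1 b2 b3 b4.
  rewrite distrC in b1; rewrite distrC in b2; rewrite distrC in b3; rewrite distrC in b4.
  have tri (v d1 d2 d3 : R) : `|d1| < rho / 4 -> `|d2| < rho / 4 -> `|d3| < rho / 4 ->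
     modc (d1%:C + (d2%:C + 'i * d3%:C)) < rho.
    move=> h1 h2 h3; apply: le_lt_trans (ler_modcD _ _) _.
    have := ler_modcD d2%:C ('i * d3%:C); rewrite modcM modc_i mul1r !modc_real => h4.
    by clear -h1 h2 h3 h4 rho0; lra.
  have tri1 (d : R) : `|d| < rho / 4 -> modc d%:C < rho.
    by move=> hd; rewrite modc_real; clear -hd rho0; lra.
  have e1 (a d u v y y' : R) : a%:C + (u%:C + 'i * y%:C) - (d%:C + (v%:C + 'i * y'%:C)) =
     (a - d)%:C + ((u - v)%:C + 'i * (y - y')%:C).
    by apply: complexP; rewrite /=; ring.
  have e2 (a d : R) : a%:C + 0 - (d%:C + 0) = (a - d)%:C.
    by apply: complexP; rewrite /=; ring.
  apply: le_trans (_ : M * h ^+ 2 <= _); last first.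
    rewrite ler_wpM2r ?sqr_ge0//; apply: le_trans (ler_norm M) _.
    apply: le_trans hn'; apply: ltW; apply: le_lt_trans hn0; rewrite lerDl invr_ge0; exact: ltW.
  apply: HM.
  - rewrite /zpt /cdir; case: (b) => /=; rewrite ?e1 ?e2.
      exact: tri.
    exact: tri1.
  - rewrite /zpt /cdir; case: (b) => /=; rewrite ?e1 ?e2.
      exact: tri1.
    exact: tri.
  rewrite h0 (le_trans hh)// -[leRHS]invrK lef_pV2 ?posrE ?invr_gt0//.
  rewrite -[n.+1%:R]natr1 ltW//; apply: le_lt_trans (_ : n%:R < _); last by rewrite ltrDl.
  apply: le_trans hn'; apply: ltW; apply: le_lt_trans hn0; rewrite lerDr; exact: normr_ge0.
have /compact_near_coveringP cov := cK.
have [n _ Hn] := cov nat \oo (fun n p => Q p n) _ H.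
exists n => x t y x1 x2 tL ys h hh.
apply: (Hn n (leqnn n) (x, (t, y))) => //=.
by split; split; rewrite /= in_itv //= -ler_norml.
Qed.

(** * Decay of the Fourier coefficients *)

Lemma bm_lincomb (J : nat) (a : nat -> R) (g : nat -> R * R -> R) :
  (forall j, bm (g j)) -> bm (fun x => \sum_(j < J) a j * g j x).
Proof.
move=> hg; elim: J => [|J IH].
  by under eq_fun do rewrite big_ord0; exact: bm_cst.
under eq_fun do rewrite big_ord_recr.
by apply: bmD => //; exact: bmZ.
Qed.

Lemma fourier_lincomb (J : nat) (a : nat -> R) (g : nat -> R * R -> R) k :
  (forall j, bm (g j)) ->
  fourier (fun x => \sum_(j < J) a j * g j x) k = \sum_(j < J) (a j)%:C * fourier (g j) k.
Proof.
move=> hg; elim: J => [|J IH].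
  rewrite big_ord0; under eq_fun do rewrite big_ord0.
  have -> : (fun=> 0) = (fun x : R * R => 0 * g 0%N x) by apply/funext => x; rewrite mul0r.
  by rewrite fourierZ// mul0r.
under eq_fun do rewrite big_ord_recr.
rewrite big_ord_recr fourierD; [|exact: bm_lincomb|exact: bmZ].
by rewrite IH fourierZ.
Qed.

(** Coefficients are defined for real functions, so the combination is split into real and imaginary
    parts; each contributes 2 C by [modc_fourier_le]. *)
Lemma modc_fourier_comb (J : nat) (q : nat -> R[i]) (g : nat -> R * R -> R) k (C : R) :
  (forall j, bm (g j)) ->
  (forall x, Omega x -> modc (\sum_(j < J) q j * (g j x)%:C) <= C) ->
  modc (\sum_(j < J) q j * fourier (g j) k) <= 4 * C.
Proof.
move=> hg hC.
have qE (z : R[i]) : z = (complex.Re z)%:C + 'i * (complex.Im z)%:C.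
  by case: z => a b; apply: complexP; rewrite /=; ring.
have -> : \sum_(j < J) q j * fourier (g j) k =
    fourier (fun x => \sum_(j < J) complex.Re (q j) * g j x) k +
    'i * fourier (fun x => \sum_(j < J) complex.Im (q j) * g j x) k.
  rewrite (@fourier_lincomb J (fun j => complex.Re (q j)) g k hg).
  rewrite (@fourier_lincomb J (fun j => complex.Im (q j)) g k hg) mulr_sumr -big_split; apply: eq_bigr => j _.
  by rewrite [in LHS](qE (q j)) mulrDl -mulrA.
have ReE (z : R[i]) (a : R) : complex.Re z * a = complex.Re (z * a%:C).
  by case: z => u v /=; rewrite mulr0 subr0.
have ImE (z : R[i]) (a : R) : complex.Im z * a = complex.Im (z * a%:C).
  by case: z => u v /=; rewrite mulr0 add0r.
apply: le_trans (ler_modcD _ _) _; rewrite (modcM 'i) modc_i mul1r.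
have -> : 4 * C = 2 * C + 2 * C by ring.
apply: lerD; apply: modc_fourier_le.
- exact: (@bm_lincomb J (fun j => complex.Re (q j))).
- move=> x /hC; apply: le_trans; under eq_bigr do rewrite ReE.
  by rewrite -cRe_sum normr_Re.
- exact: (@bm_lincomb J (fun j => complex.Im (q j))).
- move=> x /hC; apply: le_trans; under eq_bigr do rewrite ImE.
  by rewrite -cIm_sum normr_Im.
Qed.

Lemma dotkDr k x (a : R * R) : dotk k (x + a) = dotk k a + dotk k x.
Proof. by rewrite /dotk /=; ring. Qed.

Lemma wiener_shift A c f (a : R * R) : wiener A c f ->
  wiener A (fun k => c k * cis (dotk k a)) (fun x => f (x + a)).
Proof.
move=> [hc hA hf]; split.
- by move=> k; rewrite hc dotkN -cis_conj; exact/esym/rmorphM.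
- by move=> n; under eq_bigr do rewrite modcM modc_cis mulr1.
- move=> x; rewrite (_ : (fun n => _) = fun n => rtp n c (x + a)); first exact: hf.
  apply/funext => n; rewrite /rtp; congr complex.Re; apply: eq_bigr => k _.
  by rewrite dotkDr cisD mulrA.
Qed.

Lemma dotk_rdir b k t : dotk k (rdir b t) = (kdir b k)%:~R * t.
Proof. by rewrite /dotk /rdir /kdir; case: b; rewrite /= mulr0 ?addr0 ?add0r. Qed.

Lemma zpt_real b x t : zpt b x t 0 = ((x + rdir b t).1%:C, (x + rdir b t).2%:C).
Proof.
rewrite /zpt /cdir /rdir; case: b => /=; rewrite mulr0 !addr0 !realcD -[LHS]/(_, _) /=.
  by rewrite addr0.
by rewrite addr0.
Qed.

Lemma cisX (t : R) n : cis t ^+ n = cis (n%:R * t).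
Proof.
elim: n => [|n IH]; first by rewrite mul0r cis0.
by rewrite exprS IH -cisD -natr1 mulrDl mul1r addrC.
Qed.


(** With frequency -kappa the weights cancel the phases of the translates, so the combination has
    [J] times the coefficient of [f]; this sign goes with an upward shift. The shift has height
    sigma0/2, and the mesh estimate yields a quarter of it as rate: sigma0/8. *)
Lemma analytic_fourier_decay_npos (A B sigma0 : R) f (F : R[i] * R[i] -> R[i]) (k : int * int) b :
  wiener A (fourier f) f -> analytic_on (strip sigma0) F -> 0 < sigma0 -> 0 <= B ->
  (forall x, F (x.1%:C, x.2%:C) = (f x)%:C) ->
  (forall z : R[i] * R[i], strip sigma0 z -> modc (F z) <= B) -> kdir b k <= 0 ->
  modc (fourier f k) <= 4 * B * expR (- (sigma0 / 8 * `|kdir b k|%:~R)).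
Proof.
move=> wf hF s0 B0 hf hB k0.
pose kappa : R := `|kdir b k|%:~R.
have kappaE : (kdir b k)%:~R = - kappa :> R by rewrite /kappa ler0_norm// rmorphN opprK.
have kappa0 : 0 <= kappa by rewrite /kappa ler0z.
pose sigma := sigma0 / 2.
have sg0 : 0 < sigma by rewrite divr_gt0.
have sgs : sigma < sigma0 by rewrite ltr_pdivrMr// mulr_natr mulr2n ltrDl.
apply/ler_addgt0Pr => e e0.
(* The mesh has length n sigma. Relative to J = s n the end terms over all s steps amount to 8 B /
   n, at most e/2. *)
pose n := (Num.bound (16 * B / e)).+1.
have n0 : 0 < n%:R :> R by rewrite ltr0n.
have hn : 8 * B / n%:R <= e / 2.
  rewrite ler_pdivrMr//.
  have : 16 * B / e < n%:R.
    apply: lt_le_trans (archi_boundP _) _; first by rewrite divr_ge0 ?mulr_ge0// ltW.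
    by rewrite ler_nat.
  by rewrite ltr_pdivrMr// => h; clear -h; lra.
have [m Hm] := analytic_defect_unif b pi (n%:R * sigma) hF sgs.
(* The constant [m] depends on the length n sigma but not on the mesh, so the number of steps [s]
   may be chosen after it. The three summands make the accumulated defect at most e/2, kappa eta at
   most 1/2, and eta admissible for [Hm]. *)
pose bd := 8 * m%:R * sigma ^+ 2 / e + 2 * (kappa * sigma) + sigma * m.+1%:R.
have bd1 : 0 <= 8 * m%:R * sigma ^+ 2 / e.
  by rewrite divr_ge0 ?(ltW e0)// mulr_ge0 ?sqr_ge0// mulr_ge0.
have bd2 : 0 <= 2 * (kappa * sigma) by rewrite !mulr_ge0// ltW.
have bd3 : 0 <= sigma * m.+1%:R by rewrite mulr_ge0// ltW.
pose s := (Num.bound bd).+1.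
have s0' : 0 < s%:R :> R by rewrite ltr0n.
have hs : bd <= s%:R.
  apply: ltW; apply: lt_le_trans (archi_boundP _) _; last by rewrite ler_nat.
  by rewrite /bd !addr_ge0.
pose eta := sigma / s%:R.
have eta0 : 0 <= eta by rewrite divr_ge0 ?(ltW sg0)// ltW.
have seta : s%:R * eta = sigma by rewrite /eta mulrC divfK// gt_eqF.
have keta : kappa * eta <= 2^-1.
  rewrite /eta mulrA ler_pdivrMr//; move: hs; rewrite /bd; clear -bd1 bd3; lra.
have eta_m : eta <= m.+1%:R^-1.
  rewrite /eta ler_pdivrMr// mulrC ler_pdivlMr//; move: hs; rewrite /bd; clear -bd1 bd2; lra.
pose J := (s * n)%N.
have J0 : 0 < J%:R :> R by rewrite ltr0n muln_gt0.
have JE : J%:R = s%:R * n%:R :> R by rewrite natrM.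
have Jeta : J%:R * eta = n%:R * sigma by rewrite JE -seta; ring.
have main x : Omega x ->
    modc (\sum_(j < J) cis (kappa * eta) ^+ j * (f (x + rdir b (j%:R * eta)))%:C) <=
    J%:R * B * expR (- (kappa * (s%:R * eta) / 4)) + s%:R * (2 * B + J%:R * (m%:R * eta ^+ 2)).
  move=> [x1 x2].
  have -> : \sum_(j < J) cis (kappa * eta) ^+ j * (f (x + rdir b (j%:R * eta)))%:C =
     \sum_(j < J) cis (kappa * eta) ^+ j * F (zpt b x (j%:R * eta) 0).
    by apply: eq_bigr => j _; rewrite zpt_real hf.
  have lets (l : nat) : (l <= s)%N -> 0 <= l%:R * eta <= sigma.
    by move=> ls; rewrite mulr_ge0//= -seta ler_wpM2r// ler_nat.
  have H := @shifted_sum_bound (fun t y => F (zpt b x t y)) B (m%:R * eta ^+ 2) kappa eta J s.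
  apply: H => //.
  - by rewrite mulr_ge0// sqr_ge0.
  - move=> t l /lets /andP[l0 l1]; apply: hB; apply: zpt_strip.
    by rewrite ger0_norm// (le_lt_trans l1).
  - move=> j l jJ ls.
    have -> : l.+1%:R * eta = l%:R * eta + eta by rewrite -[l.+1%:R]natr1 mulrDl mul1r.
    have -> : j.+1%:R * eta = j%:R * eta + eta by rewrite -[j.+1%:R]natr1 mulrDl mul1r.
    rewrite zpt_lift zpt_shift; apply: Hm.
    + by rewrite ler_norml; move: x1; rewrite /= in_itv.
    + by rewrite ler_norml; move: x2; rewrite /= in_itv.
    + by rewrite mulr_ge0//= -Jeta ler_wpM2r// ler_nat ltnW.
    + exact/lets/ltnW.
    + by rewrite eta0.
have := modc_fourier_comb k (fun j => wiener_bm (wiener_shift (rdir b (j%:R * eta)) wf)) main.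
have -> : \sum_(j < J) cis (kappa * eta) ^+ j * fourier (fun x => f (x + rdir b (j%:R * eta))) k =
   J%:R%:C * fourier f k.
  have E (j : 'I_J) : cis (kappa * eta) ^+ j *
     fourier (fun x => f (x + rdir b (j%:R * eta))) k = fourier f k.
    rewrite (wiener_fourier k (wiener_shift (rdir b (j%:R * eta)) wf)) mulrCA.
    rewrite dotk_rdir kappaE cisX -cisD.
    have -> : j%:R * (kappa * eta) + - kappa * (j%:R * eta) = 0 by ring.
    by rewrite cis0 mulr1.
  have -> : J%:R%:C = J%:R :> R[i] by exact: rmorph_nat.
  by rewrite (eq_bigr _ (fun j _ => E j)) sumr_const card_ord [RHS]mulr_natl.
rewrite modcM modc_real (ger0_norm (ltW J0)) seta => h.
rewrite -(ler_pM2l J0); apply: (le_trans h).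
have -> : kappa * sigma / 4 = sigma0 / 8 * kappa by rewrite /sigma; field.
move: (expR _) => X.
have h3 : 4 * (s%:R * (2 * B + J%:R * (m%:R * eta ^+ 2))) <= J%:R * e.
  have -> : s%:R * (2 * B + J%:R * (m%:R * eta ^+ 2)) =
     J%:R * (2 * B / n%:R + m%:R * (sigma ^+ 2 / s%:R)).
    by rewrite JE -seta; field; rewrite !gt_eqF.
  rewrite mulrCA ler_pM2l//.
  have h4 : 4 * m%:R * sigma ^+ 2 / s%:R <= e / 2.
    rewrite ler_pdivrMr//; apply: le_trans (_ : e / 2 * bd <= _).
      have -> : 4 * m%:R * sigma ^+ 2 = e / 2 * (8 * m%:R * sigma ^+ 2 / e) by field; rewrite gt_eqF.
      rewrite ler_pM2l ?divr_gt0// /bd; clear -bd2 bd3; lra.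
    by rewrite ler_pM2l// divr_gt0.
  move: hn h4; rewrite !mulrA; clear; lra.
by rewrite mulrDr [leRHS]mulrDr; apply: lerD => //; rewrite !mulrA [4 * _]mulrC.
Qed.

Lemma analytic_fourier_decay (A B sigma0 : R) f (F : R[i] * R[i] -> R[i]) (k : int * int) b :
  wiener A (fourier f) f -> analytic_on (strip sigma0) F -> 0 < sigma0 -> 0 <= B ->
  (forall x, F (x.1%:C, x.2%:C) = (f x)%:C) ->
  (forall z : R[i] * R[i], strip sigma0 z -> modc (F z) <= B) ->
  modc (fourier f k) <= 4 * B * expR (- (sigma0 / 8 * `|kdir b k|%:~R)).
Proof.
move=> wf hF s0 B0 hf hB; have [k0|k0] := leP (kdir b k) 0.
  exact: analytic_fourier_decay_npos wf hF _ _ _ _ _.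
have kN : kdir b (- k) = - kdir b k by rewrite /kdir; case: (b).
have := @analytic_fourier_decay_npos A B sigma0 f F (- k) b wf hF s0 B0 hf hB.
by rewrite kN normrN (fourier_conj k (wiener_bm wf)) modc_conj; apply; rewrite oppr_le0 ltW.
Qed.


(** * Exponentially small truncation errors *)

Lemma bracket_exp_bounded (c : R) : 0 < c -> exists2 D : R, 0 <= D &
  forall (k : int * int) b, `|kdir (~~ b) k| <= `|kdir b k| ->
    bracket k ^+ 3 * expR (- (c * `|kdir b k|%:~R)) <= D.
Proof.
(* In the dominant direction 1 + |k|^2 <= 2 (1 + m)^2, so its cube is at most 8 (1 + m)^6; and d (1
   + m) <= 1 + c m / 6 <= e^(c m / 6), whose sixth power is e^(c m). *)
move=> c0; pose d := Num.min 1 (c / 6).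
have d0 : 0 < d by rewrite lt_min ltr01 divr_gt0.
exists (8 * (d ^+ 6)^-1); first by rewrite mulr_ge0// invr_ge0 exprn_ge0// ltW.
move=> k b hk; set m : R := _%:~R.
have m0 : 0 <= m by rewrite /m ler0z.
have km : bracket k <= 2 * (1 + m) ^+ 2.
  have hb : (kdir (~~ b) k)%:~R ^+ 2 <= m ^+ 2.
    rewrite -(real_normK (num_real (kdir (~~ b) k)%:~R)) lerXn2r ?nnegrE//.
    by rewrite -intr_norm ler_int.
  have hb' : (kdir b k)%:~R ^+ 2 = m ^+ 2.
    by rewrite -(real_normK (num_real (kdir b k)%:~R)) -intr_norm.
  have : bracket k <= 1 + 2 * m ^+ 2.
    rewrite /bracket /sqnormk lerD2l mulrDl mul1r.
    by move: hb hb'; rewrite /kdir; case: (b) => /= h1 h2; rewrite h2 ?lerD2l ?lerD2r.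
  by move=> h; apply: (le_trans h); clear -m0; nra.
have hd : d * (1 + m) <= expR (c * m / 6).
  apply: le_trans (expR_ge1Dx _); rewrite mulrDr mulr1; apply: lerD.
    by rewrite ge_min lexx.
  have -> : c * m / 6 = c / 6 * m by ring.
  by rewrite ler_wpM2r// ge_min lexx orbT.
have h6 : (d * (1 + m)) ^+ 6 <= expR (c * m).
  have -> : c * m = 6%:R * (c * m / 6) by field.
  rewrite expRM_natl lerXn2r ?nnegrE ?expR_ge0//.
  by rewrite mulr_ge0 ?(ltW d0)// addr_ge0.
have b3 : bracket k ^+ 3 <= 8 * (1 + m) ^+ 6.
  have -> : 8 * (1 + m) ^+ 6 = (2 * (1 + m) ^+ 2) ^+ 3 by ring.
  by rewrite lerXn2r ?nnegrE ?(ltW (bracket_gt0 _))// mulr_ge0// sqr_ge0.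
rewrite expRN ler_pdivrMr ?expR_gt0//; apply: (le_trans b3).
rewrite -mulrA ler_pM2l// mulrC ler_pdivlMr ?exprn_gt0// -exprMn mulrC.
exact: h6.
Qed.

(** Squared coefficients carry two exponentials. One gives the rate, as the dominant frequency
    outside the box is at least N; the other absorbs three powers of 1 + |k|^2, one for the
    derivative and two for summability. *)
Lemma exponential_tail (c : R) : 0 < c -> exists2 Z : R, 0 <= Z &
  forall (A B : R) f f1, wiener A (fourier f) f -> wiener A (dc (fourier f)) f1 ->
  (forall k b, modc (fourier f k) <= B * expR (- (c * `|kdir b k|%:~R))) ->
  forall N, ip (fun x => f x - rtp N (fourier f) x) (fun x => f x - rtp N (fourier f) x) +
     ip (fun x => f1 x - rtp N (dc (fourier f)) x)
        (fun x => f1 x - rtp N (dc (fourier f)) x) <= B ^+ 2 * Z * expR (- (c * N%:R)).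
Proof.
move=> c0; have [D D0 HD] := bracket_exp_bounded c0.
have [Z hZ] := @sum_bracket_bounded R 2 ltac:(by rewrite ltr1n).
have Z0 : 0 <= Z.
  by apply: le_trans (hZ 0%N); apply: sumr_ge0 => k _; rewrite invr_ge0 powR_ge0.
have cell0 := @cell_gt0 R.
exists (2 * cell * D * Z); first by apply: mulr_ge0 => //; apply: mulr_ge0 => //; rewrite mulr_ge0// ltW.
move=> A B f f1 wf wf1 hdec N.
pose X := B ^+ 2 * expR (- (c * N%:R)).
have X0 : 0 <= X by rewrite mulr_ge0 ?sqr_ge0 ?expR_ge0.
have key k : k \notin boxseq N ->
    bracket k * modc (fourier f k) ^+ 2 <= X * D * (bracket k `^ 2)^-1.
  move=> kN.
  have [b [hb1 hb2]] : exists b, `|kdir (~~ b) k| <= `|kdir b k| /\ N%:Z <= `|kdir b k|.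
    move: kN; rewrite mem_boxseq negb_and -!ltNge /kdir => kN.
    have [k12|k12] := leP `|k.2| `|k.1|; [exists true|exists false]; split => //=.
    - by case/orP: kN => /ltW// h; exact: le_trans h _.
    - exact: ltW.
    - by case/orP: kN => /ltW// h; apply: le_trans h (ltW k12).
  have b0 := @bracket_gt0 R k.
  rewrite powR_mulrn ?(ltW b0)// ler_pdivlMr ?exprn_gt0//.
  have := HD k b hb1; have := hdec k b; set m : R := _%:~R => h1 h2.
  have hN : expR (- (c * m)) <= expR (- (c * N%:R)).
    rewrite ler_expR lerN2 ler_pM2l// /m -[N%:R]/((N%:Z)%:~R) ler_int; exact: hb2.
  have e0 := @expR_gt0 R (- (c * m)).
  have h3 : modc (fourier f k) ^+ 2 <= (B * expR (- (c * m))) ^+ 2.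
    by rewrite lerXn2r ?nnegrE ?modc_ge0// (le_trans (modc_ge0 _) h1).
  apply: le_trans (_ : bracket k ^+ 3 * (B * expR (- (c * m))) ^+ 2 <= _).
    have -> : bracket k * modc (fourier f k) ^+ 2 * bracket k ^+ 2 =
      bracket k ^+ 3 * modc (fourier f k) ^+ 2 by ring.
    by rewrite ler_pM2l// exprn_gt0.
  have -> : bracket k ^+ 3 * (B * expR (- (c * m))) ^+ 2 =
     (B ^+ 2 * expR (- (c * m))) * (bracket k ^+ 3 * expR (- (c * m))) by ring.
  apply: ler_pM => //.
  - by rewrite mulr_ge0 ?sqr_ge0// ltW.
  - by rewrite mulr_ge0 ?exprn_ge0 ?(ltW b0)// ltW.
  - by rewrite /X ler_wpM2l// sqr_ge0.
have tail (a : int * int -> R[i]) : (forall k, modc (a k) ^+ 2 <= bracket k * modc (fourier f k) ^+ 2) ->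
    forall M, (N <= M)%N -> \sum_(k <- boxseq M | k \notin boxseq N) modc (a k) ^+ 2 <= X * D * Z.
  move=> ha M _; apply: le_trans (_ : \sum_(k <- boxseq M) X * D * (bracket k `^ 2)^-1 <= _).
    rewrite big_mkcond; apply: ler_sum => k _; case: ifP => kN.
      by apply: le_trans (ha k) _; exact: key.
    by rewrite mulr_ge0 ?invr_ge0 ?powR_ge0// mulr_ge0.
  by rewrite -mulr_sumr ler_wpM2l// mulr_ge0.
have t0 := wiener_ip_tail wf (tail (fourier f) _).
have t1 := wiener_ip_tail wf1 (tail (dc (fourier f)) _).
have -> : B ^+ 2 * (2 * cell * D * Z) * expR (- (c * N%:R)) =
  cell * (X * D * Z) + cell * (X * D * Z) by rewrite /X; ring.
apply: lerD.
  apply: t0 => k; rewrite -[X in X <= _]mul1r ler_wpM2r ?sqr_ge0//; exact: bracket_ge1.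
apply: t1 => k; rewrite modc_dc exprMn ler_wpM2r ?sqr_ge0//.
rewrite (real_normK (num_real _)) /bracket /sqnormk.
by have := sqr_ge0 (k.2%:~R : R); clear; lra.
Qed.

End ContourShift.

(** * Error estimates *)

Section ErrorEstimates.
Context {R : realType}.
Implicit Types (f g : R * R -> R) (A alpha r T M delta : R) (u ut uN : R -> R * R -> R).
Implicit Types (k : int * int) (x : R * R).

Lemma C1_Hper_regular alpha r T : 0 < alpha -> 2 + alpha < r ->
  exists2 Z : R, 0 <= Z & forall u ut M, C1_Hper r T u ut ->
    (forall t, 0 <= t <= T -> Hnorm r (u t) <= M) -> 0 <= M ->
    forall t, 0 <= t <= T ->
    exists f1 g g1, regular (Z + M ^+ 2) alpha (u t) f1 g g1.
Proof.
move=> a0 ra; have p1 : 1 < r - 1 - alpha by lra.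
have [Z hZ] := @sum_bracket_bounded R _ p1.
exists Z.
  by apply: le_trans (hZ 0%N); apply: sumr_ge0 => k _; rewrite invr_ge0 powR_ge0.
move=> u ut M [hH _] hM M0 t tT; have [h1 h2 _ _] := hH t tT.
by apply: (Hper_regular a0 h1 h2 hZ) => //; exact: hM.
Qed.

Lemma error_split N f g : bm f -> XN N g ->
  ip (fun x => f x - g x) (fun x => f x - g x) <=
  2 * ip (fun x => f x - rtp N (fourier f) x) (fun x => f x - rtp N (fourier f) x) +
  2 * ip (fun x => rtp N (fourier f) x - g x) (fun x => rtp N (fourier f) x - g x).
Proof.
move=> bf hg; have bg := XN_bm hg; have br := @bm_rtp R N (fourier f).
have := ip_sqrD (bmB bf br) (bmB br bg); congr (ip _ _ <= _); apply/funext => x;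
by rewrite addrA subrK.
Qed.

Lemma powR_rate_sqr (N : nat) r : (1 <= N)%N ->
  (N%:R `^ (- r)) ^+ 2 * N%:R `^ (2 * r) = 1 :> R.
Proof.
move=> N1; have N0 : 0 < N%:R :> R by rewrite ltr0n.
rewrite -powR_mulrn ?powR_ge0// -powRrM -powRD_gt0//.
by rewrite (_ : - r * 2 + 2 * r = 0) ?powRr0//; ring.
Qed.

Lemma semidiscrete_rate alpha r T M : 0 < alpha -> 2 + alpha < r -> 0 < T ->
  exists C : R, forall (u0 : R * R -> R) u ut, C1_Hper r T u ut ->
    is_solution alpha T u0 u ut -> C1_norm r T u ut = M ->
    forall (N : nat) uN, (1 <= N)%N -> semidiscrete alpha T N u0 uN ->
    forall t, 0 <= t <= T ->
      L2norm (fun x => u t x - uN t x) <= C * N%:R `^ (- r).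
Proof.
move=> a0 ra T0; have r0 : 0 <= r by lra.
(* A negative [M] is the norm of no solution, so any constant will do. *)
have [M0|M0] := leP 0 M; last first.
  exists 0 => u0 u ut hC _ hM; have tb : 0 <= (0 : R) <= T by rewrite lexx ltW.
  have [h _] := C1_norm_ge hC tb; have := Hnorm_ge0 r (u 0).
  by move: h; rewrite hM => h1 h2; have := le_trans h2 h1; rewrite leNgt M0.
have [Z Z0 hreg] := @C1_Hper_regular alpha r T a0 ra.
pose A := Z + M ^+ 2; have A0 : 0 <= A by rewrite addr_ge0// sqr_ge0.
have [C0 C00 hC0] := @regular_rate R A alpha r M a0 r0 A0 M0.
have cell0 := @cell_gt0 R.
(* From |u - u_N|^2 <= 2 |rho|^2 + 2 |theta|^2, with the Gronwall bound at delta = C0 N^(-2r) and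
   the common factor N^(-2r) removed. *)
pose C1 := 2 * (cell * M ^+ 2) + 2 * (A * C0 * T * expR (3 * A * T)).
exists (Num.sqrt C1) => u0 u ut hC hsol hM N uN N1 hN t tT.
have hMt s : 0 <= s <= T -> Hnorm r (u s) <= M /\ Hnorm r (ut s) <= M.
  by move=> sT; rewrite -hM; exact: C1_norm_ge.
have hR := hreg u ut M hC (fun s sT => proj1 (hMt s sT)) M0.
have N0 : 0 < N%:R :> R by rewrite ltr0n.
have X0 : 0 < N%:R `^ (2 * r) :> R by rewrite powR_gt0.
set X := N%:R `^ (2 * r) in X0.
have [bu _] := bm_C1 hC tT.
have rho : X * ip (fun x => u t x - rtp N (fourier (u t)) x)
                  (fun x => u t x - rtp N (fourier (u t)) x) <= cell * M ^+ 2.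
  have [f1 [g [g1 reg]]] := hR t tT.
  apply: (wiener_ip_tailM (reg_u reg) X0) => n _.
  have [[[_ hu] _ _ _] [hM1 _]] := (hC.1 t tT, hMt t tT).
  exact: Hper_tail r0 hu hM1 (uniq_boxseq n) N1.
have tail s : 0 < s <= T -> tail_norm N (u s) <= C0 / X.
  move=> /andP[s0 sT]; have sb : 0 <= s <= T by rewrite (ltW s0).
  have [f1 [g [g1 reg]]] := hR s sb.
  have [[_ hu] _ [_ hut] _] := hC.1 s sb; have [hM1 hM2] := hMt s sb.
  have [E1 _ E3] := regularE reg.
  rewrite ler_pdivlMr// mulrC /tail_norm -E1.
  apply: (hC0 _ (ut s) _ _ _ reg) => //; first exact: (bm_C1 hC sb).2.
  by move=> x xO; rewrite E3 E1; apply: hsol.1 => //; rewrite s0.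
have delta0 : 0 <= C0 / X by rewrite divr_ge0// ltW.
have theta := energy_estimate r0 A0 delta0 (ltW T0) hC hsol hR tail hN tT.
have := error_split bu (hN.1 t tT) => /le_trans split_le.
have e : ip (fun x => u t x - uN t x) (fun x => u t x - uN t x) <= C1 * (N%:R `^ (- r)) ^+ 2.
  have XE : X^-1 = (N%:R `^ (- r)) ^+ 2.
    by apply: (mulIf (lt0r_neq0 X0)); rewrite mulVf ?(lt0r_neq0 X0)// (powR_rate_sqr r N1).
  have -> : C1 * (N%:R `^ (- r)) ^+ 2 = 2 * (cell * M ^+ 2 / X) +
      2 * (A * (C0 / X) * T * expR (3 * A * T)) by rewrite -XE /C1; ring.
  by apply: split_le; apply: lerD; rewrite ler_pM2l// ler_pdivlMr// mulrC.
have C10 : 0 <= C1.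
  apply: addr_ge0; first by apply: mulr_ge0 => //; rewrite mulr_ge0 ?sqr_ge0// ltW.
  by rewrite !mulr_ge0 ?expR_ge0// ltW.
apply: le_trans (ler_wsqrtr e) _.
by rewrite sqrtrM// sqrtr_sqr ger0_norm ?powR_ge0.
Qed.


Lemma semidiscrete_exponential alpha r T (u0 : R * R -> R) u ut :
  0 < alpha -> 2 + alpha < r -> 0 < T -> C1_Hper r T u ut ->
  is_solution alpha T u0 u ut -> unif_analytic T u ->
  exists C sigma : R, [/\ 0 < C, 0 < sigma &
    forall (N : nat) uN, (1 <= N)%N -> semidiscrete alpha T N u0 uN ->
    forall t, 0 <= t <= T ->
      L2norm (fun x => u t x - uN t x) <= C * expR (- sigma * N%:R)].
Proof.
move=> a0 ra T0 hC hsol [sigma0 [B [s0 hF]]]; have r0 : 0 <= r by lra.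
pose M := C1_norm r T u ut.
have M0 : 0 <= M.
  have tb : 0 <= (0 : R) <= T by rewrite lexx ltW.
  exact: le_trans (Hnorm_ge0 r (u 0)) (C1_norm_ge hC tb).1.
have [Z Z0 hreg] := @C1_Hper_regular alpha r T a0 ra.
have hR := hreg u ut M hC (fun s sT => (C1_norm_ge hC sT).1) M0.
set A := Z + M ^+ 2 in hR; have A0 : 0 <= A by rewrite addr_ge0// sqr_ge0.
pose c := sigma0 / 8; have c0 : 0 < c by rewrite divr_gt0.
have [Z' Z'0 htail] := exponential_tail c0.
pose D := (4 * `|B|) ^+ 2 * Z'; have D0 : 0 <= D by rewrite mulr_ge0// sqr_ge0.
have tail N s : 0 <= s <= T -> tail_norm N (u s) <= D * expR (- (c * N%:R)).
  move=> sT; have [f1 [g [g1 reg]]] := hR s sT; have [E1 _ _] := regularE reg.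
  have [F [anF FE FB]] := hF s sT.
  rewrite /tail_norm -E1; apply: (htail _ _ _ _ (reg_u reg) (reg_u1 reg)) => k b.
  apply: (analytic_fourier_decay k b (reg_u reg) anF s0 (normr_ge0 B) FE) => z zs.
  exact: le_trans (FB z zs) (ler_norm B).
pose C1 := 2 * D + 2 * (A * D * T * expR (3 * A * T)).
have C10 : 0 <= C1.
  by rewrite addr_ge0//; rewrite !mulr_ge0 ?expR_ge0// ltW.
(* Adding 1 ensures positivity even if [C1] vanishes; the rate is halved by the square root. *)
exists (Num.sqrt C1 + 1), (c / 2); split; [|by rewrite divr_gt0|].
  by rewrite ltr_wpDl// sqrtr_ge0.
move=> N uN N1 hN t tT; have [bu _] := bm_C1 hC tT.
have delta0 : 0 <= D * expR (- (c * N%:R)) by rewrite mulr_ge0// expR_ge0.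
have tail' s : 0 < s <= T -> tail_norm N (u s) <= D * expR (- (c * N%:R)).
  by move=> /andP[s0' sT]; apply: tail; rewrite (ltW s0').
have theta := energy_estimate r0 A0 delta0 (ltW T0) hC hsol hR tail' hN tT.
have := error_split bu (hN.1 t tT) => /le_trans split_le.
have EE : expR (- (c * N%:R)) = expR (- (c / 2) * N%:R) ^+ 2.
  by rewrite -expRM_natl; congr expR; field.
have rho : ip (fun x => u t x - rtp N (fourier (u t)) x)
              (fun x => u t x - rtp N (fourier (u t)) x) <= D * expR (- (c * N%:R)).
  by apply: le_trans (tail N t tT); rewrite /tail_norm lerDl; exact: ip_ge0.
have e : ip (fun x => u t x - uN t x) (fun x => u t x - uN t x) <=
    C1 * expR (- (c / 2) * N%:R) ^+ 2.
  have -> : C1 * expR (- (c / 2) * N%:R) ^+ 2 = 2 * (D * expR (- (c * N%:R))) +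
      2 * (A * (D * expR (- (c * N%:R))) * T * expR (3 * A * T)).
    by rewrite -EE /C1; ring.
  by apply: split_le; apply: lerD; rewrite ler_pM2l.
apply: le_trans (ler_wsqrtr e) _.
rewrite sqrtrM// sqrtr_sqr ger0_norm ?expR_ge0// ler_wpM2r ?expR_ge0//.
by rewrite lerDl.
Qed.

End ErrorEstimates.

Theorem theorem4p5 (R : realType) :
  exists C : R -> R -> R -> R -> R -> R,
  forall (alpha r T K : R) (u0 : R * R -> R) (u ut : R -> R * R -> R),
    0 < alpha -> alpha <= 2 -> 2 + alpha < r -> 0 < T ->
    C1_Hper r T u ut ->
    is_solution alpha T u0 u ut ->
    (1 + (2^-1)%:E * ereal_sup [set Linfnorm (dx1 (u t)) | t in `[0%R, T]]
       <= K%:E)%E ->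
    (forall (N : nat) (uN : R -> R * R -> R), (1 <= N)%N ->
       semidiscrete alpha T N u0 uN ->
       forall t, 0 <= t <= T ->
         L2norm (fun x => u t x - uN t x)
           <= C T alpha r K (C1_norm r T u ut) * N%:R `^ (- r)) /\
    (unif_analytic T u -> unif_analytic T ut ->
     exists C' sigma : R, [/\ 0 < C', 0 < sigma &
       forall (N : nat) (uN : R -> R * R -> R), (1 <= N)%N ->
         semidiscrete alpha T N u0 uN ->
         forall t, 0 <= t <= T ->
           L2norm (fun x => u t x - uN t x)
             <= C' * expR (- sigma * N%:R)]).
Proof.
(* The constant has to be a function of the data alone, so [xget] selects an element of the set of
   constants valid for all solutions of norm [M]. By [semidiscrete_rate] this set is nonempty in
   every case considered, and the default 0 is never returned for want of an element. *)
pose P T alpha r M : set R := [set C | forall u0 u ut, C1_Hper r T u ut ->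
  is_solution alpha T u0 u ut -> C1_norm r T u ut = M ->
  forall (N : nat) uN, (1 <= N)%N -> semidiscrete alpha T N u0 uN ->
  forall t, 0 <= t <= T -> L2norm (fun x => u t x - uN t x) <= C * N%:R `^ (- r)].
exists (fun T alpha r K M => xget 0 (P T alpha r M)).
move=> alpha r T K u0 u ut a0 _ ra T0 hC hsol _; split.
  move=> N uN N1 hN t tT.
  have [C hPC] := semidiscrete_rate (C1_norm r T u ut) a0 ra T0.
  have hP : P T alpha r (C1_norm r T u ut) C by exact: hPC.
  exact: (xgetPex 0 (ex_intro _ C hP) u0 u ut hC hsol erefl N uN N1 hN t tT).
by move=> hu _; exact: semidiscrete_exponential a0 ra T0 hC hsol hu.
Qed.
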